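(* Let $\beta\ge 0$ and, for each $n\ge 1$, let $\{m_n(t)\}_{t\ge 0}$ be the Curie-Weiss empirical magnetization process at inverse temperature $\beta$, i.e. the Markov process on $E_n=\{-1,-1+\tfrac2n,\dots,1-\tfrac2n,1\}$ with generator $$\mathcal{A}_nf(x) = n \frac{1-x}{2} e^{\beta x} \left[f\left(x + \tfrac{2}{n}\right) - f(x)\right] + n \frac{1+x}{2} e^{-\beta x} \left[f\left(x - \tfrac{2}{n}\right) - f(x)\right].$$ Let $\{b_n\}_{n\geq 1}$ be a sequence of positive real numbers such that $b_n \to \infty$ and $b_n^{2} n^{-1} \to 0$. Suppose that $b_n m_n(0)$ satisfies the large deviation principle with speed $n b_n^{-2}$ on $\mathbb{R}$ with rate function $I_0$. Then the trajectories $\left\{b_n m_n(t)\right\}_{t \geq 0}$ satisfy the large deviation principle on $D_{\mathbb{R}}(\mathbb{R}^+)$ with speed $n b_n^{-2}$ and good rate function $$I(\gamma) = \begin{cases} I_0(\gamma(0)) + \int_0^\infty \mathcal{L} (\gamma(s),\dot{\gamma}(s)) \,\mathrm{d}s & \text{if } \gamma \in \mathcal{AC}, \\ \infty & \text{otherwise},\end{cases}$$ where $$\mathcal{L}(x,v) = \frac{1}{8} \left|v + 2x(1-\beta) \right|^2.$$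
   Context: $D_{\mathbb{R}}(\mathbb{R}^+)$ is the Skorohod space of càdlàg functions $\mathbb{R}^+=[0,\infty)\to\mathbb{R}$. $\mathcal{AC}$ is the set of absolutely continuous curves $\gamma:\mathbb{R}^+\to\mathbb{R}$: for every $T\ge 0$ there is $g\in L^1[0,T]$ with $\gamma(t)=\gamma(0)+\int_0^t g(s)\,\mathrm{d}s$ for $t\in[0,T]$; one writes $\dot\gamma=g$. For random variables $X_1,X_2,\dots$ on a Polish space $F$, a function $I:F\to[0,\infty]$ is a good rate function if $\{x : I(x)\le c\}$ is compact for every $c\ge 0$. The sequence $\{X_n\}$ satisfies the large deviation principle with speed (rate) $r(n)$ and good rate function $I$ if for every closed $A\subseteq F$, $\limsup_{n} \frac{1}{r(n)}\log \mathbb{P}[X_n\in A]\le -\inf_{x\in A} I(x)$, and for every open $U\subseteq F$, $\liminf_{n} \frac{1}{r(n)}\log \mathbb{P}[X_n\in U]\ge -\inf_{x\in U} I(x)$. The rate function $I_0$ is a good rate function in this sense. *)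

(* Defs.v *)
From HB Require Import structures.
From mathcomp Require Import all_boot all_order all_algebra.
From mathcomp Require Import ring lra.
From mathcomp Require Import all_classical all_reals all_analysis measurable_realfun.


Set Implicit Arguments.
Unset Strict Implicit.
Unset Printing Implicit Defensive.

Import Order.TTheory GRing.Theory Num.Theory.
Import numFieldNormedType.Exports.

Local Open Scope classical_set_scope.
Local Open Scope ring_scope.

(* A function on [0, +oo[ is represented by its extension to R that is
   constant on ]-oo, 0]; this makes Leibniz equality on [skorohod R] coincide
   with equality of functions on [0, +oo[. *)
Record skorohod (R : realType) := Skorohod {
  traj :> R -> R;
  traj_rcont : forall t, 0 <= t -> traj s @[s --> t^'+] --> traj t;
  traj_llim : forall t, 0 < t -> cvg (traj s @[s --> t^'-]);
  traj_neg : forall t, t < 0 -> traj t = traj 0 }.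

HB.instance Definition _ (R : realType) := gen_eqMixin (skorohod R).
HB.instance Definition _ (R : realType) := gen_choiceMixin (skorohod R).

Section skorohod_topology.
Context {R : realType}.
Implicit Types (x y z : skorohod R) (l : R -> R) (N e : R).

(* The values of [l] outside of [0, +oo[ are irrelevant. *)
Definition time_change l : Prop :=
  {in `[0, +oo[ &, {homo l : s t / s < t}} /\ set_surj `[0, +oo[ `[0, +oo[ l /\
  set_fun `[0, +oo[ `[0, +oo[ l.

Definition skorohod_near N e : set (skorohod R * skorohod R) :=
  [set xy : skorohod R * skorohod R | exists l, [/\ time_change l,
    forall s : R, 0 <= s -> `|l s - s| <= e &
    forall s : R, 0 <= s <= N -> `|xy.2 (l s) - xy.1 s| <= e]].

Definition skorohod_ent : set_system (skorohod R * skorohod R) :=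
  [set A | exists N e, 0 < e /\ skorohod_near N e `<=` A].

Lemma time_change_id : time_change id.
Proof. by split=> //; split=> // t t0; exists t. Qed.

Lemma time_change_ge0 l s : time_change l -> 0 <= s -> 0 <= l s.
Proof.
move=> [_ [_ lf]] s0; have := lf s; rewrite /= !in_itv/= !andbT; exact.
Qed.

Lemma time_change_comp l m :
  time_change l -> time_change m -> time_change (m \o l).
Proof.
move=> tl tm; split; [|split].
- move=> s t; rewrite !in_itv/= !andbT => s0 t0 st.
  apply: tm.1; rewrite ?in_itv/= ?andbT ?time_change_ge0//.
  by apply: tl.1 => //; rewrite in_itv/= andbT.
- move=> t /tm.2.1[u /tl.2.1[v v0 <-] <-]; by exists v.
- by move=> t /tl.2.2 /tm.2.2.
Qed.

Lemma time_change_inv l : time_change l -> exists m, time_change m /\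
  forall t, 0 <= t -> l (m t) = t.
Proof.
move=> tl.
have /choice[m mP] : forall t, exists u, 0 <= t -> 0 <= u /\ l u = t.
  move=> t; case: (leP 0 t) => t0; last by exists 0.
  have : `[0, +oo[%classic t by rewrite /= in_itv/= t0.
  by move=> /tl.2.1[u]; rewrite /= in_itv/= andbT => u0 <-; exists u.
exists m; split; last by move=> t /mP[].
split; [|split].
- move=> s t; rewrite !in_itv/= !andbT => s0 t0 st.
  have [ms0 lms] := mP _ s0; have [mt0 lmt] := mP _ t0.
  rewrite ltNge le_eqVlt; apply/negP => /orP[/eqP E|E].
    by move: st; rewrite -lms -lmt E ltxx.
  have := tl.1 _ _ _ _ E; rewrite !in_itv/= !andbT lms lmt.
  by move=> /(_ mt0 ms0) /lt_trans -/(_ _ st); rewrite ltxx.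
- move=> t; rewrite /= in_itv/= andbT => t0.
  have lt0 := time_change_ge0 tl t0; exists (l t); first by rewrite /= in_itv/= andbT.
  have [u0 lu] := mP _ lt0.
  case: (ltgtP (m (l t)) t) => // E; have := tl.1 _ _ _ _ E.
    by rewrite !in_itv/= !andbT lu ltxx => /(_ u0 t0).
  by rewrite !in_itv/= !andbT lu ltxx => /(_ t0 u0).
- by move=> t; rewrite /= !in_itv/= !andbT => /mP[].
Qed.

Lemma skorohod_nearS N N' e e' : N' <= N -> e <= e' ->
  skorohod_near N e `<=` skorohod_near N' e'.
Proof.
move=> NN ee [x y] [l [tl l1 l2]]; exists l; split => // s.
  by move=> /l1 /le_trans; apply.
move=> /andP[s0 sN]; apply: le_trans (l2 s _) ee.
by rewrite s0 (le_trans sN NN).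
Qed.

Lemma skorohod_ent_filter : Filter skorohod_ent.
Proof.
split.
- by exists 0, 1.
- move=> A B [N [e [e0 NA]]] [M [f [f0 MB]]].
  exists (Num.max N M), (Num.min e f); split; first by rewrite lt_min e0.
  move=> xy xyn; split.
    by apply: NA; apply: skorohod_nearS xyn; rewrite ?le_max ?ge_min lexx ?orbT.
  by apply: MB; apply: skorohod_nearS xyn; rewrite ?le_max ?ge_min lexx ?orbT.
- by move=> A B AB [N [e [e0 NA]]]; exists N, e; split=> // ? /NA /AB.
Qed.

Lemma skorohod_ent_diagonal A : skorohod_ent A -> diagonal `<=` A.
Proof.
move=> [N [e [e0 NA]]] [x y]; rewrite /diagonal /= => ->; apply: NA.
exists id; split; first exact: time_change_id.
  by move=> s _; rewrite subrr normr0 ltW.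
by move=> s _; rewrite subrr normr0 ltW.
Qed.

Lemma skorohod_ent_inv A : skorohod_ent A -> skorohod_ent A^-1%relation.
Proof.
move=> [N [e [e0 NA]]]; exists (N + e), e; split => // -[x y] [l [tl l1 l2]].
apply: NA; have [m [tm lm]] := time_change_inv tl.
have m1 s : 0 <= s -> `|m s - s| <= e.
  move=> s0; have := l1 _ (time_change_ge0 tm s0).
  by rewrite lm// distrC.
exists m; split => // s /andP[s0 sN] /=; have ms0 := time_change_ge0 tm s0.
rewrite distrC -[X in y X](lm _ s0); apply: l2; rewrite ms0/=.
have := m1 _ s0; rewrite ler_norml => /andP[_]; rewrite lerBlDr addrC.
by move=> /le_trans; apply; rewrite lerD2r.
Qed.

Lemma skorohod_ent_split A : skorohod_ent A ->
  exists2 B, skorohod_ent B & (B \; B `<=` A)%relation.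
Proof.
move=> [N [e [e0 NA]]]; exists (skorohod_near (N + e) (e / 2)).
  by exists (N + e), (e / 2); split; rewrite ?divr_gt0.
move=> [x z] [y /= [l [tl l1 l2]] [m [tm m1 m2]]]; apply: NA.
have e2 : e / 2 <= e by lra.
exists (m \o l); split; first exact: time_change_comp.
  move=> s s0 /=; have ls0 := time_change_ge0 tl s0.
  rewrite -[m _ - s](subrKA (l s)) (splitr e) (le_trans (ler_normD _ _))//.
  by rewrite lerD ?m1 ?l1.
move=> s /andP[s0 sN] /=; have ls0 := time_change_ge0 tl s0.
rewrite -[z _ - _](subrKA (y (l s))) (splitr e) (le_trans (ler_normD _ _))//.
rewrite lerD//; last by apply: l2; rewrite s0 (le_trans sN)// lerDl ltW.
apply: m2; rewrite ls0/=; have := l1 _ s0.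
rewrite ler_norml => /andP[_]; rewrite lerBlDr addrC => /le_trans; apply.
by rewrite lerD.
Qed.

End skorohod_topology.

HB.instance Definition _ (R : realType) := @isUniform.Build (skorohod R)
  skorohod_ent skorohod_ent_filter skorohod_ent_diagonal skorohod_ent_inv
  skorohod_ent_split.

(* The topology is the one in which [y k] converges to [x] iff there are time
   changes [l k] with sup_(s >= 0) |l k s - s| --> 0 and, for every [N],
   sup_(0 <= s <= N) |y k (l k s) - x s| --> 0 (Jacod and Shiryaev, Limit
   Theorems for Stochastic Processes, Theorem VI.1.14). *)
Lemma skorohod_cvgP (R : realType) (y : nat -> skorohod R) (x : skorohod R) :
  y @ \oo --> x <->
  exists l : nat -> R -> R, [/\ forall k, time_change (l k),
    forall e : R, 0 < e -> \forall k \near \oo,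
      forall s : R, 0 <= s -> `|l k s - s| <= e &
    forall N e : R, 0 < e -> \forall k \near \oo,
      forall s : R, 0 <= s <= N -> `|y k (l k s) - x s| <= e].
Proof.
split=> [yx|[l [tl l1 l2]]]; last first.
  apply/cvg_entourageP => A [N [e [e0 NA]]]; rewrite near_simpl.
  near=> k; apply: NA; exists (l k); split => //.
    by near: k; exact: l1.
  by near: k; exact: l2.
pose G j k := skorohod_near (j%:R : R) (j.+1%:R^-1) (x, y k).
have Gnear j : \forall k \near \oo, G j k.
  move/cvg_entourageP : yx; apply.
  by exists j%:R, j.+1%:R^-1; split; rewrite // invr_gt0 ltr0n.
pose c k := \max_(j < k.+1 | `[< G j k >]) (j : nat).
have /choice[l lP] : forall k, exists l, time_change l /\
    (G (c k) k -> (forall s : R, 0 <= s -> `|l s - s| <= (c k).+1%:R^-1) /\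
    (forall s : R, 0 <= s <= (c k)%:R -> `|y k (l s) - x s| <= (c k).+1%:R^-1)).
  move=> k; case: (pselect (G (c k) k)) => [[l [tl l1 l2]]|nG].
    by exists l.
  by exists id; split => //; exact: time_change_id.
have cP J : \forall k \near \oo, (J <= c k)%N /\ G (c k) k.
  near=> k.
  have Jk : (J < k.+1)%N by rewrite ltnS; near: k; exact: nbhs_infty_ge.
  have GJk : `[< G (Ordinal Jk) k >].
    have GJ : G J k by near: k; exact: Gnear.
    exact/asboolP.
  split; first exact: (@leq_bigmax_cond _ _ (fun j : 'I_k.+1 => j : nat) _ GJk).
  have [|j jG cE] := @eq_bigmax_cond _ (fun j : 'I_k.+1 => `[< G j k >])
     (fun j => j : nat).
    by apply/card_gt0P; exists (Ordinal Jk).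
  by rewrite /c (eq_bigl _ _ (fun _ => erefl)) cE; exact/asboolP.
have small (e : R) : 0 < e -> exists J, forall c, (J <= c)%N -> c.+1%:R^-1 <= e.
  move=> e0; exists (Num.truncn e^-1) => i Ji.
  rewrite invf_ple ?posrE ?ltr0n//; apply: le_trans (ltW (truncnS_gt _)) _.
  by rewrite ler_nat ltnS.
exists l; split.
- by move=> k; have [] := lP k.
- move=> e /small[J Je]; near=> k => s s0.
  have [Jc Gc] : (J <= c k)%N /\ G (c k) k by near: k; exact: cP.
  by have [_ /(_ Gc)[+ _]] := lP k => /(_ _ s0) /le_trans; apply; exact: Je.
- move=> N e /small[J Je]; near=> k => s /andP[s0 sN].
  have [Jc Gc] : (J <= c k)%N /\ G (c k) k by near: k; exact: cP.
  have [Nc _] : (Num.truncn N < c k)%N /\ G (c k) k by near: k; exact: cP.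
  have [_ /(_ Gc)[_ +]] := lP k => /(_ s); rewrite s0/= => h.
  apply: le_trans (h _) (Je _ Jc); apply: (le_trans sN).
  by apply: (le_trans (ltW (truncnS_gt _))); rewrite ler_nat.
Unshelve. all: by end_near. Qed.

Local Open Scope ereal_scope.

Definition good_rate_function (R : realType) (F : topologicalType)
    (I : F -> \bar R) : Prop :=
  (forall x, 0 <= I x) /\
  forall c : R, (0 <= c)%R -> compact [set x | I x <= c%:E].

(* [X 0] plays no role. The random variables may live on different
   probability spaces; [lne 0 = -oo], and the infimum over the empty set is
   [+oo]. *)
Definition LDP (R : realType) (F : topologicalType) (d : nat -> measure_display)
    (T : forall n, measurableType (d n)) (P : forall n, probability (T n) R)
    (X : forall n, T n -> F) (r : nat -> R) (I : F -> \bar R) : Prop :=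
  [/\ good_rate_function I,
    forall n, (0 < n)%N -> forall U, open U -> measurable (X n @^-1` U),
    forall A, closed A ->
      limn_esup (fun n => (r n)^-1%:E * lne (P n (X n @^-1` A))) <=
      - ereal_inf (I @` A) &
    forall U, open U ->
      - ereal_inf (I @` U) <=
      limn_einf (fun n => (r n)^-1%:E * lne (P n (X n @^-1` U)))].

Local Close Scope ereal_scope.

(* The state space is the range of [S], which is meant to be injective; the
   values of functions outside of it must not matter to the generator [A]. The
   last clause is the Markov property with respect to the natural filtration,
   which for a finite state space amounts to elementary conditioning on finitely
   many past values. Nothing is required of [X w t] for t < 0. *)
Definition markov_process (R : realType) (N : nat) (S : 'I_N -> R)
    (A : (R -> R) -> R -> R) (d : measure_display) (T : measurableType d)
    (P : probability T R) (X : T -> R -> R) : Prop :=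
  [/\ forall t, 0 <= t -> measurable_fun setT (X ^~ t),
    forall w t, 0 <= t -> exists i, X w t = S i &
    exists p : R -> 'M[R]_N,
    [/\ forall t, 0 <= t -> (forall i j, 0 <= p t i j) /\
          (forall i, \sum_j p t i j = 1),
      p 0 = 1%:M /\
        (forall s t, 0 <= s -> 0 <= t -> p (s + t) = p s *m p t),
      forall (f : R -> R) i,
        t^-1 * (\sum_j p t i j * f (S j) - f (S i)) @[t --> 0^'+]
          --> A f (S i) &
      forall (k : nat) (u : nat -> R) (x : nat -> 'I_N) (t : R) (j : 'I_N),
        0 <= u 0%N -> (forall i, (i < k)%N -> u i <= u i.+1) -> 0 <= t ->
        P [set w | (forall i, (i <= k)%N -> X w (u i) = S (x i)) /\
                   X w (u k + t) = S j] =
        (P [set w | forall i, (i <= k)%N -> X w (u i) = S (x i)] *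
         (p t (x k) j)%:E)%E]].

Definition cw_state (R : realType) (n : nat) (k : 'I_n.+1) : R :=
  -1 + k%:R * (2 / n%:R).

Definition cw_generator (R : realType) (beta : R) (n : nat) (f : R -> R)
    (x : R) : R :=
  n%:R * ((1 - x) / 2) * expR (beta * x) * (f (x + 2 / n%:R) - f x) +
  n%:R * ((1 + x) / 2) * expR (- beta * x) * (f (x - 2 / n%:R) - f x).

Definition cw_process (R : realType) (beta : R) (n : nat) (d : measure_display)
    (T : measurableType d) (P : probability T R) (m : T -> skorohod R) : Prop :=
  markov_process (@cw_state R n) (cw_generator beta n) P
    (fun w => m w : R -> R).

Section skorohod_scale.
Context {R : realType} (c : R) (x : skorohod R).

Let scale_rcont t : 0 <= t -> c * x s @[s --> t^'+] --> c * x t.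
Proof. by move=> t0; apply: cvgM; [exact: cvg_cst|exact: traj_rcont]. Qed.

Let scale_llim t : 0 < t -> cvg (c * x s @[s --> t^'-]).
Proof. by move=> t0; apply: is_cvgM; [exact: is_cvg_cst|exact: traj_llim]. Qed.

Let scale_neg t : t < 0 -> c * x t = c * x 0.
Proof. by move=> t0; rewrite traj_neg. Qed.

Definition skorohod_scale : skorohod R :=
  @Skorohod R (fun t => c * x t) scale_rcont scale_llim scale_neg.

End skorohod_scale.

Local Notation leb := lebesgue_measure.

Definition primitive_on (R : realType) (T : R) (x g : R -> R) : Prop :=
  leb.-integrable `[0, T] (EFin \o g) /\
  forall t, 0 <= t <= T -> x t = x 0 + \int[leb]_(s in `[0, t]) g s.

Definition abs_continuous (R : realType) (x : R -> R) : Prop :=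
  forall T, 0 <= T -> exists g, primitive_on T x g.

(* The derivative of an absolutely continuous curve, unique up to a null set. *)
Definition velocity (R : realType) (x : R -> R) : R -> R :=
  get [set g : R -> R | forall T, 0 <= T -> primitive_on T x g].

Lemma integrable_disjU (d : measure_display) (T : measurableType d)
    (R : realType) (mu : {measure set T -> \bar R}) (A B : set T)
    (f : T -> \bar R) : measurable A -> measurable B -> [disjoint A & B] ->
  mu.-integrable A f -> mu.-integrable B f -> mu.-integrable (A `|` B) f.
Proof.
move=> mA mB AB /integrableP[m1 i1] /integrableP[m2 i2].
have mU := (measurable_funU _ mA mB).2 (conj m1 m2).
apply/integrableP; split => //; rewrite ge0_integral_setU//.
  exact: lte_add_pinfty.
exact: measurableT_comp mU.
Qed.

Lemma velocityP (R : realType) (x : R -> R) : abs_continuous x ->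
  forall T, 0 <= T -> primitive_on T x (velocity x).
Proof.
move=> xac.
suff : [set g : R -> R | forall T, 0 <= T -> primitive_on T x g] !=set0.
  by move=> /getPex.
have /choice[g gP] : forall n : nat, exists g : R -> R, primitive_on n%:R x g.
  by move=> n; exact: xac.
pose G s := g `|Num.ceil s|%N s.
have Gg n s : s \in `]n%:R, n.+1%:R] -> G s = g n.+1 s.
  rewrite in_itv/= => ns; rewrite /G (@ceil_def _ _ n.+1%:Z)//.
  by rewrite -[in X in X - 1]addn1 PoszD addrK.
have GnP n : primitive_on (n%:R : R) x G.
  elim: n => [|n [IHi IH]].
    split; last first.
      move=> t; rewrite -eq_le => /eqP <-.
      by rewrite set_itv1 Rintegral_set1 addr0.
    rewrite /= set_itv1; apply/integrableP; split; first exact: measurable_fun_set1.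
    by rewrite integral_set1.
  have [gi gx] := gP n.+1.
  have nn1 : n%:R <= n.+1%:R :> R by rewrite ler_nat.
  have Gi1 : leb.-integrable `]n%:R, n.+1%:R] (EFin \o G).
    have : leb.-integrable `]n%:R, n.+1%:R] (EFin \o g n.+1).
      by apply: integrableS gi => //; apply: subset_itv; rewrite bnd_simp.
    by apply: eq_integrable => // s /set_mem /Gg /= ->.
  have Gi : leb.-integrable `[0, n.+1%:R] (EFin \o G).
    rewrite (@itv_bndbnd_setU _ _ _ (BRight n%:R)) ?bnd_simp//.
    apply: integrable_disjU => //; apply/disj_setPS => y [/=].
    by rewrite 2!in_itv/= => /andP[_ yx] /andP[]; rewrite ltNge yx.
  split=> // t /andP[t0 tn1].
  have [tn|nt] := leP t n%:R; first by apply: IH; rewrite t0.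
  have Git : leb.-integrable `[0, t] (EFin \o G).
    by apply: integrableS Gi => //; apply: subset_itvl; rewrite bnd_simp.
  have git : leb.-integrable `[0, t] (EFin \o g n.+1).
    by apply: integrableS gi => //; apply: subset_itvl; rewrite bnd_simp.
  have := @Rintegral_itvB _ G (BLeft 0) (BRight t) n%:R Git.
  rewrite !bnd_simp => /(_ (ler0n _ _) (ltW nt)) GE.
  have := @Rintegral_itvB _ (g n.+1) (BLeft 0) (BRight t) n%:R git.
  rewrite !bnd_simp => /(_ (ler0n _ _) (ltW nt)) gE.
  have E : \int[leb]_(s in `]n%:R, t]) G s = \int[leb]_(s in `]n%:R, t]) g n.+1 s.
    apply: eq_Rintegral => s /set_mem /=; rewrite in_itv/= => /andP[ns st].
    by apply: Gg; rewrite in_itv/= ns (le_trans st).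
  have := gx t; rewrite t0 tn1 => /(_ isT) xt.
  have := gx n%:R; rewrite ler0n nn1 => /(_ isT) xn.
  have := IH n%:R; rewrite ler0n lexx => /(_ isT) xn'.
  move: GE; rewrite E -gE => GE; lra.
exists G => T T0; have [Gi Gx] := GnP (Num.truncn T).+1.
have TN : T <= (Num.truncn T).+1%:R by rewrite ltW// truncnS_gt.
split; last by move=> t /andP[t0 tT]; apply: Gx; rewrite t0 (le_trans tT).
by apply: integrableS Gi => //; apply: subset_itvl; rewrite bnd_simp.
Qed.

Definition cw_lagrangian (R : realType) (beta x v : R) : R :=
  8^-1 * `|v + 2 * x * (1 - beta)| ^+ 2.

Definition cw_rate (R : realType) (beta : R) (I0 : R -> \bar R)
    (x : skorohod R) : \bar R :=
  if `[< abs_continuous x >] then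
    (I0 (x 0%R) + \int[leb]_(s in `[0%R, +oo[)
                  (cw_lagrangian beta (x s) (velocity x s))%:E)%E
  else +oo%E.

(* Main.v *)
(** With [a = 2 (1 - beta)], the factor [e^(a t)] removes the linear drift: put
    [u(t) = e^(a t) b_n m_n(t)], [r = n b_n^-2] and [V(t) = 2 int_0^t e^(2 a s) ds].
    The nonlinear generator at speed [r], applied to linear functions, converges
    to [2 q^2 - a x q], so that for slopes [q_k] constant on the cells of a time
    grid [exp (r sum_k (q_k du_k - q_k^2 dV_k))] is almost a martingale as long as
    the path stays bounded. The rate of a curve is the value at 0 of [I_0] plus the
    supremum over grids and slopes of [sum_k (q_k du_k - q_k^2 dV_k)].

    Upper bound: up to oscillations inside the cells, which are superexponentially
    rare when the mesh is small, a path is determined by its initial value and its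
    increments over the cells. Rounding these leaves finitely many classes; each
    one contains a curve polygonal with respect to [V], whose slopes give the
    exponential bound for the class.

    Lower bound: on a tube around a curve, polygonal up to a small error, the
    exponential martingale with the slopes of the curve is bounded by
    [exp (r * cost)], while on leaving the tube it is dominated by the exponential
    martingales with slopes [q + theta] and [q - theta]; hence no change of measure
    is needed.

    Goodness: curves of bounded rate have a common modulus of continuity, hence
    converge locally uniformly along ultrafilters; their velocities converge weakly
    in L^2, and the energy is lower semicontinuous. *)

Require Import Defs.
From HB Require Import structures.
From mathcomp Require Import all_boot all_order all_algebra.
From mathcomp Require Import ring lra.
From mathcomp Require Import all_classical all_reals all_analysis.
From mathcomp Require Import measurable_realfun.

Set Implicit Arguments.
Unset Strict Implicit.
Unset Printing Implicit Defensive.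

Import Order.TTheory GRing.Theory Num.Theory.
Import numFieldNormedType.Exports.

Local Open Scope classical_set_scope.
Local Open Scope ring_scope.

(** * The generator on exponential functions *)

Section exponential_bounds.
Context {R : realType}.
Implicit Types x y z : R.

(** In terms of [u(t) = e^(a t) x(t)] the Lagrangian is [|u'|^2 / (8 e^(2 a s))], so in the time
    scale [V] the cost is that of a Brownian path: a cell with increment [du] is charged
    [sup_q (q du - q^2 dV) = du^2 / (4 dV)], attained at [q = du / (2 dV)]. The slopes used below
    come from this formula.

    Two obstacles shape the proof. The generators converge uniformly only for bounded positions and
    slopes, hence the stopping. And the Markov property is given for finitely many times, hence
    exponential estimates are made on finite grids, where expectations are finite sums, with
    constants independent of the mesh; right continuity then reaches all times. For each [n] the
    grid is refined as far as [n] requires; the tolerance [eta] of the generator and the coarse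
    cells are fixed before [n] grows.

    Compactness of the sublevel sets takes the place of exponential tightness: a closed set disjoint
    from such a set keeps a uniform distance from it, seen on a finite horizon. *)

Lemma MVT_derive (f df : R -> R) (x y : R) : x <= y ->
  (forall z, is_derive z 1 f (df z)) ->
  exists2 z, x <= z <= y & f y - f x = df z * (y - x).
Proof.
move=> xy fdf.
have [|z zxy fE] := @MVT_segment R f df x y xy _ _.
- apply: derivable_within_continuous => z _; exact: (@ex_derive _ _ _ _ _ _ _ (fdf z)).
- by exists z.
Qed.

(** The inequality [expR (- x) >= 1 - x] gives [expR x * (1 - x) <= 1]; together with
    [expR x >= 1 + x] this leaves elementary algebra. *)
Lemma expR_taylor1 x : `|x| <= 2^-1 -> `|expR x - 1 - x| <= 2 * x ^+ 2.
Proof.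
move=> x2; have := expR_ge1Dx x => x1.
have : 1 - x <= expR (- x) by exact: expR_ge1Dx.
have := expRxMexpNx_1 x; have e0 := expR_gt0 x.
move: (expR (- x)) (expR x) e0 x1 => u v v0 v1 vu u1.
move: x2; rewrite ler_norml => /andP[xl xr].
rewrite ger0_norm; last lra.
have : v * (1 - x) <= 1 by rewrite -[leRHS]vu ler_wpM2l// ltW.
have x20 : 0 <= x ^+ 2 by exact: sqr_ge0.
nra.
Qed.

(** The derivative of the second-order remainder is the first-order remainder, so the mean value
    theorem reduces to [expR_taylor1]. *)
Lemma expR_taylor2 x : `|x| <= 2^-1 ->
  `|expR x - 1 - x - x ^+ 2 / 2| <= 2 * `|x| ^+ 3.
Proof.
move=> x2; pose f (t : R) := expR t - 1 - t - t ^+ 2 / 2.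
have fdf z : is_derive z 1 f (expR z - 1 - z).
  rewrite /f; apply: is_derive_eq.
  by rewrite /GRing.scale/= !mulr0; field.
have f0 : f 0 = 0 by rewrite /f expR0 expr0n/= mul0r; ring.
suff : `|f x| <= 2 * `|x| ^+ 3 by [].
have [x0|x0] := leP 0 x.
- have [z /andP[z0 zx] fE] := MVT_derive x0 fdf.
  rewrite -[f x]subr0 -f0 fE normrM subr0.
  have zn : `|z| <= `|x| by rewrite !ger0_norm.
  rewrite exprSr mulrA ler_pM// (le_trans (expR_taylor1 (le_trans zn x2)))//.
  by rewrite ler_pM2l// -(real_normK (num_real z)) ler_sqr ?nnegrE.
- have [z /andP[xz z0] fE] := MVT_derive (ltW x0) fdf.
  rewrite -normrN -[- f x]add0r -f0 fE normrM sub0r normrN.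
  have zn : `|z| <= `|x| by rewrite (ler0_norm z0) ler0_norm ?lerN2// ltW.
  rewrite exprSr mulrA ler_pM// (le_trans (expR_taylor1 (le_trans zn x2)))//.
  by rewrite ler_pM2l// -(real_normK (num_real z)) ler_sqr ?nnegrE.
Qed.

End exponential_bounds.

(** * Convergence of the nonlinear generators *)

Section generator.
Context {R : realType} (beta : R).
Hypothesis beta0 : 0 <= beta.

(* The nonlinear generator of the process [b m_n] at speed [n b^-2], applied to
   the linear function with slope [q]. *)
Definition cw_hamiltonian (n : nat) (b x q : R) : R :=
  (n%:R * b ^- 2)^-1 *
  cw_generator beta n (fun s => expR (n%:R * b ^- 2 * q * (b * s - x))) (x / b).

(** A jump [2 / n] of the magnetization moves the exponent by [2 q / b]: the number of spins
    cancels, and only [b] has to grow in the convergence below. *)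
Lemma cw_hamiltonianE (n : nat) (b x q : R) : (0 < n)%N -> 0 < b ->
  cw_hamiltonian n b x q =
  b ^+ 2 * ((1 - x / b) / 2 * expR (beta * (x / b)) * (expR (2 * q / b) - 1) +
            (1 + x / b) / 2 * expR (- (beta * (x / b))) *
              (expR (- (2 * q / b)) - 1)).
Proof.
move=> n0 b0; have n0' : n%:R != 0 :> R by rewrite pnatr_eq0 -lt0n.
have b0' := lt0r_neq0 b0.
rewrite /cw_hamiltonian /cw_generator.
have -> : n%:R / b ^+ 2 * q * (b * (x / b) - x) = 0 by field; rewrite ?n0' ?b0'.
have -> : n%:R / b ^+ 2 * q * (b * (x / b + 2 / n%:R) - x) = 2 * q / b.
  by field; rewrite ?n0' ?b0'.
have -> : n%:R / b ^+ 2 * q * (b * (x / b - 2 / n%:R) - x) = - (2 * q / b).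
  by field; rewrite ?n0' ?b0'.
by rewrite expR0 mulNr; field; rewrite n0' b0'.
Qed.

(** Here [m] stands for [x / b] and [y] for [2 q / b]; [F1], [F2] are the Taylor remainders of the
    jump rates and [E1], [E2] those of the exponential increments. *)
Lemma hamiltonian_remainder (m y F1 F2 E1 E2 : R) : `|m| <= 1 -> `|y| <= 1 ->
  `|beta * m| <= 2^-1 ->
  `|F1| <= 2 * (beta * m) ^+ 2 -> `|F2| <= 2 * (beta * m) ^+ 2 ->
  `|E1| <= 2 * `|y| ^+ 3 -> `|E2| <= 2 * `|y| ^+ 3 ->
  `|(1 - m) / 2 * (1 + beta * m + F1) * (y + y ^+ 2 / 2 + E1) +
    (1 + m) / 2 * (1 - beta * m + F2) * (- y + y ^+ 2 / 2 + E2) -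
    ((beta - 1) * m * y + y ^+ 2 / 2)|
  <= 4 * (beta + 2 * beta ^+ 2) * (m ^+ 2 * `|y|) + 8 * `|y| ^+ 3.
Proof.
move=> m1 y1 bm hF1 hF2 hE1 hE2.
pose c := beta + 2 * beta ^+ 2.
(* The jump rates are [1/2 + (beta - 1) m / 2 + A1] and [1/2 - (beta - 1) m / 2 + A2]: the main
   parts produce the limit, and [A1], [A2] are quadratic in [m]. *)
pose A1 := - (beta * m ^+ 2) / 2 + (1 - m) / 2 * F1.
pose A2 := - (beta * m ^+ 2) / 2 + (1 + m) / 2 * F2.
have c0 : 0 <= c by rewrite addr_ge0// mulr_ge0// sqr_ge0.
have m20 : 0 <= m ^+ 2 by exact: sqr_ge0.
have half_m (s F : R) : `|s| <= 1 -> `|F| <= 2 * (beta * m) ^+ 2 ->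
    `|- (beta * m ^+ 2) / 2 + s * F| <= c * m ^+ 2.
  move=> s1 hF; rewrite (le_trans (ler_normD _ _))//.
  have -> : c * m ^+ 2 = beta * m ^+ 2 + 2 * (beta * m) ^+ 2.
    by rewrite /c; ring.
  rewrite lerD//.
    have bm20 : 0 <= beta * m ^+ 2 by exact: mulr_ge0.
    rewrite mulNr normrN ger0_norm; lra.
  by rewrite normrM (le_trans _ hF)// ler_piMl.
have hm : `|(1 - m) / 2| <= 1 /\ `|(1 + m) / 2| <= 1.
  move: m1; rewrite !ler_norml => /andP[? ?].
  by split; apply/andP; split; lra.
have hA1 : `|A1| <= c * m ^+ 2 by apply: half_m => //; exact: hm.1.
have hA2 : `|A2| <= c * m ^+ 2 by apply: half_m => //; exact: hm.2.
pose al1 := (1 - m) / 2 * (1 + beta * m + F1).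
pose al2 := (1 + m) / 2 * (1 - beta * m + F2).
have bm2 : (beta * m) ^+ 2 <= 4^-1.
  rewrite -[leLHS]real_normK ?num_real//.
  have -> : 4^-1 = 2^-1 ^+ 2 :> R by field.
  by rewrite ler_sqr ?nnegrE.
have hal (s t F : R) : `|s| <= 1 -> `|t| <= 2^-1 ->
    `|F| <= 2 * (beta * m) ^+ 2 -> `|s * (1 + t + F)| <= 2.
  move=> s1 t2 hF; rewrite normrM.
  have h2 : `|1 + t + F| <= 2.
    move: t2 hF bm2; rewrite !ler_norml => /andP[? ?] /andP[? ?] ?.
    by apply/andP; split; lra.
  by rewrite (le_trans _ h2)// ler_piMl.
have hal1 : `|al1| <= 2 by apply: hal => //; exact: hm.1.
have hal2 : `|al2| <= 2 by apply: hal => //; [exact: hm.2|rewrite normrN].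
rewrite [X in `|X|](_ : _ = (A1 - A2) * y + (A1 + A2) * (y ^+ 2 / 2) +
    al1 * E1 + al2 * E2); last by rewrite /A1 /A2 /al1 /al2; field.
have -> : 4 * (beta + 2 * beta ^+ 2) * (m ^+ 2 * `|y|) + 8 * `|y| ^+ 3 =
    2 * (c * m ^+ 2) * `|y| + 2 * (c * m ^+ 2) * `|y| + 2 * (2 * `|y| ^+ 3) +
    2 * (2 * `|y| ^+ 3) by rewrite /c; ring.
have cm0 : 0 <= c * m ^+ 2 by rewrite mulr_ge0.
rewrite !(le_trans (ler_normD _ _))// lerD//.
  rewrite !(le_trans (ler_normD _ _))// lerD//.
    rewrite !(le_trans (ler_normD _ _))// lerD//.
      rewrite normrM ler_wpM2r// (le_trans (ler_normB _ _))//.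
      by rewrite mulr2n mulrDl !mul1r lerD.
    rewrite normrM ler_pM//.
      by rewrite (le_trans (ler_normD _ _))// mulr2n mulrDl !mul1r lerD.
    rewrite ger0_norm ?divr_ge0 ?sqr_ge0// -real_normK ?num_real//.
    have := normr_ge0 y; move: `|y| y1 => v v1 v0; nra.
  by rewrite normrM ler_pM.
by rewrite normrM ler_pM.
Qed.

(** Both [m] and [y] are of order [1 / b], so the remainder is of order [b^-3]; the prefactor [b^2]
    leaves an error [C / b], uniform in [n]. *)
Lemma cw_hamiltonian_cvg (K Q eta : R) : 0 < eta ->
  exists B : R, forall n b, (0 < n)%N -> B <= b -> 0 < b ->
  forall x q, `|x| <= K -> `|q| <= Q ->
  `|cw_hamiltonian n b x q - (2 * q ^+ 2 - 2 * (1 - beta) * x * q)| <= eta.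
Proof.
move=> eta0.
wlog [K0 Q0] : K Q / 0 <= K /\ 0 <= Q.
  move=> /(_ (`|K|) (`|Q|)) [//|B HB]; exists B => n b n0 bB b0 x q xK qQ.
  apply: HB => //; first by rewrite (le_trans xK)// ler_norm.
  by rewrite (le_trans qQ)// ler_norm.
pose C := 4 * (beta + 2 * beta ^+ 2) * (K ^+ 2 * (2 * Q)) + 8 * (2 * Q) ^+ 3.
have C0 : 0 <= C.
  by rewrite addr_ge0 ?mulr_ge0 ?exprn_ge0 ?mulr_ge0 ?addr_ge0 ?mulr_ge0.
(* The terms in [K] and [Q] keep [x / b], [4 q / b] and [2 beta x / b] within [[-1, 1]], as the
   Taylor bounds require; the last one makes [C / b <= eta]. *)
exists (1 + K + 4 * Q + 2 * beta * K + C / eta) => n b n0 bB b0 x q xK qQ.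
have Ce0 : 0 <= C / eta by rewrite divr_ge0// ltW.
have bK0 : 0 <= beta * K by rewrite mulr_ge0.
rewrite cw_hamiltonianE//.
pose e := b^-1; have e0 : 0 < e by rewrite invr_gt0.
have be : b * e = 1 by rewrite divff// lt0r_neq0.
have small z s : 0 <= z -> `|s| <= z -> z <= b -> `|s * e| <= 1.
  move=> z0 sz zb; rewrite normrM (gtr0_norm e0) -be ler_pM2r//.
  exact: le_trans zb.
have hm : `|x / b| <= 1 by apply: (small K) => //; lra.
have hy' : `|4 * q / b| <= 1.
  by apply: (small (4 * Q)); [lra| rewrite normrM ger0_norm// ler_pM2l|lra].
have hbm' : `|2 * beta * x / b| <= 1.
  apply: (small (2 * beta * K)); [by rewrite -mulrA mulr_ge0| |lra].
  by rewrite normrM ger0_norm ?mulr_ge0// ler_wpM2l// mulr_ge0.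
have hy : `|2 * q / b| <= 2^-1.
  have -> : 2 * q / b = 2^-1 * (4 * q / b) by field; exact: lt0r_neq0.
  by rewrite normrM ger0_norm ?invr_ge0// ler_piMr// invr_ge0.
have hbm : `|beta * (x / b)| <= 2^-1.
  have -> : beta * (x / b) = 2^-1 * (2 * beta * x / b).
    by field; exact: lt0r_neq0.
  by rewrite normrM ger0_norm ?invr_ge0// ler_piMr// invr_ge0.
have hbmN : `|- (beta * (x / b))| <= 2^-1 by rewrite normrN.
have hyN : `|- (2 * q / b)| <= 2^-1 by rewrite normrN.
have hy1 : `|2 * q / b| <= 1.
  by apply: le_trans hy _; rewrite invf_le1//; lra.
have tF1 := expR_taylor1 hbm; have tF2 := expR_taylor1 hbmN.
have tE1 := expR_taylor2 hy; have tE2 := expR_taylor2 hyN.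
rewrite normrN in tE2; rewrite sqrrN in tF2.
have := @hamiltonian_remainder (x / b) (2 * q / b) _ _ _ _ hm hy1 hbm
  tF1 tF2 tE1 tE2.
move: (expR (beta * (x / b))) (expR (- (beta * (x / b))))
  (expR (2 * q / b)) (expR (- (2 * q / b))) => u1 u2 v1 v2 H.
have {}H : `|(1 - x / b) / 2 * u1 * (v1 - 1) + (1 + x / b) / 2 * u2 * (v2 - 1) -
    ((beta - 1) * (x / b) * (2 * q / b) + (2 * q / b) ^+ 2 / 2)| <= C * e ^+ 3.
  apply: le_trans (le_trans H _); last first.
    have -> : C * e ^+ 3 = 4 * (beta + 2 * beta ^+ 2) * ((K * e) ^+ 2 * (2 * Q * e))
        + 8 * (2 * Q * e) ^+ 3 by rewrite /C; ring.
    have hx : `|x / b| <= K * e by rewrite normrM (gtr0_norm e0) ler_wpM2r// ltW.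
    have hq : `|2 * q / b| <= 2 * Q * e.
      by rewrite normrM (gtr0_norm e0) normrM ger0_norm// ler_wpM2r ?ler_pM2l// ltW.
    rewrite lerD//.
      rewrite ler_wpM2l ?mulr_ge0 ?addr_ge0 ?mulr_ge0 ?sqr_ge0//.
      rewrite ler_pM ?sqr_ge0// -real_normK ?num_real// ler_sqr ?nnegrE//.
      by rewrite mulr_ge0// ltW.
    by rewrite ler_pM2l// lerXn2r// nnegrE// mulr_ge0 ?mulr_ge0// ltW.
  rewrite le_eqVlt; apply/orP; left; apply/eqP; congr `|_|; by field; exact: lt0r_neq0.
rewrite [X in `|X|](_ : _ = b ^+ 2 * ((1 - x / b) / 2 * u1 * (v1 - 1) +
    (1 + x / b) / 2 * u2 * (v2 - 1) -
    ((beta - 1) * (x / b) * (2 * q / b) + (2 * q / b) ^+ 2 / 2))); last first.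
  by field; exact: lt0r_neq0.
rewrite normrM ger0_norm ?sqr_ge0// (le_trans (ler_wpM2l (sqr_ge0 _) H))//.
have -> : b ^+ 2 * (C * e ^+ 3) = C * e.
  by rewrite /e; field; exact: lt0r_neq0.
rewrite /e ler_pdivrMr// mulrC -ler_pdivrMr//; lra.
Qed.

End generator.

(** * Markov processes on a time grid *)

Section finite_law.
Context {R : realType} {d : measure_display} {T : measurableType d}
  (P : probability T R).

Definition Pr (A : set T) : R := fine (P A).

Lemma Pr_EFin A : measurable A -> (Pr A)%:E = P A.
Proof. by move=> mA; rewrite fineK// fin_num_measure. Qed.

Lemma Pr_ge0 A : 0 <= Pr A.
Proof. by rewrite fine_ge0. Qed.

Lemma Pr_le1 A : measurable A -> Pr A <= 1.
Proof. by move=> mA; rewrite -lee_fin Pr_EFin// probability_le1. Qed.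

Lemma le_Pr A B : measurable A -> measurable B -> A `<=` B -> Pr A <= Pr B.
Proof. by move=> mA mB AB; rewrite -lee_fin !Pr_EFin// le_measure ?inE. Qed.

Lemma Pr_setU A B : measurable A -> measurable B -> Pr (A `|` B) <= Pr A + Pr B.
Proof.
move=> mA mB; rewrite -lee_fin EFinD !Pr_EFin//; last exact: measurableU.
exact: measureU2.
Qed.

Lemma Pr_finite (I : finType) (f : T -> I) (B : pred I) :
  (forall i, measurable [set w | f w = i]) ->
  measurable [set w | B (f w)] /\
  Pr [set w | B (f w)] = \sum_i Pr [set w | f w = i] * (B i)%:R.
Proof.
move=> mf.
have fin : finite_set [set` B] by exact: finite_finset.
have E : [set w | B (f w)] = \bigcup_(i in [set` B]) [set w | f w = i].
  apply/seteqP; split => [w /= Bw|w [i /= Bi fi]]; [by exists (f w)|by rewrite fi].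
have mB : measurable [set w | B (f w)].
  by rewrite E; apply: fin_bigcup_measurable.
split => //; apply: EFin_inj; rewrite Pr_EFin// E measure_fin_bigcup//; last first.
  by move=> i j _ _ [w [/= -> ->]].
rewrite -(@bigfs _ _ _ _ (index_enum I) B) ?index_enum_uniq//; last first.
  by move=> i _; rewrite mem_index_enum.
rewrite big_mkcond/= -sumEFin; apply: eq_bigr => i _.
by case: (B i); rewrite ?mulr1 ?mulr0// Pr_EFin.
Qed.

End finite_law.

(** * The law of the path on a grid *)

Section markov_paths.
Context {R : realType} {n : nat} (S : 'I_n.+1 -> R) (A : (R -> R) -> R -> R)
  {d : measure_display} {T : measurableType d} (P : probability T R)
  (X : T -> R -> R).
Hypothesis S_inj : injective S.
Hypothesis markovX : markov_process S A P X.

(** The default [ord0] can occur only at negative times, where nothing is assumed of the process. *)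
Definition state_at (w : T) (t : R) : 'I_n.+1 :=
  odflt ord0 [pick i | X w t == S i].

Lemma state_atE w t : 0 <= t -> X w t = S (state_at w t).
Proof.
move=> t0; have [_ /(_ w t t0)[i Xi] _] := markovX.
rewrite /state_at; case: pickP => [j /eqP//|/(_ i)]; by rewrite Xi eqxx.
Qed.

Lemma measurable_state_at t i : 0 <= t ->
  measurable [set w | state_at w t = i].
Proof.
move=> t0; have [mX _ _] := markovX.
rewrite [X in measurable X](_ : _ = X ^~ t @^-1` [set S i]).
  by rewrite -[X in measurable X]setTI; apply: mX.
apply/seteqP; split => w /=; first by move=> <-; rewrite -state_atE.
by rewrite state_atE// => /S_inj.
Qed.

(* The states at the times [k h, ..., 2 h, h, 0], in this order. *)
Fixpoint grid_path (h : R) (k : nat) (w : T) : seq 'I_n.+1 :=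
  state_at w (k%:R * h) :: if k is k'.+1 then grid_path h k' w else [::].

Lemma size_grid_path h k w : size (grid_path h k w) = k.+1.
Proof. by elim: k => //= k ->. Qed.

Lemma last_grid_path h k w i : last i (grid_path h k w) = state_at w 0.
Proof. by elim: k i => [|k IH] i /=; rewrite ?mul0r ?IH. Qed.

Definition grid_tuple h k w : k.+1.-tuple 'I_n.+1 :=
  Tuple (introT eqP (size_grid_path h k w)).

Lemma measurable_grid_path h k s : 0 <= h ->
  measurable [set w | grid_path h k w = s].
Proof.
move=> h0; elim: k s => [|k IH] [|x s] /=.
- by rewrite [X in measurable X](_ : _ = set0)//; apply/seteqP; split.
- have [->|s0] := eqVneq s [::].
    rewrite [X in measurable X](_ : _ = [set w | state_at w (0 * h) = x]).
      by apply: measurable_state_at; rewrite mul0r.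
    by apply/seteqP; split => [w /= [->]|w /= ->].
  rewrite [X in measurable X](_ : _ = set0)//; apply/seteqP; split => // w [] _ /esym.
  by move/eqP; rewrite (negbTE s0).
- by rewrite [X in measurable X](_ : _ = set0)//; apply/seteqP; split.
- rewrite [X in measurable X](_ : _ =
      [set w | state_at w (k.+1%:R * h) = x] `&` [set w | grid_path h k w = s]).
    by apply: measurableI => //; apply: measurable_state_at; rewrite mulr_ge0.
  by apply/seteqP; split => [w /= [-> ->]|w [/= -> ->]].
Qed.

Lemma grid_tupleE h k (t : k.+1.-tuple 'I_n.+1) :
  [set w | grid_tuple h k w = t] = [set w | grid_path h k w = t].
Proof.
by apply/seteqP; split => w /= [E]; [rewrite -E|apply: val_inj].
Qed.

Definition grid_law h k (s : seq 'I_n.+1) : R :=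
  Pr P [set w | grid_path h k w = s].

(** The expectation of [F] along the grid path. As there are finitely many such paths, it is a
    finite sum, and neither integrals nor conditional expectations enter the martingale argument. *)
Definition grid_mean h k (F : seq 'I_n.+1 -> R) : R :=
  \sum_(t : k.+1.-tuple 'I_n.+1) grid_law h k t * F t.

Lemma Pr_grid_event h k (B : pred (seq 'I_n.+1)) : 0 <= h ->
  measurable [set w | B (grid_path h k w)] /\
  Pr P [set w | B (grid_path h k w)] = grid_mean h k (fun s => (B s)%:R).
Proof.
move=> h0; have [|mB PB] := @Pr_finite _ _ _ P _ (grid_tuple h k) (fun t => B t).
  by move=> t; rewrite grid_tupleE; exact: measurable_grid_path.
by split => //; rewrite PB; apply: eq_bigr => t _; rewrite grid_tupleE.
Qed.

Lemma le_grid_mean h k (F G : seq 'I_n.+1 -> R) :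
  (forall s, size s = k.+1 -> F s <= G s) ->
  grid_mean h k F <= grid_mean h k G.
Proof.
move=> FG; apply: ler_sum => t _; rewrite ler_wpM2l ?Pr_ge0// FG//.
by rewrite size_tuple.
Qed.

Lemma eq_grid_mean h k (F G : seq 'I_n.+1 -> R) :
  (forall s, size s = k.+1 -> F s = G s) ->
  grid_mean h k F = grid_mean h k G.
Proof.
by move=> FG; apply: eq_bigr => t _; rewrite FG// size_tuple.
Qed.

Lemma grid_meanZ h k c (F : seq 'I_n.+1 -> R) :
  grid_mean h k (fun s => c * F s) = c * grid_mean h k F.
Proof. by rewrite /grid_mean mulr_sumr; apply: eq_bigr => t _; rewrite mulrCA. Qed.

Lemma grid_meanD h k (F G : seq 'I_n.+1 -> R) :
  grid_mean h k (fun s => F s + G s) = grid_mean h k F + grid_mean h k G.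
Proof. by rewrite /grid_mean -big_split; apply: eq_bigr => t _; rewrite mulrDr. Qed.

Lemma nth_grid_path h k w j : (j <= k)%N ->
  nth ord0 (grid_path h k w) j = state_at w ((k - j)%N%:R * h).
Proof.
elim: k j => [|k IH] [|j] //=.
by rewrite ltnS => jk; rewrite IH// subSS.
Qed.

Lemma grid_pathP h k w s : 0 <= h -> size s = k.+1 ->
  grid_path h k w = s <->
  forall i, (i <= k)%N -> X w (i%:R * h) = S (nth ord0 s (k - i)).
Proof.
move=> h0 sk; split=> [<- i ik|H].
  by rewrite nth_grid_path ?leq_subr// subKn// -state_atE// mulr_ge0.
apply: (@eq_from_nth _ ord0) => [|j]; rewrite size_grid_path// ltnS => jk.
rewrite nth_grid_path//; apply: S_inj; rewrite -state_atE ?mulr_ge0//.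
by rewrite H ?leq_subr// subKn.
Qed.

(** This is the Markov clause read at the times [0, h, ..., k h]; since paths list the latest state
    first, the head of [s] is the present state. *)
Lemma grid_law_cons (p : R -> 'M[R]_n.+1) h k s y : 0 <= h ->
  (forall (k : nat) (u : nat -> R) (x : nat -> 'I_n.+1) (t : R) (j : 'I_n.+1),
    0 <= u 0%N -> (forall i, (i < k)%N -> u i <= u i.+1) -> 0 <= t ->
    P [set w | (forall i, (i <= k)%N -> X w (u i) = S (x i)) /\
               X w (u k + t) = S j] =
    (P [set w | forall i, (i <= k)%N -> X w (u i) = S (x i)] *
     (p t (x k) j)%:E)%E) ->
  size s = k.+1 ->
  grid_law h k.+1 (y :: s) = grid_law h k s * p h (head ord0 s) y.
Proof.
move=> h0 pM sk; apply: EFin_inj; rewrite EFinM /grid_law.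
rewrite !Pr_EFin; [|exact: measurable_grid_path..].
have -> : P [set w | grid_path h k w = s] =
  P [set w | forall i, (i <= k)%N -> X w (i%:R * h) = S (nth ord0 s (k - i))].
  by congr (P _); apply/seteqP; split => w /=; rewrite grid_pathP.
have := pM k (fun i => i%:R * h) (fun i => nth ord0 s (k - i)) h y.
rewrite mul0r subnn nth0 => /(_ (lexx 0)) <- //; last first.
  by move=> i _; rewrite ler_wpM2r// ler_nat.
have kh : k%:R * h + h = k.+1%:R * h by rewrite -natr1 mulrDl mul1r.
have kh0 : 0 <= k.+1%:R * h by rewrite mulr_ge0.
congr (P _); apply/seteqP; split => w /=.
  case=> hy hs; split; first by apply/grid_pathP.
  by rewrite kh (state_atE _ kh0) hy.
case=> /(grid_pathP _ h0 sk) -> hy; congr (_ :: _).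
by apply: S_inj; rewrite -state_atE// -kh.
Qed.

(** The tower property: the last step is averaged out by the transition matrix. *)
Lemma grid_mean_step (p : R -> 'M[R]_n.+1) h k F : 0 <= h ->
  (forall s y, size s = k.+1 ->
    grid_law h k.+1 (y :: s) = grid_law h k s * p h (head ord0 s) y) ->
  grid_mean h k.+1 F =
  grid_mean h k (fun s => \sum_y p h (head ord0 s) y * F (y :: s)).
Proof.
move=> h0 lawS; rewrite /grid_mean.
under [RHS]eq_bigr do rewrite mulr_sumr.
rewrite exchange_big pair_big/=.
rewrite (reindex (fun q : 'I_n.+1 * k.+1.-tuple 'I_n.+1 => [tuple of q.1 :: q.2]))/=.
  by apply: eq_bigr => -[y t] _ /=; rewrite lawS ?size_tuple// mulrA.
exists (fun t => (thead t, [tuple of behead t])) => [[y t] _|t _] /=.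
  by rewrite theadE; congr (_, _); apply: val_inj.
by rewrite [RHS]tuple_eta.
Qed.

End markov_paths.

(** * The clock of the martingale *)

Section clock.
Context {R : realType} (a : R).

(* [clock t] is [2 * int_0^t e^(2 a s) ds]. *)
Definition clock (t : R) : R :=
  if a == 0 then 2 * t else (expR (2 * a * t) - 1) / a.

Lemma clock0 : clock 0 = 0.
Proof. by rewrite /clock; case: eqP => _; rewrite !mulr0 ?expR0 ?subrr ?mul0r. Qed.

(** This cocycle identity lets a one-step estimate at time 0 serve at every later time, after
    multiplying the slope by [e^(a s)]. *)
Lemma clockD s t : clock (s + t) = clock s + expR (2 * a * s) * clock t.
Proof.
rewrite /clock; case: eqVneq => [->|a0].
  by rewrite mulr0 mul0r expR0 mulrDr mul1r.
by rewrite mulrDr expRD; field.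
Qed.

Lemma is_derive_clock (t : R) : is_derive t 1 clock (2 * expR (2 * a * t)).
Proof.
rewrite /clock; case: eqVneq => [a0|a0].
  apply: is_derive_eq; rewrite /GRing.scale/= a0 mulr0 mul0r expR0; ring.
by apply: is_derive_eq; rewrite /GRing.scale/= !mulr0; field.
Qed.

Lemma clock_lt s t : s < t -> clock s < clock t.
Proof.
move=> st; have [z _ E] := MVT_derive (ltW st) is_derive_clock.
by rewrite -subr_gt0 E mulr_gt0 ?subr_gt0// mulr_gt0 ?expR_gt0.
Qed.

Lemma clock_le s t : s <= t -> clock s <= clock t.
Proof. by rewrite le_eqVlt => /predU1P[->//|/clock_lt/ltW]. Qed.

Lemma clock_taylor h : `|2 * a * h| <= 2^-1 ->
  `|clock h - 2 * h| <= 8 * `|a| * h ^+ 2.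
Proof.
move=> ah; rewrite /clock; case: eqVneq => [->|a0].
  by rewrite subrr normr0 mulr0 mul0r.
have -> : (expR (2 * a * h) - 1) / a - 2 * h =
    (expR (2 * a * h) - 1 - 2 * a * h) / a by field.
rewrite normrM normfV ler_pdivrMr ?normr_gt0//.
apply: le_trans (expR_taylor1 ah) _.
have -> : 8 * `|a| * h ^+ 2 * `|a| = 8 * `|a| ^+ 2 * h ^+ 2 by ring.
by rewrite real_normK ?num_real// le_eqVlt; apply/orP; left; apply/eqP; ring.
Qed.

End clock.

(** * Short-time expansion of the transition matrix *)

Section one_step.
Context {R : realType} {n : nat} (S : 'I_n.+1 -> R) (A : (R -> R) -> R -> R)
  (p : R -> 'M[R]_n.+1).
Hypothesis S_inj : injective S.
Hypothesis p_gen : forall (f : R -> R) i,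
  t^-1 * (\sum_j p t i j * f (S j) - f (S i)) @[t --> 0^'+] --> A f (S i).

(** The generator is given only as an operator on functions; indicators of states recover its
    matrix. *)
Let jump_rate i j : R := A (fun s => (s == S j)%:R) (S i).

Let jump_rate_cvg i j :
  t^-1 * (p t i j - (i == j)%:R) @[t --> 0^'+] --> jump_rate i j.
Proof.
have := @p_gen (fun s => (s == S j)%:R) i.
under eq_fun => t.
  under eq_bigr do rewrite (inj_eq S_inj).
  rewrite (bigD1 j)//= eqxx mulr1 big1 ?addr0 => [|k /negPf ->]; last by rewrite mulr0.
  rewrite (inj_eq S_inj).
  over.
exact.
Qed.

Let sum_jump_rate f i : \sum_j jump_rate i j * f (S j) = A f (S i).
Proof.
have H : t^-1 * (\sum_j p t i j * f (S j) - f (S i)) @[t --> 0^'+] -->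
    \sum_j jump_rate i j * f (S j).
  have -> : (fun t => t^-1 * (\sum_j p t i j * f (S j) - f (S i))) =
    (fun t => \sum_j (t^-1 * (p t i j - (i == j)%:R)) * f (S j)).
    apply/funext => t; rewrite -[in LHS](_ : \sum_j (i == j)%:R * f (S j) = f (S i)).
      rewrite -sumrB mulr_sumr; apply: eq_bigr => j _; ring.
    rewrite (bigD1 i)//= eqxx mul1r big1 ?addr0// => j /negPf.
    by rewrite eq_sym => ->; rewrite mul0r.
  apply: cvg_big => [|j _]; first exact: add_continuous.
  by apply: cvgMr_tmp; exact: jump_rate_cvg.
exact: cvg_unique H (@p_gen f i).
Qed.

(** The convergence to the generator is assumed for each function separately. On a finite state
    space the finitely many indicators make it uniform in the entries. *)
Lemma transition_expansion (e : R) : 0 < e ->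
  exists2 Q : 'I_n.+1 -> 'I_n.+1 -> R,
    (forall f i, \sum_j Q i j * f (S j) = A f (S i)) &
    \forall h \near 0^'+, forall i j,
      `|p h i j - (i == j)%:R - h * Q i j| <= e * h.
Proof.
move=> e0; exists jump_rate => //.
apply: filter_forall => i; apply: filter_forall => j.
have /cvgrPdist_le /(_ e e0) := @jump_rate_cvg i j.
apply: filterS2 (nbhs_right_gt 0) => h h0 H.
rewrite -[h * _]mulrC.
have -> : p h i j - (i == j)%:R - jump_rate i j * h =
    - (jump_rate i j - h^-1 * (p h i j - (i == j)%:R)) * h.
  by field; exact: lt0r_neq0.
by rewrite normrM normrN (gtr0_norm h0) ler_pM2r.
Qed.

End one_step.

(** * One step of the exponential martingale *)

Section curie_weiss_step.
Context {R : realType} (beta : R) (n : nat) (b : R) (p : R -> 'M[R]_n.+1).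
Hypotheses (n0 : (0 < n)%N) (b0 : 0 < b).
Hypothesis p_gen : forall (f : R -> R) i,
  t^-1 * (\sum_j p t i j * f (@cw_state R n j) - f (@cw_state R n i))
    @[t --> 0^'+] --> cw_generator beta n f (@cw_state R n i).

Local Notation S := (@cw_state R n).
Local Notation speed := (n%:R * b ^- 2).
Local Notation a := (2 * (1 - beta)).

Lemma cw_state_inj : injective S.
Proof.
move=> i j /addrI /mulIf H; apply: val_inj; apply/eqP.
rewrite -(@eqr_nat R); apply/eqP; apply: H.
by rewrite mulf_neq0// invr_neq0// pnatr_eq0 -lt0n.
Qed.

Lemma cw_state_le1 i : `|S i| <= 1.
Proof.
have n0' : 0 < n%:R :> R by rewrite ltr0n.
have i1 : i%:R * (2 / n%:R) <= 2 :> R.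
  by rewrite mulrA ler_pdivrMr// mulrC ler_wpM2l// ler_nat -ltnS.
have i2 : 0 <= i%:R * (2 / n%:R) :> R by rewrite mulr_ge0// divr_ge0.
by rewrite /cw_state ler_norml; apply/andP; split; lra.
Qed.

Lemma speed_gt0 : 0 < speed.
Proof. by rewrite divr_gt0 ?ltr0n// exprn_gt0. Qed.

(** To first order in [h], the deviation from 1 is [speed * h] times the difference between
    [cw_hamiltonian] and its limit. The bound [2 * speed * eta * h] consists of this term, half as
    much for the error of the transition matrix, and half as much for all terms of order [h^2]. *)
Lemma cw_one_step (K Q eta : R) : 0 <= Q -> 0 < eta ->
  (forall x q, `|x| <= K -> `|q| <= Q ->
    `|cw_hamiltonian beta n b x q - (2 * q ^+ 2 - 2 * (1 - beta) * x * q)|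
      <= eta) ->
  \forall h \near 0^'+, forall i q, `|b * S i| <= K -> `|q| <= Q ->
  `|\sum_j p h i j * expR (speed * (q * (expR (a * h) * (b * S j) - b * S i) -
      q ^+ 2 * clock a h)) - 1| <= 2 * speed * eta * h.
Proof.
move=> Q0 eta0 ham; have r0 := speed_gt0.
have [r rE] : {r : R | r = speed} by exists speed.
rewrite -rE in r0 *.
have [al alE] : {x : R | x = a} by exact: exist.
rewrite -alE in ham *.
have [CF CFE] : {x : R | x = expR (r * (Q * (2 * b)))} by exact: exist.
have CF0 : 0 < CF by rewrite CFE expR_gt0.
(* Summed over the [n.+1] states, with the exponentials bounded by [2 * CF], an entrywise error
   [e * h] amounts to [r * eta * h / 2]. *)
have [e eE] : {x : R | x = r * eta / (4 * CF * n.+1%:R)} by exact: exist.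
have e0 : 0 < e by rewrite eE divr_gt0 ?mulr_gt0 ?ltr0Sn.
have [J JE Jnear] := transition_expansion cw_state_inj p_gen e0.
have [W WE] : {x : R | x = r * (Q * (`|al| * b) + 2 * Q ^+ 2)} by exact: exist.
have [D DE] : {x : R | x = r * (Q * (2 * al ^+ 2 * b) + Q ^+ 2 * (8 * `|al|))} by exact: exist.
have W0 : 0 <= W.
  by rewrite WE mulr_ge0 ?addr_ge0 ?mulr_ge0 ?sqr_ge0// ltW.
have D0 : 0 <= D.
  rewrite DE; apply: mulr_ge0; [exact: ltW|apply: addr_ge0; apply: mulr_ge0 => //].
  - by apply: mulr_ge0; [apply: mulr_ge0; rewrite ?sqr_ge0|exact: ltW].
  - exact: sqr_ge0.
have [Js JsE] : {x : R | x = \sum_i \sum_j `|J i j|} by exact: exist.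
have Js0 : 0 <= Js by rewrite JsE; apply: sumr_ge0 => i _; exact: sumr_ge0.
pose C := 2 * (W + D) ^+ 2 + D + Js * CF * (2 * (W + D)).
have C0 : 0 <= C.
  by rewrite /C !addr_ge0 ?mulr_ge0 ?addr_ge0 ?sqr_ge0// ltW.
have near_le (c m : R) : 0 <= c -> 0 < m -> \forall h \near 0^'+, h * c <= m.
  move=> c0 m0; have cp : 0 < m / (c + 1) by rewrite divr_gt0// ltr_wpDl.
  apply: filterS2 (nbhs_right_gt 0) (nbhs_right_le cp) => h h0 hm.
  rewrite (le_trans (_ : _ <= h * (c + 1))) ?ler_pM2l ?lerDl//.
  by rewrite -ler_pdivlMr// ltr_wpDl.
near=> h.
have h0 : 0 < h by near: h; exact: nbhs_right_gt.
have h1 : h * 1 <= 1 by near: h; exact: near_le.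
have ha : h * `|2 * al| <= 2^-1 by near: h; apply: near_le; rewrite // invr_gt0.
have hWD : h * (W + D) <= 2^-1.
  by near: h; apply: near_le; rewrite ?addr_ge0// invr_gt0.
have hC : h * C <= r * eta / 2 by near: h; apply: near_le; rewrite ?divr_gt0 ?mulr_gt0.
have Jh i j : `|p h i j - (i == j)%:R - h * J i j| <= e * h.
  by move: i j; near: h.
rewrite mulr1 in h1.
move=> i q xK qQ.
have Sb j : `|b * S j| <= b.
  by rewrite normrM gtr0_norm// ler_piMr ?cw_state_le1// ltW.
have ha2 : `|2 * al * h| <= 2^-1 by rewrite normrM (gtr0_norm h0) mulrC.
have ha1 : `|al * h| <= 2^-1.
  apply: le_trans ha2; rewrite -mulrA [leRHS]normrM ger0_norm//.
  by rewrite ler_peMl// ler1n.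
have q2 : q ^+ 2 <= Q ^+ 2.
  by rewrite -real_normK ?num_real// lerXn2r// nnegrE.
(* The exponent splits into the jump part, kept in [F j], and the part [z j] due to the factor
   [e^(a h)] and the clock; [z j] is [h * w j] up to [O(h^2)]. *)
pose F j := expR (r * (q * (b * S j - b * S i))).
pose z j := r * (q * ((expR (al * h) - 1) * (b * S j)) - q ^+ 2 * clock al h).
pose w j := r * (al * q * (b * S j) - 2 * q ^+ 2).
have FCF j : F j <= CF.
  rewrite /F CFE ler_expR ler_pM2l//; apply: le_trans (ler_norm _) _.
  rewrite normrM ler_pM//; apply: le_trans (ler_normB _ _) _.
  by rewrite mulr2n mulrDl !mul1r lerD.
have FE : \sum_j J i j * F j = r * cw_hamiltonian beta n b (b * S i) q.
  rewrite (JE (fun s => expR (r * (q * (b * s - b * S i))))).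
  rewrite /cw_hamiltonian -rE mulVKf ?lt0r_neq0//.
  rewrite [b * _ / b]mulrAC divff ?lt0r_neq0// mul1r.
  by congr cw_generator; apply/funext => s; rewrite -mulrA.
have zw j : `|z j - h * w j| <= D * h ^+ 2.
  have -> : z j - h * w j = r * (q * ((expR (al * h) - 1 - al * h) * (b * S j))
      - q ^+ 2 * (clock al h - 2 * h)) by rewrite /z /w; ring.
  rewrite normrM gtr0_norm// DE -mulrA ler_pM2l//.
  apply: le_trans (ler_normB _ _) _; rewrite [leRHS]mulrDl lerD//.
    rewrite normrM -!mulrA ler_pM// normrM.
    have := expR_taylor1 ha1; rewrite exprMn => hh.
    rewrite [leRHS](_ : _ = 2 * (al ^+ 2 * h ^+ 2) * b); last by ring.
    by rewrite ler_pM.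
  rewrite normrM ger0_norm ?sqr_ge0// -mulrA ler_pM ?sqr_ge0//.
  exact: clock_taylor.
have wW j : `|w j| <= W.
  rewrite /w WE normrM gtr0_norm// ler_pM2l//.
  apply: le_trans (ler_normB _ _) _; rewrite lerD//.
    rewrite [al * q]mulrC -mulrA normrM ler_pM// normrM ler_pM//.
  by rewrite normrM (ger0_norm (sqr_ge0 _)) ger0_norm// ler_pM2l.
have zWD j : `|z j| <= h * (W + D).
  have -> : z j = h * w j + (z j - h * w j) by ring.
  apply: le_trans (ler_normD _ _) _; rewrite mulrDr lerD//.
    by rewrite normrM gtr0_norm// ler_pM2l.
  apply: le_trans (zw j) _; rewrite expr2 mulrA [leRHS]mulrC.
  by rewrite ler_piMr ?mulr_ge0// ltW.
have zhalf j : `|z j| <= 2^-1 by exact: le_trans (zWD j) hWD.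
have ez j : `|expR (z j) - 1| <= 2 * (h * (W + D)).
  have := expR_taylor1 (zhalf j) => H.
  have -> : expR (z j) - 1 = z j + (expR (z j) - 1 - z j) by ring.
  apply: le_trans (ler_normD _ _) _; apply: le_trans (lerD (lexx _) H) _.
  rewrite -real_normK ?num_real//.
  have := zhalf j; have := zWD j; have := normr_ge0 (z j); nra.
have ez2 j : expR (z j) <= 2.
  have := ez j; rewrite ler_norml => /andP[_]; move: hWD; lra.
have ezi : `|expR (z i) - 1 - h * w i| <= (2 * (W + D) ^+ 2 + D) * h ^+ 2.
  have -> : expR (z i) - 1 - h * w i =
    (expR (z i) - 1 - z i) + (z i - h * w i) by ring.
  apply: le_trans (ler_normD _ _) _; rewrite mulrDl lerD//.
  apply: le_trans (expR_taylor1 (zhalf i)) _.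
  rewrite -mulrA ler_pM2l// -exprMn -real_normK ?num_real// [_ * h]mulrC.
  by rewrite lerXn2r// nnegrE mulr_ge0 ?addr_ge0// ltW.
pose err j := p h i j - (i == j)%:R - h * J i j.
have -> : \sum_j p h i j * expR (r * (q * (expR (al * h) * (b * S j) - b * S i) -
      q ^+ 2 * clock al h)) - 1 =
    (expR (z i) - 1 - h * w i) + h * \sum_j J i j * F j * (expR (z j) - 1) +
    \sum_j err j * F j * expR (z j) +
    h * (w i + \sum_j J i j * F j).
  have -> : expR (z i) = \sum_j (i == j)%:R * F j * expR (z j).
    rewrite (bigD1 i)//= eqxx mul1r {1}/F subrr !mulr0 expR0 mul1r.
    rewrite big1 ?addr0// => j /negPf; rewrite eq_sym => ->.
    by rewrite !mul0r.
  have -> (x1 x2 x3 x4 x5 : R) : x1 - 1 - h * x2 + h * x3 + x4 + h * (x2 + x5)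
     = x1 + h * x5 + h * x3 + x4 - 1 by ring.
  congr (_ - 1); rewrite !mulr_sumr -!big_split; apply: eq_bigr => j _ /=.
  have -> : r * (q * (expR (al * h) * (b * S j) - b * S i) - q ^+ 2 * clock al h)
    = r * (q * (b * S j - b * S i)) + z j by rewrite /z; ring.
  rewrite expRD -/(F j) /err; ring.
(* The coefficient [w i] is [- r] times the limit Hamiltonian, while the jump sum is [r] times the
   Hamiltonian of the process. *)
have last_term : `|h * (w i + \sum_j J i j * F j)| <= r * eta * h.
  rewrite FE.
  have -> : h * (w i + r * cw_hamiltonian beta n b (b * S i) q) =
    r * h * (cw_hamiltonian beta n b (b * S i) q -
      (2 * q ^+ 2 - al * (b * S i) * q)) by rewrite /w; ring.
  rewrite normrM gtr0_norm ?mulr_gt0// mulrAC ler_pM2r//.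
  by rewrite ler_pM2l//; exact: ham.
have mid_term : `|h * \sum_j J i j * F j * (expR (z j) - 1)| <=
    Js * CF * (2 * (W + D)) * h ^+ 2.
  rewrite normrM gtr0_norm// [leRHS](_ : _ =
    h * (Js * CF * (2 * (h * (W + D))))); last by ring.
  rewrite ler_pM2l//; apply: le_trans (ler_norm_sum _ _ _) _.
  apply: (@le_trans _ _ (\sum_j `|J i j| * (CF * (2 * (h * (W + D)))))).
    apply: ler_sum => j _; rewrite !normrM -mulrA ler_wpM2l// ler_pM//.
    by rewrite gtr0_norm ?expR_gt0.
  rewrite -mulr_suml -mulrA ler_wpM2r//.
    by rewrite !mulr_ge0 ?addr_ge0// ltW.
  rewrite JsE [leRHS](bigD1 i)//= lerDl; apply: sumr_ge0 => k _; exact: sumr_ge0.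
have err_term : `|\sum_j err j * F j * expR (z j)| <= r * eta / 2 * h.
  apply: le_trans (ler_norm_sum _ _ _) _.
  apply: (@le_trans _ _ (\sum_(j < n.+1) e * h * (CF * 2))).
    apply: ler_sum => j _; rewrite !normrM -mulrA ler_pM ?Jh//.
    by rewrite ler_pM// gtr0_norm ?expR_gt0.
  rewrite sumr_const card_ord -mulr_natr eE.
  rewrite le_eqVlt; apply/orP; left; apply/eqP; field.
  by rewrite (lt0r_neq0 CF0) andbT nat1r pnatr_eq0.
have -> : 2 * r * eta * h = r * eta / 2 * h + r * eta / 2 * h + r * eta * h.
  by field.
apply: le_trans (ler_normD _ _) _; rewrite lerD//.
apply: le_trans (ler_normD _ _) _; rewrite lerD//.
apply: le_trans (ler_normD _ _) _.
apply: le_trans (lerD ezi mid_term) _.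
by rewrite -mulrDl -/C expr2 mulrA ler_pM2r// mulrC.
Unshelve. all: by end_near. Qed.

End curie_weiss_step.

(** * Stopped exponential martingales *)

Section stopped_exponentials.
Context {R : realType} {N : nat} (x : 'I_N.+1 -> R) (a h r : R).
Implicit Types (q : nat -> R) (s : seq 'I_N.+1) (good : pred (seq 'I_N.+1)).

(** The latest state comes first, so a path with [k.+1] entries ends at time [k * h]. *)
Definition scaled_value s : R :=
  expR (a * ((size s).-1%:R * h)) * x (head ord0 s).

Definition clock_step k : R := clock a (k.+1%:R * h) - clock a (k%:R * h).

Definition tilt q y s : R :=
  q (size s).-1 * (scaled_value (y :: s) - scaled_value s) -
  q (size s).-1 ^+ 2 * clock_step (size s).-1.

(** The predicate is tested on the path up to each time, so a stopping rule may depend on the whole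
    past, for instance on the exponent accumulated so far. *)
Fixpoint alive good s : bool :=
  if s is _ :: s' then good s && alive good s' else true.

(* Exponent of the exponential martingale with slopes [q], stopped when the
   path leaves [good]. *)
Fixpoint stopped_tilt good q s : R :=
  if s is y :: s' then
    stopped_tilt good q s' +
    (* A path with one entry has made no step yet. The step that leaves [good] is still counted, as
       only the earlier path has to be alive. *)
    (if (s' != [::]) && alive good s' then tilt q y s' else 0)
  else 0.

Lemma clock_stepE k : clock_step k = expR (2 * a * (k%:R * h)) * clock a h.
Proof.
by rewrite /clock_step -natr1 mulrDl mul1r clockD addrAC subrr add0r.
Qed.

Lemma tiltE q y s : s != [::] ->
  tilt q y s =
  (q (size s).-1 * expR (a * ((size s).-1%:R * h))) *
    (expR (a * h) * x y - x (head ord0 s)) -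
  (q (size s).-1 * expR (a * ((size s).-1%:R * h))) ^+ 2 * clock a h.
Proof.
case: s => // z s _; rewrite /tilt /scaled_value clock_stepE /=.
rewrite -[(size s).+1%:R]natr1 mulrDl mul1r mulrDr expRD exprMn -expRM_natl.
have -> : 2 * a * ((size s)%:R * h) = 2 * (a * ((size s)%:R * h)) by ring.
by ring.
Qed.

End stopped_exponentials.

Section exponential_martingale.
Context {R : realType} {N : nat} (S : 'I_N.+1 -> R) (A : (R -> R) -> R -> R)
  {d : measure_display} {T : measurableType d} (P : probability T R)
  (X : T -> R -> R) (p : R -> 'M[R]_N.+1) (x : 'I_N.+1 -> R) (a h r : R).
Hypotheses (S_inj : injective S) (markovX : markov_process S A P X).
Hypothesis h0 : 0 <= h.
Hypothesis p_stoch : forall i, (forall j, 0 <= p h i j) /\ \sum_j p h i j = 1.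
Hypothesis lawS : forall k s y, size s = k.+1 ->
  grid_law S P X h k.+1 (y :: s) = grid_law S P X h k s * p h (head ord0 s) y.

Local Notation mean := (grid_mean S P X h).

Variables (good : pred (seq 'I_N.+1)) (q : nat -> R) (e : R) (J : nat)
  (g : 'I_N.+1 -> R).
Hypothesis e01 : 0 <= e <= 1.
Hypothesis g0 : forall i, 0 <= g i.
Hypothesis step : forall s, s != [::] -> (size s <= J)%N -> good s ->
  `|\sum_j p h (head ord0 s) j * expR (r * tilt x a h q j s) - 1| <= e.

Local Notation L := (stopped_tilt x a h good q).

(** On a path that is alive the hypothesis [step] applies; on a stopped one the exponent no longer
    changes, and the rows of [p h] sum to 1. The weight [g] of the initial state is carried along,
    which keeps the start of the path in the bounds. *)
Lemma stopped_exponential_step k : (k < J)%N ->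
  (1 - e) * mean k (fun s => g (last ord0 s) * expR (r * L s)) <=
  mean k.+1 (fun s => g (last ord0 s) * expR (r * L s)) <=
  (1 + e) * mean k (fun s => g (last ord0 s) * expR (r * L s)).
Proof.
move=> kJ; rewrite (grid_mean_step _ h0 (@lawS k)) -!grid_meanZ.
have key s : size s = k.+1 -> `|\sum_y p h (head ord0 s) y *
    (g (last ord0 (y :: s)) * expR (r * L (y :: s))) -
    g (last ord0 s) * expR (r * L s)| <= e * (g (last ord0 s) * expR (r * L s)).
  move=> sk; have s0 : s != [::] by rewrite -size_eq0 sk.
  have gl y : last ord0 (y :: s) = last ord0 s by case: s s0 {sk}.
  under eq_bigr => y _.
    rewrite gl /= s0 /= mulrDr expRD.
    rewrite [X in _ * X](_ : _ = g (last ord0 s) * expR (r * L s) *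
      expR (r * (if alive good s then tilt x a h q y s else 0))); last by ring.
    rewrite mulrCA.
    over.
  rewrite -mulr_sumr -[X in _ - X]mulr1 -mulrBr normrM mulrC.
  have w0 : 0 <= g (last ord0 s) * expR (r * L s) by rewrite mulr_ge0// expR_ge0.
  rewrite (ger0_norm w0) ler_wpM2r//.
  case: (boolP (alive good s)) => [al|_]; last first.
    under eq_bigr do rewrite mulr0 expR0 mulr1.
    have [_ ->] := p_stoch (head ord0 s).
    by rewrite subrr normr0; case/andP: e01.
  apply: step; rewrite ?sk//.
  by move: al; case: s s0 {sk gl w0} => //= z s _ /andP[].
apply/andP; split; apply: le_grid_mean => s /key; rewrite ler_norml => /andP[].
  by rewrite lerBrDr addrC mulrBl mul1r.
by move=> _; rewrite lerBlDr mulrDl mul1r addrC.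
Qed.

Lemma stopped_exponential_mean k : (k <= J)%N ->
  (1 - e) ^+ k * mean 0 (fun s => g (last ord0 s)) <=
  mean k (fun s => g (last ord0 s) * expR (r * L s)) <=
  (1 + e) ^+ k * mean 0 (fun s => g (last ord0 s)).
Proof.
have /andP[e0 e1] := e01.
elim: k => [_|k IH kJ].
  rewrite !mul1r.
  have -> : mean 0 (fun s => g (last ord0 s) * expR (r * L s)) =
      mean 0 (fun s => g (last ord0 s)).
    by apply: eq_grid_mean => -[|y []]//= _; rewrite addr0 mulr0 expR0 mulr1.
  by rewrite lexx.
have /andP[l1 l2] := IH (ltnW kJ); have /andP[m1 m2] := stopped_exponential_step kJ.
rewrite !exprS -!mulrA; apply/andP; split.
  by apply: le_trans m1; rewrite ler_wpM2l// subr_ge0.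
by apply: le_trans m2 _; rewrite ler_wpM2l// addr_ge0.
Qed.

End exponential_martingale.

Section path_functionals.
Context {R : realType} {n : nat} (S : 'I_n.+1 -> R) (A : (R -> R) -> R -> R)
  {d : measure_display} {T : measurableType d} (P : probability T R)
  (X : T -> R -> R) (a h b : R).
Hypotheses (markovX : markov_process S A P X) (h0 : 0 <= h).
Local Notation x := (fun i => b * S i).
Local Notation path := (grid_path S X h).

Definition grid_scaled (w : T) (k : nat) : R :=
  expR (a * (k%:R * h)) * (b * X w (k%:R * h)).

Definition grid_tilt (q : nat -> R) (w : T) (k : nat) : R :=
  q k * (grid_scaled w k.+1 - grid_scaled w k) - q k ^+ 2 * clock_step a h k.

Lemma scaled_value_path w k : scaled_value x a h (path k w) = grid_scaled w k.
Proof.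
rewrite /scaled_value size_grid_path /grid_scaled; congr (_ * (_ * _)).
by case: k => [|k] /=; rewrite -(state_atE markovX)// mulr_ge0.
Qed.

Lemma tilt_path q w k y : y = state_at S X w (k.+1%:R * h) ->
  tilt x a h q y (path k w) = grid_tilt q w k.
Proof.
move=> ->; rewrite /tilt -[_ :: _]/(path k.+1 w) !scaled_value_path.
by rewrite size_grid_path.
Qed.

Lemma alive_path (good : pred (seq 'I_n.+1)) w k :
  reflect (forall i, (i <= k)%N -> good (path i w)) (alive good (path k w)).
Proof.
elim: k => [|k IH] /=.
  by rewrite andbT; apply: (iffP idP) => [g [|]//|/(_ 0%N)]; exact.
apply: (iffP andP) => [[gk /IH gi] i|g]; last first.
  by split; [exact: (g k.+1)|apply/IH => i ik; rewrite g// ltnW].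
by rewrite leq_eqVlt => /predU1P[->//|]; rewrite ltnS => /gi.
Qed.

Lemma stopped_tilt_path good q w k :
  stopped_tilt x a h good q (path k w) =
  \sum_(i < k) if alive good (path i w) then grid_tilt q w i else 0.
Proof.
elim: k => [|k IH]; first by rewrite big_ord0 /= addr0.
rewrite big_ord_recr/= -IH; congr (_ + _).
have -> : (path k w != [::]) by rewrite -size_eq0 size_grid_path.
by rewrite /=; case: ifP => // _; rewrite tilt_path.
Qed.

(** Sequences not realized by any sample point have mass 0, so the comparison is only required along
    actual paths, where pathwise estimates are available. *)
Lemma le_grid_mean_path k (F G : seq 'I_n.+1 -> R) :
  (forall w, F (path k w) <= G (path k w)) ->
  grid_mean S P X h k F <= grid_mean S P X h k G.
Proof.
move=> FG; apply: ler_sum => t _; rewrite /grid_law.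
have [[w <-]|/set0P] := pselect ([set w | path k w = t] !=set0).
  by rewrite ler_wpM2l ?Pr_ge0.
by move=> /negP/negPn/eqP ->; rewrite /Pr measure0 /= !mul0r.
Qed.

End path_functionals.

(** * Exponential bounds on a grid *)

Section tilted_bounds.
Context {R : realType} (beta : R) (n : nat) (b : R)
  {d : measure_display} {T : measurableType d} (P : probability T R)
  (m : T -> skorohod R).
Hypotheses (n0 : (0 < n)%N) (b0 : 0 < b) (mP : cw_process beta n P m).
Local Notation S := (@cw_state R n).
Local Notation a := (2 * (1 - beta)).
Local Notation X := (fun w => m w : R -> R).

Definition start_in (G : set R) : set T := [set w | G (b * m w 0)].

Variables (r K Q eta N0 : R).
Hypothesis rE : r = n%:R * b ^- 2.
Hypotheses (Q0 : 0 <= Q) (eta0 : 0 < eta) (N00 : 0 <= N0).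
Hypothesis ham : forall x q, `|x| <= K -> `|q| <= Q ->
    `|cw_hamiltonian beta n b x q - (2 * q ^+ 2 - 2 * (1 - beta) * x * q)|
      <= eta.

(** No measurability of [G] is assumed: the initial value takes finitely many values. *)
Lemma measurable_start_in G : measurable (start_in G).
Proof.
have S_inj := @cw_state_inj R n n0.
have [] := @Pr_finite _ _ _ P _ (fun w => state_at S X w 0)
    (fun i => `[< G (b * S i) >]).
  by move=> i; exact: (measurable_state_at S_inj mP).
move=> + _; congr (measurable _); apply/seteqP; split => w /=.
  by move=> /asboolP; rewrite -(state_atE mP).
by move=> Gw; apply/asboolP; rewrite -(state_atE mP).
Qed.

(** Each step costs a factor [1 + e] or [1 - e] with [e = 2 r eta h], and there are at most [N0 / h]
    steps. Since [(1 + e)^J <= e^(e J)] and, for [e <= 1/2], [(1 - e)^J >= e^(- 2 e J)], the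
    constants are 2 and 4, whatever the mesh. *)
Lemma stopped_mean : \forall h \near 0^'+, forall (J : nat) (q : nat -> R)
    (good : pred (seq 'I_n.+1)) (G : set R),
  J%:R * h <= N0 -> (forall i, `|q i| * expR (`|a| * N0) <= Q) ->
  (forall s, good s -> `|b * S (head ord0 s)| <= K) ->
  expR (- (4 * r * eta * N0)) * Pr P (start_in G) <=
  grid_mean S P X h J (fun s => (`[< G (b * S (last ord0 s)) >])%:R *
    expR (r * stopped_tilt (fun i => b * S i) a h good q s)) <=
  expR (2 * r * eta * N0) * Pr P (start_in G).
Proof.
have S_inj := @cw_state_inj R n n0; have r0 := @speed_gt0 R n b n0 b0.
rewrite -rE in r0.
have [_ _ [p [pstoch [p0 psemi] pgen pM]]] := mP.
have step := cw_one_step n0 b0 pgen Q0 eta0 ham.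
rewrite -rE in step.
(* For [h] below this threshold the error [e] of a step is at most [1/2]. *)
have c0 : 0 < (4 * r * eta)^-1 by rewrite invr_gt0 !mulr_gt0.
apply: filterS3 (nbhs_right_gt 0) (nbhs_right_le c0) step.
move=> h h0 hc step J q good G JN qQ goodK.
set e := 2 * r * eta * h.
have e2 : e <= 2^-1.
  rewrite /e (_ : 2 * r * eta * h = 2^-1 * (4 * r * eta * h)); last by field.
  rewrite ler_piMr ?invr_ge0// mulrC -ler_pdivlMr ?mulr_gt0//.
  by rewrite div1r.
have e0 : 0 <= e by rewrite /e ltW// !mulr_gt0.
have e01 : 0 <= e <= 1 by rewrite e0 (le_trans e2)// invf_le1 ?ler1n.
have lawS k s y : size s = k.+1 -> grid_law S P X h k.+1 (y :: s) =
    grid_law S P X h k s * p h (head ord0 s) y.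
  exact: (grid_law_cons S_inj mP _ (ltW h0) pM).
have ps i : (forall j, 0 <= p h i j) /\ \sum_j p h i j = 1.
  by have [p1 p2] := pstoch h (ltW h0); split.
have g0 i : 0 <= (`[< G (b * S i) >])%:R :> R by [].
have stepE s : s != [::] -> (size s <= J)%N -> good s ->
    `|\sum_j p h (head ord0 s) j *
      expR (r * tilt (fun i => b * S i) a h q j s) - 1| <= e.
  move=> s0 sJ gs; under eq_bigr do rewrite tiltE//.
  apply: step; first exact: goodK.
  rewrite normrM (le_trans _ (qQ (size s).-1))// ler_wpM2l//.
  rewrite ger0_norm ?expR_ge0// ler_expR.
  apply: le_trans (ler_norm _) _; rewrite normrM ler_wpM2l//.
  rewrite ger0_norm; last by rewrite mulr_ge0// ltW.
  rewrite (le_trans _ JN)// ler_pM2r// ler_nat.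
  by rewrite (leq_trans _ sJ)// leq_pred.
have /andP[H1 H2] := stopped_exponential_mean (ltW h0) ps lawS e01 g0 stepE
  (leqnn J).
have E0 : grid_mean S P X h 0 (fun s => (`[< G (b * S (last ord0 s)) >])%:R) =
    Pr P (start_in G).
  have [_ <-] := Pr_grid_event S_inj mP 0
    (fun s => `[< G (b * S (last ord0 s)) >]) (ltW h0).
  congr (Pr P _); apply/seteqP; split => w /=.
    by move=> /asboolP; rewrite mul0r -(state_atE mP).
  by move=> Gw; apply/asboolP; rewrite mul0r -(state_atE mP).
rewrite E0 in H1 H2.
have eJ : e * J%:R <= 2 * r * eta * N0.
  by rewrite /e -mulrA ler_wpM2l 1?mulrC// ltW// !mulr_gt0.
have PG0 : 0 <= Pr P (start_in G) by exact: Pr_ge0.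
apply/andP; split.
  apply: le_trans H1; rewrite ler_wpM2r//.
  apply: (@le_trans _ _ (expR (- (2 * e)) ^+ J)).
    rewrite -expRM_natr ler_expR mulNr lerN2; lra.
  rewrite lerXn2r ?nnegrE ?expR_ge0// ?subr_ge0; first by case/andP: e01.
  (* For [e <= 1/2] one has [(1 + 2 e) (1 - e) >= 1], hence
     [1 / (1 - e) <= 1 + 2 e <= expR (2 e)]. *)
  have e1 : 0 < 1 - e by rewrite subr_gt0 (le_lt_trans e2)// invf_lt1// ltr1n.
  rewrite -[leRHS]invrK expRN lef_pV2 ?posrE ?expR_gt0 ?invr_gt0//.
  apply: le_trans (expR_ge1Dx _); rewrite invf_ple ?posrE//; last by nra.
  rewrite -[leLHS]mul1r ler_pdivrMr; last by nra.
  nra.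
apply: le_trans H2 _; rewrite ler_wpM2r//.
apply: (@le_trans _ _ (expR e ^+ J)).
  by rewrite lerXn2r ?nnegrE ?expR_ge0 ?addr_ge0// expR_ge1Dx.
by rewrite -expRM_natr ler_expR.
Qed.

Local Notation U := (grid_scaled X a).
Local Notation dtilt h := (grid_tilt X a h b).

(** A maximal inequality: the martingale is stopped when its exponent first reaches [c], then
    Markov's inequality is applied. The position has to be bounded only strictly before that time,
    which later lets a path jump out of the bounded region at the very step where an oscillation
    occurs. *)
Lemma grid_upper_bound : \forall h \near 0^'+,
    forall (J : nat) (q : nat -> R) (c : R) (G : set R),
  J%:R * h <= N0 -> (forall i, `|q i| * expR (`|a| * N0) <= Q) ->
  exists E, [/\ measurable E,
    Pr P E <= expR (- (r * (c - 2 * eta * N0))) * Pr P (start_in G) &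
    forall w, G (b * m w 0) ->
      (exists2 j, (j <= J)%N &
        (forall i, (i < j)%N -> `|b * m w (i%:R * h)| <= K) /\
        c <= \sum_(i < j) dtilt h q w i) -> E w].
Proof.
have S_inj := @cw_state_inj R n n0.
have r0 : 0 < r by rewrite rE; exact: speed_gt0.
apply: filterS2 (nbhs_right_gt 0) stopped_mean => h h0 mean_h J q c G JN qQ.
(* The exponent tested here is the unstopped one; at the first index where it reaches [c] the path
   ceases to be good, so the stopped exponent keeps that value. *)
pose good s := (`|b * S (head ord0 s)| <= K) &&
  (stopped_tilt (fun i => b * S i) a h xpredT q s < c).
have {mean_h}/andP[_ mean_le] : _ := mean_h J q good G JN qQ
  (fun s gs => proj1 (andP gs)).
pose B s := `[< G (b * S (last ord0 s)) >] &&
  (c <= stopped_tilt (fun i => b * S i) a h good q s).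
have [mE PE] := Pr_grid_event S_inj mP J B (ltW h0).
exists [set w | B (grid_path S X h J w)]; split => //.
  have -> : expR (- (r * (c - 2 * eta * N0))) * Pr P (start_in G) =
      expR (- (r * c)) * (expR (2 * r * eta * N0) * Pr P (start_in G)).
    by rewrite mulrA -expRD; congr (expR _ * _); ring.
  rewrite PE; apply: le_trans (ler_wpM2l (expR_ge0 _) mean_le).
  rewrite -grid_meanZ; apply: le_grid_mean => s _.
  rewrite /B; case: asboolP => _ /=; last by rewrite mul0r mulr0.
  rewrite mul1r -expRD [- (r * c) + _]addrC -mulrBr.
  case: (leP c) => cL; last exact: expR_ge0.
  by rewrite -[leLHS]expR0 ler_expR mulr_ge0 ?subr_ge0// ltW.
move=> w Gw [j0 j0J [j0K j0c]]; apply/andP; split.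
  by apply/asboolP; rewrite last_grid_path -(state_atE mP).
pose lt_c i := c <= \sum_(k < i) dtilt h q w k.
have full i : stopped_tilt (fun i => b * S i) a h xpredT q
    (grid_path S X h i w) = \sum_(k < i) dtilt h q w k.
  rewrite (stopped_tilt_path a b mP (ltW h0)).
  apply: eq_bigr => k _.
  suff -> : alive xpredT (grid_path S X h k w) by [].
  exact/alive_path.
have ex : exists i, lt_c i by exists j0.
have [j jc jmin] := ex_minnP ex.
have jj0 : (j <= j0)%N by exact: jmin.
have head_path i : b * S (head ord0 (grid_path S X h i w)) = b * m w (i%:R * h).
  by case: i => [|i] /=; rewrite -(state_atE mP)// mulr_ge0// ltW.
have aliveE i : (i <= J)%N -> alive good (grid_path S X h i w) = (i < j)%N.
  move=> iJ; apply/idP/idP => [/alive_path H|ij].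
    rewrite ltnNge; apply/negP => ji; have := H j ji.
    by rewrite /good full => /andP[_]; rewrite ltNge -/(lt_c j) jc.
  apply/alive_path => k ki; have kj : (k < j)%N by exact: leq_ltn_trans ij.
  rewrite /good head_path full j0K ?(leq_trans kj)//= ltNge.
  by apply/negP => /jmin; rewrite leqNgt kj.
rewrite (stopped_tilt_path a b mP (ltW h0)).
apply: le_trans jc _; rewrite le_eqVlt; apply/orP; left; apply/eqP.
rewrite (big_ord_widen J (dtilt h q w)) ?(leq_trans jj0)// big_mkcond/=.
by apply: eq_bigr => i _; rewrite aliveE// ltnW.
Qed.

(** The slope [q] is optimal for increments [2 q dV]; this is the distance from the curve which
    starts at the same point and has these increments. *)
Definition grid_deviation h (q : nat -> R) (w : T) (j : nat) : R :=
  U h b w j - b * m w 0 - \sum_(i < j) 2 * q i * clock_step a h i.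

Lemma grid_deviation0 h q w : grid_deviation h q w 0 = 0.
Proof.
by rewrite /grid_deviation /grid_scaled big_ord0 mul0r mulr0 expR0 mul1r subrr subr0.
Qed.

Lemma grid_deviationS h q w j :
  grid_deviation h q w j.+1 - grid_deviation h q w j =
  U h b w j.+1 - U h b w j - 2 * q j * clock_step a h j.
Proof. rewrite /grid_deviation big_ord_recr /=; ring. Qed.

Lemma grid_tilt_deviation h q w j : dtilt h q w j =
  q j * (grid_deviation h q w j.+1 - grid_deviation h q w j) +
  q j ^+ 2 * clock_step a h j.
Proof. rewrite grid_deviationS /grid_tilt; ring. Qed.

Lemma grid_tilt_shift h q th w j : dtilt h (fun i => q i + th) w j =
  dtilt h q w j + th * (grid_deviation h q w j.+1 - grid_deviation h q w j) -
  th ^+ 2 * clock_step a h j.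
Proof. rewrite grid_deviationS /grid_tilt; ring. Qed.

(** The mean of the exponential with slopes [q] is split by survival. Surviving paths contribute at
    most [expR (r * La)] times their probability. A path that exits has deviation at least [rho], so
    one of the slopes [q + th], [q - th] gains [th * rho - th ^+ 2 * clock a N0] in the exponent;
    the means of these two exponentials bound the loss. *)
Lemma grid_lower_bound : \forall h \near 0^'+,
    forall (J : nat) (q : nat -> R) (th rho La : R) (G : set R),
  J%:R * h <= N0 -> (forall i, (`|q i| + th) * expR (`|a| * N0) <= Q) ->
  0 < th -> 0 < rho ->
  (forall j x0 y, (j <= J)%N -> G x0 ->
    `|expR (a * (j%:R * h)) * y - x0 - \sum_(i < j) 2 * q i * clock_step a h i|
      < rho -> `|y| <= K) ->
  (forall D : nat -> R, D 0%N = 0 ->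
    (forall j, (j <= J)%N -> `|D j| < rho) ->
    \sum_(i < J) (q i * (D i.+1 - D i) + q i ^+ 2 * clock_step a h i) <= La) ->
  exists E, [/\ measurable E,
    expR (- (r * La)) * ((expR (- (4 * r * eta * N0)) -
      2 * expR (- (r * (th * rho - th ^+ 2 * clock a N0)) + 2 * r * eta * N0)) *
      Pr P (start_in G)) <= Pr P E &
    forall w, E w -> G (b * m w 0) /\
      forall j, (j <= J)%N -> `|grid_deviation h q w j| < rho].
Proof.
have S_inj := @cw_state_inj R n n0.
have r0 : 0 < r by rewrite rE; exact: speed_gt0.
apply: filterS2 (nbhs_right_gt 0) stopped_mean.
move=> h h0 mean_h J q th rho La G JN qQ th0 rho0 contained La_ub.
pose x i := b * S i.
pose dev s := scaled_value x a h s - x (last ord0 s) -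
  \sum_(i < (size s).-1) 2 * q i * clock_step a h i.
(* By the hypothesis [contained], on paths started in [G] the bound by [K] follows from the bound on
   the deviation, so an exit is an exit from the tube. *)
pose good s := [&& `[< G (x (last ord0 s)) >], `|x (head ord0 s)| <= K &
  `|dev s| < rho].
have goodK s : good s -> `|x (head ord0 s)| <= K by case/and3P.
have qQs (e : R) : `|e| = th -> forall i, `|q i + e| * expR (`|a| * N0) <= Q.
  move=> eth i; apply: le_trans (qQ i); rewrite ler_wpM2r ?expR_ge0//.
  by rewrite -eth ler_normD.
have qQ0 i : `|q i| * expR (`|a| * N0) <= Q.
  by apply: le_trans (qQ i); rewrite ler_wpM2r ?expR_ge0// lerDl ltW.
have /andP[m_ge _] := mean_h J q good G JN qQ0 goodK.
have /andP[_ mp_le] := mean_h J (fun i => q i + th) good G JN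
  (qQs th (gtr0_norm th0)) goodK.
have /andP[_ mm_le] := mean_h J (fun i => q i + - th) good G JN
  (qQs (- th) (etrans (normrN th) (gtr0_norm th0))) goodK.
clear mean_h.
pose ka := th * rho - th ^+ 2 * clock a N0.
pose B s := `[< G (x (last ord0 s)) >] && alive good s.
have [mE PE] := Pr_grid_event S_inj mP J B (ltW h0).
pose L q' s := stopped_tilt x a h good q' s.
have last_path i w : x (last ord0 (grid_path S X h i w)) = b * m w 0.
  by rewrite last_grid_path /x -(state_atE mP).
have head_path i w : x (head ord0 (grid_path S X h i w)) = b * m w (i%:R * h).
  by rewrite /x; case: i => [|i] /=; rewrite -(state_atE mP)// mulr_ge0// ltW.
have dev_path i w : dev (grid_path S X h i w) = grid_deviation h q w i.
  by rewrite /dev (scaled_value_path a b mP (ltW h0)) last_path size_grid_path.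
have good_path i w : (i <= J)%N -> G (b * m w 0) ->
    good (grid_path S X h i w) = (`|grid_deviation h q w i| < rho).
  move=> iJ Gw; rewrite /good last_path head_path dev_path.
  have -> : `[< G (b * m w 0) >] by exact/asboolP.
  rewrite /=; case: ltP => [D|]; last by rewrite andbF.
  by rewrite andbT; exact: (contained i (b * m w 0)).
have LE q' w : L q' (grid_path S X h J w) =
    \sum_(i < J) if alive good (grid_path S X h i w) then dtilt h q' w i else 0.
  exact: (stopped_tilt_path a b mP (ltW h0)).
have clock_sum k : \sum_(i < k) clock_step a h i = clock a (k%:R * h).
  elim: k => [|k IH]; first by rewrite big_ord0 mul0r clock0.
  by rewrite big_ord_recr/= IH /clock_step addrCA subrr addr0.
have clock_step_ge0 k : 0 <= clock_step a h k.
  by rewrite subr_ge0 clock_le// ler_pM2r// ler_nat.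
(* At the exit time, the slope [q + th] or [q - th], according to the side of
   exit, gains at least [ka] over the slope [q]. *)
have exit_bound w : G (b * m w 0) -> ~~ alive good (grid_path S X h J w) ->
    expR (r * L q (grid_path S X h J w)) <= expR (- (r * ka)) *
      (expR (r * L (fun i => q i + th) (grid_path S X h J w)) +
       expR (r * L (fun i => q i + - th) (grid_path S X h J w))).
  move=> Gw dead.
  have ex : exists i, ~~ good (grid_path S X h i w).
    apply/not_existsP => H; move/negP : dead; apply; apply/alive_path => i _.
    by have /negP/negPn := H i.
  have [k kbad kmin] := ex_minnP ex.
  have kJ : (k <= J)%N.
    rewrite leqNgt; apply/negP => Jk; move/negP: dead; apply; apply/alive_path.
    move=> i iJ; apply/negPn/negP => /kmin; rewrite leqNgt => /negP; apply.
    exact: leq_ltn_trans Jk.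
  have aliveE i : alive good (grid_path S X h i w) = (i < k)%N.
    apply/idP/idP => [/alive_path H|ik].
      by rewrite ltnNge; apply/negP => ki; move/negP: kbad; apply; exact: H.
    apply/alive_path => l li; apply/negPn/negP => /kmin; rewrite leqNgt.
    by rewrite (leq_ltn_trans li ik).
  have sumE (f : nat -> R) :
      \sum_(i < J) (if alive good (grid_path S X h i w) then f i else 0) =
      \sum_(i < k) f i.
    rewrite (big_ord_widen J f kJ) [RHS]big_mkcond/=.
    by apply: eq_bigr => i _; rewrite aliveE.
  have shift e : L (fun i => q i + e) (grid_path S X h J w) =
      L q (grid_path S X h J w) + e * grid_deviation h q w k -
      e ^+ 2 * clock a (k%:R * h).
    rewrite !LE !sumE -clock_sum.
    under eq_bigr do rewrite grid_tilt_shift.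
    rewrite sumrB big_split/= -!mulr_sumr; congr (_ + _ * _ - _).
    rewrite -[RHS]subr0 -[in RHS](grid_deviation0 h q w).
    rewrite -(telescope_sumr (grid_deviation h q w) (leq0n k)) big_mkord.
    by [].
  have ck : clock a (k%:R * h) <= clock a N0.
    apply: clock_le; apply: le_trans JN; rewrite ler_pM2r// ler_nat//.
  have : rho <= `|grid_deviation h q w k|.
    by move: kbad; rewrite good_path// -leNgt.
  have one_side e : `|e| = th -> th * rho <= e * grid_deviation h q w k ->
      expR (r * L q (grid_path S X h J w)) <= expR (- (r * ka)) *
      expR (r * L (fun i => q i + e) (grid_path S X h J w)).
    move=> eth D; rewrite -expRD ler_expR shift addrC -mulrBr ler_pM2l//.
    have e2 : e ^+ 2 = th ^+ 2 by rewrite -eth real_normK ?num_real.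
    rewrite e2 /ka; have : th ^+ 2 * clock a (k%:R * h) <= th ^+ 2 * clock a N0.
      by rewrite ler_wpM2l// sqr_ge0.
    lra.
  rewrite mulrDr; case: (leP 0 (grid_deviation h q w k)) => D0.
    rewrite ger0_norm// => D; apply: le_trans (one_side th _ _) _.
    - exact: gtr0_norm.
    - by rewrite ler_pM2l.
    - by rewrite lerDl mulr_ge0 ?expR_ge0.
  rewrite ltr0_norm// => D; apply: le_trans (one_side (- th) _ _) _.
  - by rewrite normrN gtr0_norm.
  - by rewrite mulNr -mulrN ler_pM2l.
  - by rewrite lerDr mulr_ge0 ?expR_ge0.
exists [set w | B (grid_path S X h J w)]; split => //; last first.
  move=> w /andP[/asboolP]; rewrite last_path => Gw /alive_path al.
  by split => // j jJ; rewrite -good_path// al.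
pose g s : R := (`[< G (x (last ord0 s)) >])%:R.
have main : expR (- (r * La)) *
    grid_mean S P X h J (fun s => g s * expR (r * L q s)) <=
    Pr P [set w | B (grid_path S X h J w)] +
    expR (- (r * La)) * (expR (- (r * ka)) *
      (grid_mean S P X h J (fun s => g s * expR (r * L (fun i => q i + th) s)) +
       grid_mean S P X h J (fun s => g s * expR (r * L (fun i => q i + - th) s)))).
  rewrite PE -grid_meanD -!grid_meanZ -grid_meanD.
  apply: le_grid_mean_path => w; rewrite /B /g.
  have e_ge0 : 0 <= expR (- (r * La)) * (expR (- (r * ka)) *
      (expR (r * L (fun i => q i + th) (grid_path S X h J w)) +
       expR (r * L (fun i => q i + - th) (grid_path S X h J w)))).
    by rewrite !mulr_ge0 ?expR_ge0// addr_ge0 ?expR_ge0.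
  case: asboolP => [|_]; last by rewrite !mul0r add0r addr0 !mulr0.
  rewrite last_path => Gw; rewrite !mul1r.
  have [al|dead] := boolP (alive good (grid_path S X h J w)); last first.
    by rewrite add0r ler_wpM2l ?expR_ge0// exit_bound.
  rewrite -[leLHS]addr0 lerD//= -expRD -[leRHS]expR0 ler_expR.
  rewrite addrC -mulrBr pmulr_rle0// subr_le0 LE.
  have gd i : (i <= J)%N -> `|grid_deviation h q w i| < rho.
    by move=> iJ; rewrite -good_path//; move/alive_path : al; exact.
  apply: le_trans (La_ub _ (grid_deviation0 h q w) gd).
  rewrite le_eqVlt; apply/orP; left; apply/eqP; apply: eq_bigr => i _.
  rewrite -grid_tilt_deviation.
  suff -> : alive good (grid_path S X h i w) by [].
  by apply/alive_path => l li; rewrite good_path ?gd// ltnW// (leq_ltn_trans li).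
rewrite mulrBl mulrBr lerBlDr; apply: le_trans (le_trans main _).
  by rewrite ler_wpM2l ?expR_ge0.
rewrite lerD// ler_wpM2l ?expR_ge0// expRD -/ka.
rewrite [leRHS](_ : _ = expR (- (r * ka)) *
  (expR (2 * r * eta * N0) * Pr P (start_in G) +
   expR (2 * r * eta * N0) * Pr P (start_in G))); last by ring.
by rewrite ler_wpM2l ?expR_ge0// lerD.
Qed.

End tilted_bounds.

(** * Primitives and energy *)

Local Notation leb := lebesgue_measure.

Section primitives.
Context {R : realType}.
Implicit Types (x g f h : R -> R) (T s t : R) (D : set (measurableTypeR R)).

Lemma integrable_mul_bounded D f h (M : R) : measurable D ->
  measurable_fun D h -> (forall r, D r -> `|h r| <= M) ->
  leb.-integrable D (EFin \o f) ->
  leb.-integrable D (EFin \o (fun r => h r * f r)).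
Proof.
move=> mD mh hM fi.
have bh : [bounded h r | r in D].
  exists M; split; first exact: num_real.
  by move=> y My r Dr /=; rewrite (le_trans (hM r Dr))// ltW.
by have := integrableMr mD mh bh fi; apply: eq_integrable.
Qed.

Lemma integrableZl_EFin D f (k : R) : measurable D ->
  leb.-integrable D (EFin \o f) ->
  leb.-integrable D (EFin \o (fun r => k * f r)).
Proof.
move=> mD fi; have := integrableZl mD k fi.
by apply: eq_integrable => // r _; rewrite /= EFinM.
Qed.

Lemma integrableD_EFin D f h : measurable D ->
  leb.-integrable D (EFin \o f) -> leb.-integrable D (EFin \o h) ->
  leb.-integrable D (EFin \o (fun r => f r + h r)).
Proof.
move=> mD fi hi; have := integrableD mD fi hi.
by apply: eq_integrable => // r _; rewrite /= EFinD.
Qed.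

Lemma integrableB_EFin D f h : measurable D ->
  leb.-integrable D (EFin \o f) -> leb.-integrable D (EFin \o h) ->
  leb.-integrable D (EFin \o (fun r => f r - h r)).
Proof.
move=> mD fi hi; have := integrableB mD fi hi.
by apply: eq_integrable => // r _; rewrite /= EFinB.
Qed.

Lemma continuous_integrable_itv s t f : continuous f ->
  leb.-integrable `[s, t] (EFin \o f).
Proof.
move=> cf; apply: continuous_compact_integrable; first exact: segment_compact.
exact: continuous_subspaceT.
Qed.

Lemma primitive_incr T x g s t : primitive_on T x g -> 0 <= s -> s <= t ->
  t <= T -> x t - x s = \int[leb]_(r in `]s, t]) g r.
Proof.
move=> [gi xg] s0 st tT; rewrite xg ?(le_trans s0 st)// (xg s); last first.
  by rewrite s0 (le_trans st).
rewrite opprD addrACA subrr add0r Rintegral_itvB ?bnd_simp//.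
by apply: integrableS gi => //; apply: subset_itvl; rewrite bnd_simp.
Qed.

Lemma primitive_continuous T x g : 0 <= T -> primitive_on T x g ->
  {within `[0, T], continuous x}.
Proof.
move=> T0 [gi xg].
apply: (@subspace_eq_continuous _ _ _
    (fun t => x 0 + parameterized_integral leb 0 t g)).
  by move=> t; rewrite inE /= in_itv/= => /xg <-.
move=> t; apply: cvgD; first exact: cvg_cst.
exact: parameterized_integral_continuous.
Qed.

(** The difference of the two densities has vanishing integrals over all [[0, t]], and by the
    Lebesgue differentiation theorem it is almost everywhere the derivative of these integrals. *)
Lemma primitive_on_unique T x g h : 0 < T ->
  primitive_on T x g -> primitive_on T x h ->
  {ae leb, forall r, r \in `]0, T[ -> g r = h r}.
Proof.
move=> T0 [gi xg] [hi xh].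
pose f := fun r => g r - h r.
have fi : leb.-integrable `[0, T] (EFin \o f).
  exact: integrableB_EFin.
pose fT := f \_ `[0, T].
have fTi : leb.-integrable setT (EFin \o fT).
  by rewrite -restrict_EFin; apply/(integrable_mkcond _ _).1.
have loc : locally_integrable setT fT by exact: integrable_locally.
have := @FTC1 R fT (BLeft 0) _ loc.
have fTy y : leb.-integrable [set` Interval (BLeft 0) (BRight y)] (EFin \o fT).
  exact: integrableS fTi.
move=> /(_ fTy) /=.
apply: filterS; first exact: (ae_filter_ringOfSetsType leb).
move=> r H; rewrite in_itv/= => /andP[r0 rT].
have {H}[] := H; first by rewrite lte_fin.
set F := fun r => _; move=> _.
have F0 t : 0 <= t <= T -> F t = 0.
  move=> /andP[t0 tT]; rewrite /F.
  have -> : \int[leb]_(u in `[0, t]) fT u = \int[leb]_(u in `[0, t]) f u.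
    apply: eq_Rintegral => u; rewrite inE/= in_itv/= => /andP[u0 ut].
    by rewrite /fT patchE mem_set//= in_itv/= u0 (le_trans ut).
  have git : leb.-integrable `[0, t] (EFin \o g).
    by apply: integrableS gi => //; apply: subset_itvl; rewrite bnd_simp.
  have hit : leb.-integrable `[0, t] (EFin \o h).
    by apply: integrableS hi => //; apply: subset_itvl; rewrite bnd_simp.
  rewrite RintegralB//; have := xg t; have := xh t.
  by rewrite t0 tT => -> // /(_ isT) /addrI ->; rewrite subrr.
have -> : (derive1 F) r = 0.
  rewrite derive1E.
  have nearE : {near r, F =1 cst 0}.
    have rI : r \in `]0, T[ by rewrite in_itv/= r0.
    apply: filterS (near_in_itvoo rI) => u; rewrite in_itv/= => /andP[u0 uT].
    by rewrite F0// ?(ltW u0) ?(ltW uT).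
  by rewrite (near_eq_derive _ nearE) derive_cst.
by rewrite /fT patchE mem_set/= ?in_itv/= ?(ltW r0) ?(ltW rT)// => /esym/subr0_eq.
Qed.

(* Cut [0, T] into n cells: the bounds on the cells sum up to O(1 / n). *)
Lemma vanishing_increments (D G : R -> R) (C T : R) : 0 <= T -> 0 <= C ->
  (forall s t, 0 <= s -> s <= t -> t <= T ->
    `|D t - D s| <= C * (t - s) * (G t - G s)) -> D T = D 0.
Proof.
move=> T0 C0 H; apply/subr0_eq/eqP; rewrite -normr_le0.
have GT0 : 0 <= C * T * (G T - G 0).
  by apply: le_trans (normr_ge0 _) _; rewrite -[T in C * T]subr0; exact: H.
have bound (n : nat) : `|D T - D 0| <= C * T * (G T - G 0) / n.+1%:R.
  pose t i := i%:R * (T / n.+1%:R).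
  have tn : t n.+1 = T by rewrite /t mulrC divfK// pnatr_eq0.
  have t0 : t 0%N = 0 by rewrite /t mul0r.
  have h0 : 0 <= T / n.+1%:R by rewrite divr_ge0.
  have tS i : t i.+1 - t i = T / n.+1%:R by rewrite /t -natr1; ring.
  rewrite -[in leLHS]tn -[in leLHS]t0.
  have -> : D (t n.+1) - D (t 0%N) = \sum_(i < n.+1) (D (t i.+1) - D (t i)).
    by rewrite -(telescope_sumr (D \o t) (leq0n n.+1)) big_mkord.
  apply: le_trans (ler_norm_sum _ _ _) _.
  apply: (@le_trans _ _ (\sum_(i < n.+1) C * (T / n.+1%:R) *
      (G (t i.+1) - G (t i)))).
    apply: ler_sum => i _; rewrite -(tS i); apply: H.
    - by rewrite mulr_ge0.
    - by rewrite -subr_ge0 tS.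
    - by rewrite -[leRHS]tn ler_wpM2r// ler_nat.
  rewrite -mulr_sumr -(big_mkord xpredT (fun i => G (t i.+1) - G (t i))).
  rewrite (telescope_sumr (G \o t))//= tn t0.
  by rewrite le_eqVlt; apply/orP; left; apply/eqP; ring.
rewrite leNgt; apply/negP => d0.
have [n Hn] : exists n : nat, C * T * (G T - G 0) / `|D T - D 0| < n.+1%:R.
  exists (Num.truncn (C * T * (G T - G 0) / `|D T - D 0|)); exact: truncnS_gt.
have := bound n; rewrite leNgt => /negP; apply.
by rewrite ltr_pdivrMr ?ltr0Sn// -ltr_pdivrMl// mulrC.
Qed.

Lemma expR_lipschitz (c T s t : R) : 0 <= s -> s <= t -> t <= T ->
  `|expR (c * t) - expR (c * s)| <= `|c| * expR (`|c| * T) * (t - s).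
Proof.
move=> s0 st tT.
have dE (z : R) : is_derive z 1 (fun z => expR (c * z)) (c * expR (c * z)).
  by apply: is_derive_eq; rewrite /GRing.scale/=; ring.
have [z /andP[sz zt] ->] := MVT_derive st dE.
rewrite normrM (ger0_norm (_ : 0 <= t - s)) ?subr_ge0// ler_wpM2r ?subr_ge0//.
rewrite normrM ler_wpM2l// ger0_norm ?expR_ge0// ler_expR.
apply: le_trans (ler_norm _) _; rewrite normrM ler_wpM2l//.
by rewrite ger0_norm ?(le_trans s0)// (le_trans zt).
Qed.

Lemma continuous_expRM (c : R) : continuous (fun z : R => expR (c * z)).
Proof.
have dE (z : R) : is_derive z 1 (fun z => expR (c * z)) (c * expR (c * z)).
  by apply: is_derive_eq; rewrite /GRing.scale/=; ring.
by move=> z; apply: differentiable_continuous; apply/derivable1_diffP.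
Qed.

Lemma continuous_clock (c : R) : continuous (clock c).
Proof.
move=> z; apply: differentiable_continuous; apply/derivable1_diffP.
exact: (@ex_derive _ _ _ _ _ _ _ (is_derive_clock c z)).
Qed.

Lemma Rintegral_expR (c s t : R) : s <= t ->
  \int[leb]_(r in `]s, t]) (c * expR (c * r)) = expR (c * t) - expR (c * s).
Proof.
rewrite le_eqVlt => /predU1P[->|st].
  by rewrite set_itv_ge ?bnd_simp ?ltxx// Rintegral_set0 subrr.
have dE (z : R) : is_derive z 1 (fun z => expR (c * z)) (c * expR (c * z)).
  by apply: is_derive_eq; rewrite /GRing.scale/=; ring.
have cE := @continuous_expRM c.
have cf : continuous (fun r => c * expR (c * r)).
  by move=> z; apply: cvgM; [exact: cvg_cst|exact: cE].
rewrite Rintegral_itv_obnd_cbnd; last first.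
  apply: integrableS (continuous_integrable_itv s t cf) => //.
  by apply: subset_itvr; rewrite bnd_simp.
rewrite /Rintegral (@continuous_FTC2 _ _ (fun z => expR (c * z)))//.
- exact: continuous_subspaceT.
- split.
  + by move=> z _; exact: (@ex_derive _ _ _ _ _ _ _ (dE z)).
  + by apply: cvg_at_right_filter; exact: cE.
  + by apply: cvg_at_left_filter; exact: cE.
- by move=> z _; rewrite derive1E; exact: (@derive_val _ _ _ _ _ _ _ (dE z)).
Qed.

Lemma length_itv_oc (s t : R) : s <= t ->
  fine (leb (`]s, t] : set (measurableTypeR R))) = t - s.
Proof.
have -> : leb (`]s, t] : set (measurableTypeR R)) = _ :=
  lebesgue_measure_itv `]s, t]%R.
by rewrite /= lte_fin le_eqVlt; case: ltP => //= _ /orP[/eqP ->|//]; rewrite ?subrr.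
Qed.

(** The product rule for an absolutely continuous curve and a smooth factor. The two sides differ by
    a function whose increment over []s, u]] is at most a constant times [u - s] times the integral
    of the norm of [g], hence by a constant. *)
Lemma primitive_expR (c T : R) x g : 0 <= T -> primitive_on T x g ->
  primitive_on T (fun t => expR (c * t) * x t)
    (fun t => expR (c * t) * (g t + c * x t)).
Proof.
move=> T0 xg; have [gi _] := xg.
have cE := @continuous_expRM c.
have mE (D : set (measurableTypeR R)) : measurable_fun D (fun z => expR (c * z)).
  exact: (measurable_funTS (continuous_measurable_fun cE)).
have xi : leb.-integrable `[0, T] (EFin \o x).
  apply: continuous_compact_integrable; first exact: segment_compact.
  exact: primitive_continuous xg.
have Eb t : t \in `[0, T] -> `|expR (c * t)| <= expR (`|c| * T).
  rewrite in_itv/= => /andP[t0 tT]; rewrite ger0_norm ?expR_ge0// ler_expR.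
  by apply: le_trans (ler_norm _) _; rewrite normrM ler_wpM2l// ger0_norm.
have cxi : leb.-integrable `[0, T] (EFin \o (fun t => c * x t)).
  by exact: integrableZl_EFin.
have Fi : leb.-integrable `[0, T]
    (EFin \o (fun t => expR (c * t) * (g t + c * x t))).
  apply: (@integrable_mul_bounded _ _ _ (expR (`|c| * T))) => //.
  exact: integrableD_EFin.
split => // t /andP[t0 tT]; rewrite mulr0 expR0 mul1r.
pose f := fun r => expR (c * r) * (g r + c * x r).
pose I (h : R -> R) u := \int[leb]_(r in `[0, u]) h r.
have I0 h : I h 0 = 0 by rewrite /I set_itv1 Rintegral_set1.
have sub s u : 0 <= s -> s <= u -> u <= T ->
    `]s, u] `<=` (`[0, T] : set (measurableTypeR R)).
  by move=> s0 su uT; apply: subset_itv; rewrite bnd_simp.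
have IB h s u : leb.-integrable `[0, T] (EFin \o h) -> 0 <= s -> s <= u -> u <= T ->
    I h u - I h s = \int[leb]_(r in `]s, u]) h r.
  move=> hi s0 su uT; rewrite /I Rintegral_itvB ?bnd_simp//.
  by apply: integrableS hi => //; apply: subset_itvl; rewrite bnd_simp.
suff : expR (c * t) * x t - I f t = expR (c * 0) * x 0 - I f 0.
  by rewrite I0 subr0 mulr0 expR0 mul1r => /eqP; rewrite subr_eq => /eqP ->.
pose M := `|c| * expR (`|c| * T).
have M0 : 0 <= M by rewrite mulr_ge0// expR_ge0.
have gni : leb.-integrable `[0, T] (EFin \o (fun r => `|g r|)).
  exact: integrable_norm.
apply: (@vanishing_increments (fun u => expR (c * u) * x u - I f u)
  (I (fun r => `|g r|)) (2 * M)) => //; first by rewrite mulr_ge0.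
move=> s u s0 su ut; have uT := le_trans ut tT.
have dI h : leb.-integrable `[0, T] (EFin \o h) ->
    leb.-integrable `]s, u] (EFin \o h).
  by move=> hi; apply: integrableS hi => //; exact: sub.
have xE : forall v, s <= v -> v <= u -> `|x u - x v| <=
    \int[leb]_(r in `]s, u]) `|g r|.
  move=> v sv vu; have v0 := le_trans s0 sv.
  rewrite (primitive_incr xg v0 vu uT).
  apply: le_trans (le_normr_Rintegral _ _) _ => //.
    by apply: integrableS gi => //; exact: sub.
  rewrite -(IB _ v u gni v0 vu uT) -(IB _ s u gni s0 su uT) lerD2l lerN2.
  rewrite -subr_ge0 (IB _ s v gni s0 sv (le_trans vu uT)).
  exact: Rintegral_ge0.
(* An exact formula for the increment of the difference: each term is the variation of one factor
   within the cell times the velocity of the other. *)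
have E1 : (expR (c * u) * x u - I f u) - (expR (c * s) * x s - I f s) =
    \int[leb]_(r in `]s, u]) ((expR (c * s) - expR (c * r)) * g r +
       (c * expR (c * r)) * (x u - x r)).
  have cEi : leb.-integrable `[0, T] (EFin \o (fun r => c * expR (c * r))).
    apply: continuous_integrable_itv => z; apply: cvgM; first exact: cvg_cst.
    exact: cE.
  have -> : \int[leb]_(r in `]s, u]) ((expR (c * s) - expR (c * r)) * g r +
      (c * expR (c * r)) * (x u - x r)) =
    \int[leb]_(r in `]s, u]) (expR (c * s) * g r +
      x u * (c * expR (c * r)) - f r).
    by apply: eq_Rintegral => r _; rewrite /f; ring.
  have gi' := dI _ gi; have cEi' := dI _ cEi; have fi' := dI _ Fi.
  have sgi : leb.-integrable `]s, u] (EFin \o (fun r => expR (c * s) * g r)).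
    exact: integrableZl_EFin.
  have xci : leb.-integrable `]s, u] (EFin \o (fun r => x u * (c * expR (c * r)))).
    exact: integrableZl_EFin.
  rewrite RintegralB//; last exact: integrableD_EFin.
  rewrite RintegralD// RintegralZl// (_ : \int[leb]_(r in `]s, u]) (x u * _) =
    x u * (\int[leb]_(r in `]s, u]) (c * expR (c * r)))).
    rewrite Rintegral_expR// -(primitive_incr xg)// -IB//; ring.
  by rewrite RintegralZl.
rewrite E1 IB//.
set B := \int[leb]_(r in `]s, u]) `|g r|.
have B0 : 0 <= B by exact: Rintegral_ge0.
have us0 : 0 <= u - s by rewrite subr_ge0.
have gi' := dI _ gi; have gni' := dI _ gni.
have cEi : leb.-integrable `]s, u] (EFin \o (fun r => expR (c * r))).
  by apply: dI; exact: continuous_integrable_itv.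
have ki : leb.-integrable `]s, u]
    (EFin \o (fun r => (expR (c * s) - expR (c * r)) * g r +
       (c * expR (c * r)) * (x u - x r))).
  have ci (k : R) : leb.-integrable `]s, u] (EFin \o (fun=> k)).
    by apply: dI; apply: continuous_integrable_itv => z; exact: cvg_cst.
  have D s' : s' \in `]s, u] -> s' \in `[0, T].
    by move=> /(sub s u s0 su uT).
  apply: integrableD_EFin => //.
    apply: (@integrable_mul_bounded _ _ _ (M * (u - s))) => //.
      by apply: measurable_funB => //; exact: measurable_cst.
    move=> r; rewrite /= in_itv/= => /andP[/ltW sr ru].
    rewrite distrC (le_trans (expR_lipschitz c s0 sr (le_trans ru uT)))//.
    by rewrite ler_wpM2l// lerD2r.
  apply: (@integrable_mul_bounded _ _ _ M) => //.
  - by apply: measurable_funM => //; exact: measurable_cst.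
  - by move=> r rI; rewrite normrM ler_wpM2l// Eb// D.
  - apply: integrableB_EFin => //; exact: dI.
apply: le_trans (le_normr_Rintegral _ ki) _ => //.
have ri : leb.-integrable `]s, u] (EFin \o (fun r => M * (u - s) * `|g r| + M * B)).
  apply: integrableD_EFin => //.
    exact: integrableZl_EFin.
  by apply: dI; apply: continuous_integrable_itv => z; exact: cvg_cst.
apply: (@le_trans _ _ (\int[leb]_(r in `]s, u]) (M * (u - s) * `|g r| + M * B))).
  apply: le_Rintegral => //; first exact: integrable_norm.
  move=> r; rewrite /= in_itv/= => /andP[/ltW sr ru].
  apply: le_trans (ler_normD _ _) _; rewrite !normrM lerD//.
    rewrite ler_wpM2r// distrC.
    rewrite (le_trans (expR_lipschitz c s0 sr (le_trans ru uT)))//.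
    by rewrite ler_wpM2l// lerD2r.
  rewrite ler_pM ?mulr_ge0//; last exact: xE.
  by rewrite ler_wpM2l// Eb// in_itv/= (le_trans s0 sr) (le_trans ru uT).
rewrite RintegralD//; last 2 first.
  exact: integrableZl_EFin.
  by apply: dI; apply: continuous_integrable_itv => z; exact: cvg_cst.
rewrite RintegralZl// Rintegral_cst// -/B length_itv_oc//.
by rewrite le_eqVlt; apply/orP; left; apply/eqP; ring.
Qed.

End primitives.

(** * The energy and its linear lower bounds *)

Section rate_bounds.
Context {R : realType} (beta : R).
Implicit Types (x g : R -> R) (T s t p : R).
Local Notation a := (2 * (1 - beta)).
Local Notation halfline := (`[0%R, +oo[%classic : set (measurableTypeR R)).

Lemma cw_lagrangianE y v : cw_lagrangian beta y v = (v + a * y) ^+ 2 / 8.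
Proof.
by rewrite /cw_lagrangian real_normK ?num_real// mulrC; congr (_ ^+ 2 * _); ring.
Qed.

Lemma cw_lagrangian_ge0 y v : 0 <= cw_lagrangian beta y v.
Proof. by rewrite cw_lagrangianE mulr_ge0// sqr_ge0. Qed.

Lemma measurable_lagrangian T x g : 0 <= T -> primitive_on T x g ->
  measurable_fun (`[0, T] : set (measurableTypeR R))
    (fun s => (cw_lagrangian beta (x s) (g s))%:E).
Proof.
move=> T0 xg; apply/measurable_EFinP.
apply: (eq_measurable_fun (fun s => (g s + a * x s) ^+ 2 / 8)) => [s _|].
  by rewrite cw_lagrangianE.
have mg : measurable_fun (`[0, T] : set (measurableTypeR R)) g.
  by apply/measurable_EFinP; case: xg => /integrableP[].
have mx : measurable_fun (`[0, T] : set (measurableTypeR R)) x.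
  apply: subspace_continuous_measurable_fun => //.
  exact: primitive_continuous xg.
apply: measurable_funM => //; apply: measurable_funX.
by apply: measurable_funD => //; apply: measurable_funM.
Qed.

Lemma halflineE : halfline = \bigcup_k (`[0%R, k%:R]%classic : set (measurableTypeR R)).
Proof.
have := itv_bndy_bigcup_BRight true (0 : R).
by rewrite /= => ->; apply: eq_bigcupr => k _; rewrite add0r.
Qed.

Lemma measurable_lagrangian_halfline x g :
  (forall T, 0 <= T -> primitive_on T x g) ->
  measurable_fun halfline (fun s => (cw_lagrangian beta (x s) (g s))%:E).
Proof.
move=> xg; rewrite halflineE; apply/measurable_fun_bigcup => // k.
by apply: measurable_lagrangian => //; exact: xg.
Qed.

Lemma Rintegral_clock s t : s <= t ->
  \int[leb]_(r in `]s, t]) (2 * expR (2 * a * r)) = clock a t - clock a s.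
Proof.
rewrite le_eqVlt => /predU1P[->|st].
  by rewrite set_itv_ge ?bnd_simp ?ltxx// Rintegral_set0 subrr.
have cf : continuous (fun r => 2 * expR (2 * a * r)).
  move=> z; apply: cvgM; first exact: cvg_cst.
  exact: continuous_expRM.
have cc := @continuous_clock R a.
rewrite Rintegral_itv_obnd_cbnd; last first.
  apply: integrableS (continuous_integrable_itv s t cf) => //.
  by apply: subset_itvr; rewrite bnd_simp.
rewrite /Rintegral (@continuous_FTC2 _ _ (clock a))//.
- exact: continuous_subspaceT.
- split.
  + move=> z _; exact: (@ex_derive _ _ _ _ _ _ _ (is_derive_clock a z)).
  + by apply: cvg_at_right_filter; exact: cc.
  + by apply: cvg_at_left_filter; exact: cc.
- move=> z _; rewrite derive1E.
  exact: (@derive_val _ _ _ _ _ _ _ (is_derive_clock a z)).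
Qed.

(** The upper function may have an infinite integral, which a comparison of real integrals would
    exclude. *)
Lemma le_Rintegral_integral (D : set (measurableTypeR R)) (f h : R -> R) :
  measurable D -> leb.-integrable D (EFin \o f) ->
  measurable_fun D (EFin \o h) -> (forall r, D r -> 0 <= h r) ->
  (forall r, D r -> f r <= h r) ->
  ((\int[leb]_(r in D) f r)%:E <= \int[leb]_(r in D) (h r)%:E)%E.
Proof.
move=> mD fi mh h0 fh.
have [Iy|Iny] := eqVneq (\int[leb]_(r in D) (h r)%:E)%E +oo%E.
  by rewrite Iy leey.
have hi : leb.-integrable D (EFin \o h).
  apply/integrableP; split => //.
  under eq_integral => r rD.
    rewrite gee0_abs ?lee_fin ?h0//; last exact/set_mem.
    over.
  by rewrite ltey.
rewrite /Rintegral fineK; last exact: integrable_fin_num.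
by apply: le_integral => // r /set_mem rD; rewrite lee_fin fh.
Qed.

(* Pointwise, [p e y - 2 p^2 e^2 <= y^2 / 8] with [e = e^(a r)], [y = g + a x]. *)
Lemma tilt_le_energy T x g p s t : primitive_on T x g ->
  0 <= s -> s <= t -> t <= T ->
  ((p * (expR (a * t) * x t - expR (a * s) * x s) -
     p ^+ 2 * (clock a t - clock a s))%:E <=
   \int[leb]_(r in `]s, t]) (cw_lagrangian beta (x r) (g r))%:E)%E.
Proof.
move=> xg s0 st tT; have T0 : 0 <= T by apply: le_trans tT; exact: le_trans st.
have ug := primitive_expR a T0 xg.
have sub : `]s, t] `<=` (`[0, T] : set (measurableTypeR R)).
  by apply: subset_itv; rewrite bnd_simp.
have ui : leb.-integrable `]s, t]
    (EFin \o (fun r => expR (a * r) * (g r + a * x r))).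
  by have [ui _] := ug; apply: integrableS ui => //.
have ci : leb.-integrable `]s, t] (EFin \o (fun r => 2 * expR (2 * a * r))).
  have cf : continuous (fun r => 2 * expR (2 * a * r)).
    move=> z; apply: cvgM; first exact: cvg_cst.
    exact: continuous_expRM.
  apply: integrableS (continuous_integrable_itv s t cf) => //.
  by apply: subset_itvr; rewrite bnd_simp.
rewrite (primitive_incr ug s0 st tT) -Rintegral_clock//.
rewrite -!RintegralZl// -RintegralB//; [|exact: integrableZl_EFin..].
apply: le_Rintegral_integral => //.
- by apply: integrableB_EFin => //; exact: integrableZl_EFin.
- by apply: measurable_funS (measurable_lagrangian T0 xg) => //.
- by move=> r _; exact: cw_lagrangian_ge0.
move=> r _; rewrite cw_lagrangianE.
have -> : expR (2 * a * r) = expR (a * r) ^+ 2.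
  by rewrite -expRM_natl; congr expR; ring.
rewrite -subr_ge0.
have -> : (g r + a * x r) ^+ 2 / 8 - (p * (expR (a * r) * (g r + a * x r)) -
    p ^+ 2 * (2 * expR (a * r) ^+ 2)) =
  ((g r + a * x r) - 4 * p * expR (a * r)) ^+ 2 / 8 by field.
by rewrite mulr_ge0// sqr_ge0.
Qed.

Lemma energy_ge0 (D : set (measurableTypeR R)) x g :
  (0 <= \int[leb]_(r in D) (cw_lagrangian beta (x r) (g r))%:E)%E.
Proof. by apply: integral_ge0 => r _; rewrite lee_fin cw_lagrangian_ge0. Qed.

(** Additivity over the cells. With the slopes of the polygonal interpolation, the left-hand side is
    the cost of the interpolation, which is thus at most the energy of the curve; the lower bound
    relies on this. *)
Lemma tilt_sum_le_energy x g (p t : nat -> R) (M : nat) :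
  (forall T, 0 <= T -> primitive_on T x g) ->
  t 0%N = 0 -> (forall k, t k <= t k.+1) ->
  ((\sum_(k < M) (p k * (expR (a * t k.+1) * x (t k.+1) -
      expR (a * t k) * x (t k)) -
     p k ^+ 2 * (clock a (t k.+1) - clock a (t k))))%:E <=
   \int[leb]_(r in `[0%R, +oo[) (cw_lagrangian beta (x r) (g r))%:E)%E.
Proof.
move=> xg t0 tS.
have tge0 k : 0 <= t k.
  by elim: k => [|k IH]; rewrite ?t0// (le_trans IH).
have mL := measurable_lagrangian_halfline xg.
have subH s u : 0 <= s -> `]s, u] `<=` halfline.
  by move=> s0 r /=; rewrite !in_itv/= andbT => /andP[/ltW sr _]; exact: le_trans sr.
apply: (@le_trans _ _
   (\int[leb]_(r in `]0%R, t M]) (cw_lagrangian beta (x r) (g r))%:E)%E); last first.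
  apply: ge0_subset_integral => //; last exact: subH.
  by move=> r _; rewrite lee_fin cw_lagrangian_ge0.
elim: M => [|M IH]; first by rewrite big_ord0 energy_ge0.
rewrite big_ord_recr/= EFinD.
rewrite (@itv_bndbnd_setU _ _ _ (BRight (t M))) ?bnd_simp//.
rewrite ge0_integral_setU//; last 3 first.
- apply: measurable_funS mL => // r [|] /=; rewrite !in_itv/= andbT => /andP[/ltW h _] //.
  exact: le_trans h.
- by move=> r _; rewrite lee_fin cw_lagrangian_ge0.
- apply/disj_setPS => y [/=]; rewrite !in_itv/= => /andP[_ yx] /andP[].
  by rewrite ltNge yx.
by apply: leeD => //; apply: (tilt_le_energy (T := t M.+1)) => //; exact: xg.
Qed.

Lemma energy_halfline_le x g (C : \bar R) :
  (forall T, 0 <= T -> primitive_on T x g) ->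
  (forall n : nat,
    (\int[leb]_(r in `[0%R, n%:R]) (cw_lagrangian beta (x r) (g r))%:E <= C)%E) ->
  (\int[leb]_(r in `[0%R, +oo[) (cw_lagrangian beta (x r) (g r))%:E <= C)%E.
Proof.
move=> xg H; rewrite halflineE.
have cvgI := @ge0_nondecreasing_set_cvg_integral _ _ _
  (fun k : nat => `[0%R, k%:R]%classic : set (measurableTypeR R))
  (fun r => (cw_lagrangian beta (x r) (g r))%:E) leb.
have {}cvgI := cvgI _ _ _ _.
have {}cvgI : (\int[leb]_(r in `[0%R, k%:R])
      (cw_lagrangian beta (x r) (g r))%:E)%E @[k --> \oo] -->
    (\int[leb]_(r in \bigcup_k `[0%R, k%:R]%classic)
      (cw_lagrangian beta (x r) (g r))%:E)%E.
  apply: cvgI => //.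
  - move=> m n mn; apply/subsetPset => r /=; rewrite !in_itv/= => /andP[-> /=].
    by move=> /le_trans; apply; rewrite ler_nat.
  - by move=> n; apply: measurable_lagrangian => //; exact: xg.
  - by move=> n r _; rewrite lee_fin cw_lagrangian_ge0.
rewrite -(cvg_lim _ cvgI)//; apply: lime_le; last exact: nearW.
by apply/cvg_ex; eexists; exact: cvgI.
Qed.

(** The velocity in the rate is chosen by [get]. Densities are unique almost everywhere, so any
    density on the half-line gives the same energy; time 0 is discarded because uniqueness is stated
    on open intervals. *)
Lemma cw_rate_primitive (I0 : R -> \bar R) (x : skorohod R) g :
  (forall T, 0 <= T -> primitive_on T x g) ->
  cw_rate beta I0 x = (I0 (x 0%R) +
    \int[leb]_(r in `[0%R, +oo[) (cw_lagrangian beta (x r) (g r))%:E)%E.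
Proof.
move=> xg; have xac : abs_continuous x by move=> T T0; exists g; exact: xg.
rewrite /cw_rate; case: asboolP => // _; congr (_ + _)%E.
have xv := velocityP xac.
apply: ge0_ae_eq_integral => //.
- exact: measurable_lagrangian_halfline.
- exact: measurable_lagrangian_halfline.
- by move=> r _; rewrite lee_fin cw_lagrangian_ge0.
- by move=> r _; rewrite lee_fin cw_lagrangian_ge0.
have H (n : nat) := primitive_on_unique (ltr0Sn R n) (xv _ (ler0n R n.+1))
  (xg _ (ler0n R n.+1)).
have {}H := ae_foralln H.
have H0 : {ae leb, forall r : R, r != 0}.
  exists [set 0]; split => //; first exact: lebesgue_measure_set1.
  by move=> r /= /negP/negPn/eqP.
apply: filterS2 H H0 => r Hr r0; rewrite /= in_itv/= andbT => rge0.
congr (_%:E); congr cw_lagrangian; apply: (Hr (Num.truncn r)).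
by rewrite in_itv/= lt0r r0 rge0 truncnS_gt.
Qed.

End rate_bounds.

Section continuous_paths.
Context {R : realType}.

(** Composing with [max t 0] yields the extension, constant at negative times, that the
    representation requires; it is continuous on the whole line. *)
Lemma continuous_skorohod (y : R -> R) :
  (forall T, 0 <= T -> {within `[0, T], continuous y}) ->
  exists x : skorohod R, forall t, 0 <= t -> x t = y t.
Proof.
move=> cy; pose z (t : R) := y (Num.max t 0).
have cz : continuous z.
  move=> t U /= Ut.
  pose T := `|t| + 1.
  have T0 : 0 <= T by rewrite addr_ge0.
  have max_ge0 s : 0 <= Num.max s 0 :> R by rewrite le_max lexx orbT.
  have maxT : Num.max t 0 < T.
    by rewrite gt_max /T (le_lt_trans (ler_norm _)) ?ltrDl//= ltr_wpDl.
  have /subspace_continuousP := cy T T0.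
  move=> /(_ (Num.max t 0)); rewrite /= in_itv/= max_ge0 (ltW maxT).
  move=> /(_ isT U Ut) /= HU.
  have cmax : (fun s : R => Num.max s 0) @ t --> Num.max t 0.
    by apply: continuous_max; [exact: cvg_id|exact: cvg_cst].
  have H1 : \forall s \near t, `[0, T]%classic (Num.max s 0) -> U (z s) :=
    cmax _ HU.
  have H2 : \forall s \near t, Num.max s 0 < T := cmax _ (lt_nbhsl maxT).
  suff : \forall s \near t, U (z s) by [].
  apply: filterS2 H1 H2 => s H1 H2; apply: H1.
  by rewrite /= in_itv/= max_ge0/= ltW.
have z_neg t : t < 0 -> z t = z 0.
  by move=> t0; rewrite /z max_r ?(ltW t0)// maxxx.
have z_rcont t : 0 <= t -> z s @[s --> t^'+] --> z t.
  by move=> _; apply: cvg_at_right_filter; exact: cz.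
have z_llim t : 0 < t -> cvg (z s @[s --> t^'-]).
  by move=> _; apply/cvg_ex; exists (z t); apply: cvg_at_left_filter; exact: cz.
by exists (Skorohod z_rcont z_llim z_neg) => t t0; rewrite /= /z max_l.
Qed.

End continuous_paths.

(** * Curves polygonal with respect to the clock *)

Section polygonal_paths.
Context {R : realType} (beta : R).
Local Notation a := (2 * (1 - beta)).

(** The curve is [e^(- a s) u(s)], where [u] is affine in the clock with slope [2 p k] on cell [k];
    there the Lagrangian is [p k ^+ 2] times the derivative of the clock. After [t M] the function
    [u] is constant, so the curve follows the linear drift at no cost. *)
Lemma polygonal_path (I0 : R -> \bar R) (y0 : R) (t p : nat -> R) (M : nat) :
  t 0%N = 0 -> (forall k, t k < t k.+1) -> (0 <= I0 y0)%E ->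
  exists x : skorohod R, [/\
    forall k s, (k < M)%N -> t k <= s <= t k.+1 ->
      expR (a * s) * x s =
      y0 + \sum_(j < k) 2 * p j * (clock a (t j.+1) - clock a (t j)) +
      2 * p k * (clock a s - clock a (t k)) &
    (cw_rate beta I0 x <= I0 y0 +
      (\sum_(k < M) p k ^+ 2 * (clock a (t k.+1) - clock a (t k)))%:E)%E].
Proof.
move=> t0 tS I00.
have t_le i j : (i <= j)%N -> t i <= t j.
  elim: j => [|j IH]; first by rewrite leqn0 => /eqP ->.
  by rewrite leq_eqVlt => /predU1P[->//|/IH/le_trans]; apply; exact: ltW.
have t_ge0 k : 0 <= t k by rewrite -t0 t_le.
pose P (s : R) := \sum_(k < M) p k * \1_(`]t k, t k.+1]%classic) s.
have P_cell k s : (k < M)%N -> s \in `]t k, t k.+1] -> P s = p k.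
  move=> kM sk; rewrite /P (bigD1 (Ordinal kM))//= indicE mem_set//= mulr1.
  rewrite big1 ?addr0// => j jk; rewrite indicE memNset ?mulr0//=.
  move: sk; rewrite !in_itv/= => /andP[ks sk] /andP[js sj].
  have [jlt|kle] := ltnP j k.
    by have := t_le _ _ jlt; rewrite leNgt (lt_le_trans ks sj).
  have kj : (k < j)%N.
    rewrite ltn_neqAle kle andbT; apply: contra jk => /eqP kj.
    by apply/eqP/val_inj.
  by have := t_le _ _ kj; rewrite leNgt (lt_le_trans js sk).
have P_out s : t M < s -> P s = 0.
  move=> Ms; rewrite /P big1// => j _; rewrite indicE memNset ?mulr0//=.
  rewrite in_itv/= => /andP[_ sj].
  by have := t_le _ _ (ltn_ord j); rewrite leNgt (lt_le_trans Ms sj).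
have P_le s : `|P s| <= \sum_(k < M) `|p k|.
  apply: le_trans (ler_norm_sum _ _ _) _; apply: ler_sum => k _.
  by rewrite normrM ler_piMr// indicE; case: (_ \in _); rewrite ?normr1 ?normr0.
have mP (D : set (measurableTypeR R)) : measurable_fun D P.
  by apply: measurable_sum => k; exact: measurable_funM.
pose e2 s := 2 * expR (2 * a * s).
have e2_cont : continuous e2.
  move=> z; apply: cvgM; [exact: cvg_cst|exact: continuous_expRM].
pose f s := (2 * P s) * e2 s.
have fi T : leb.-integrable `[0, T] (EFin \o f).
  apply: (@integrable_mul_bounded _ _ _ _ (2 * \sum_(k < M) `|p k|)) => //.
  - exact: measurable_funM.
  - by move=> r _; rewrite normrM ger0_norm// ler_pM2l.
  - exact: continuous_integrable_itv.
pose u s := y0 + \int[leb]_(r in `[0, s]) f r.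
have u0 : u 0 = y0 by rewrite /u set_itv1 Rintegral_set1 addr0.
have uf T : primitive_on T u f.
  by split => // s /andP[s0 sT]; rewrite u0.
have u_cell k s : (k < M)%N -> t k <= s <= t k.+1 ->
    u s - u (t k) = 2 * p k * (clock a s - clock a (t k)).
  move=> kM /andP[ks sk].
  rewrite (primitive_incr (uf s) (t_ge0 k) ks (lexx s)).
  rewrite -Rintegral_clock// -RintegralZl//; last first.
    apply: integrableS (continuous_integrable_itv (t k) s e2_cont) => //.
    by apply: subset_itvr; rewrite bnd_simp.
  apply: eq_Rintegral => r; rewrite inE/= in_itv/= => /andP[kr rs].
  by rewrite /f (P_cell k)// in_itv/= kr (le_trans rs).
have u_node k : (k <= M)%N ->
    u (t k) = y0 + \sum_(j < k) 2 * p j * (clock a (t j.+1) - clock a (t j)).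
  elim: k => [_|k IH kM]; first by rewrite t0 u0 big_ord0 addr0.
  rewrite big_ord_recr/= addrA -IH ?(ltnW kM)// -(u_cell k)//.
    by rewrite addrC subrK.
  by rewrite lexx ltW.
have yg T : 0 <= T -> primitive_on T (fun s => expR (- a * s) * u s)
    (fun s => expR (- a * s) * (f s + - a * u s)).
  by move=> T0; exact: primitive_expR.
have [x xE] := continuous_skorohod (fun T T0 => primitive_continuous T0 (yg T T0)).
have ux s : 0 <= s -> expR (a * s) * x s = u s.
  by move=> s0; rewrite xE// mulrA -expRD mulNr subrr expR0 mul1r.
exists x; split.
  move=> k s kM /andP[ks sk]; have s0 := le_trans (t_ge0 k) ks.
  by rewrite ux// -u_node ?(ltnW kM)// -(u_cell k) ?ks// addrC subrK.
have x0 : x 0 = y0 by rewrite xE// mulr0 expR0 mul1r u0.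
have xg T : 0 <= T -> primitive_on T x (fun s => expR (- a * s) * (f s + - a * u s)).
  move=> T0; have [i1 i2] := yg T T0; split => // s /andP[s0 sT].
  by rewrite !xE// i2// s0.
rewrite (cw_rate_primitive beta I0 xg) x0 leeD2l//.
pose phi s := (P s) ^+ 2 * e2 s.
have LE r : 0 <= r ->
    cw_lagrangian beta (x r) (expR (- a * r) * (f r + - a * u r)) = phi r.
  move=> r0; rewrite cw_lagrangianE xE// /phi /f /e2.
  have -> : expR (2 * a * r) = expR (- a * r) ^- 2.
    by rewrite -expRM_natl -expRN; congr expR; ring.
  by field; rewrite lt0r_neq0 ?expR_gt0.
have mphi (D : set (measurableTypeR R)) : measurable_fun D (EFin \o phi).
  apply/measurable_EFinP/measurable_funM; first exact: measurable_funX.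
  exact: (measurable_funTS (continuous_measurable_fun e2_cont)).
have phi0 r : (0 <= (phi r)%:E)%E.
  by rewrite lee_fin mulr_ge0 ?sqr_ge0// mulr_ge0 ?expR_ge0.
have -> : (\int[leb]_(r in `[0%R, +oo[)
      (cw_lagrangian beta (x r) (expR (- a * r) * (f r + - a * u r)))%:E =
    \int[leb]_(r in `[0%R, +oo[) (phi r)%:E)%E.
  by apply: eq_integral => r; rewrite inE/= in_itv/= andbT => r0; rewrite LE.
rewrite (@itv_bndbnd_setU _ _ _ (BRight (t M))) ?bnd_simp//.
rewrite ge0_integral_setU//; last first.
  apply/disj_setPS => y [/=]; rewrite !in_itv/= andbT => /andP[_ yx].
  by rewrite ltNge yx.
rewrite [X in (_ + X)%E]integral0_eq ?adde0; last first.
  move=> r /=; rewrite in_itv/= andbT => rM.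
  by rewrite /phi P_out// expr0n mul0r.
rewrite -integral_itv_obnd_cbnd; last exact: mphi.
have -> // : forall k, (k <= M)%N -> (\int[leb]_(r in `]0%R, t k]) (phi r)%:E =
    (\sum_(j < k) p j ^+ 2 * (clock a (t j.+1) - clock a (t j)))%:E)%E.
elim=> [_|k IH kM].
  by rewrite t0 set_itv_ge ?bnd_simp ?ltxx// integral_set0 big_ord0.
rewrite (@itv_bndbnd_setU _ _ _ (BRight (t k))) ?bnd_simp ?(ltW (tS k))//.
rewrite ge0_integral_setU//; last first.
  apply/disj_setPS => y [/=]; rewrite !in_itv/= => /andP[_ yx] /andP[].
  by rewrite ltNge yx.
rewrite IH ?(ltnW kM)// big_ord_recr/= EFinD; congr (_ + _)%E.
rewrite -Rintegral_clock ?(ltW (tS k))// -RintegralZl//; last first.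
  apply: integrableS (continuous_integrable_itv (t k) (t k.+1) e2_cont) => //.
  by apply: subset_itvr; rewrite bnd_simp.
have ci : leb.-integrable `]t k, t k.+1] (EFin \o e2).
  apply: integrableS (continuous_integrable_itv (t k) (t k.+1) e2_cont) => //.
  by apply: subset_itvr; rewrite bnd_simp.
rewrite /Rintegral fineK; last first.
  apply: integrable_fin_num => //; exact: integrableZl_EFin.
apply: eq_integral => r; rewrite inE/= => rk.
by rewrite /phi (P_cell k).
Qed.

End polygonal_paths.

(** * Goodness of the rate function *)

Section ultrafilter_limits.
Context {R : realType} {X : Type} (F : set_system X) {UF : UltraFilter F}.

(** Bounded real functions converge along any ultrafilter, so limits exist at all times and on all
    sets at once, without extracting subsequences. *)
Lemma ultra_bounded_cvg (f : X -> R) (B : R) :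
  F [set x | `|f x| <= B] -> cvg (f x @[x --> F]).
Proof.
move=> fB.
have [|p [pB pcl]] := @segment_compact R (- B) B (f x @[x --> F]) _ _.
  suff : F [set x | f x \in `[- B, B]] by [].
  apply: filterS fB => x fx; rewrite /= in_itv/= -ler_norml; exact: fx.
apply/cvg_ex; exists p => U Up.
have [//|FnU] := in_ultra_setVsetC (f @^-1` U) UF.
by have [y [nUy Uy]] := pcl (~` U) U FnU Up.
Qed.

End ultrafilter_limits.

(** * Weak limits in L^2 along an ultrafilter *)

Section weak_limits.
Context {R : realType} {X : Type} (F : set_system X) {UF : UltraFilter F}.
Variables (N C : R) (h : X -> R -> R).
Hypotheses (N0 : 0 <= N) (C0 : 0 <= C).
Local Notation D := (`[0, N]%classic : set (measurableTypeR R)).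
Hypothesis hi : forall x, leb.-integrable D (EFin \o h x).
Hypothesis hC : forall x,
  (\int[leb]_(r in D) ((h x r) ^+ 2)%:E <= C%:E)%E.

Let mh x (A : set (measurableTypeR R)) : A `<=` D -> measurable_fun A (h x).
Proof.
move=> AD; have /integrableP[+ _] := hi x => /measurable_EFinP.
by move/measurable_funS; apply.
Qed.

Let weight (A : set (measurableTypeR R)) : R := fine (leb (A `&` D)).

Let leb_fin (A : set (measurableTypeR R)) : measurable A ->
  leb (A `&` D) \is a fin_num.
Proof.
move=> mA; rewrite ge0_fin_numE//.
apply: (@le_lt_trans _ _ (leb D)).
  apply: le_measure; rewrite ?inE//; first exact: measurableI.
have -> : leb D = _ := lebesgue_measure_itv `[0, N]%R.
by case: ifP; rewrite /= ?ltry// -EFinB ltry.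
Qed.

Let mass_integral x (A : set (measurableTypeR R)) : R :=
  \int[leb]_(r in A `&` D) h x r.

Let hAi x A : measurable A -> leb.-integrable (A `&` D) (EFin \o h x).
Proof. by move=> mA; apply: integrableS (hi x) => //; exact: measurableI. Qed.

Let cst_integrable (A : set (measurableTypeR R)) (k : R) : measurable A ->
  leb.-integrable (A `&` D) (EFin \o (fun=> k)).
Proof.
move=> mA; apply: (@integrableS _ _ _ _ D) => //; first exact: measurableI.
by apply: continuous_integrable_itv => z; exact: cvg_cst.
Qed.

Let cst_integral (A : set (measurableTypeR R)) (k : R) : measurable A ->
  \int[leb]_(r in A `&` D) k = k * weight A.
Proof. by move=> mA; rewrite Rintegral_cst//; exact: measurableI. Qed.

(* [2 c y - c^2 <= y^2] *)
Let slice_le x A c : measurable A ->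
  ((2 * c * mass_integral x A - c ^+ 2 * weight A)%:E <=
   \int[leb]_(r in A `&` D) ((h x r) ^+ 2)%:E)%E.
Proof.
move=> mA; have mAD : measurable (A `&` D) by exact: measurableI.
rewrite /mass_integral -cst_integral// -RintegralZl//; last exact: hAi.
rewrite -RintegralB//; [|exact: integrableZl_EFin (hAi x mA)|exact: cst_integrable].
apply: le_Rintegral_integral => //.
- apply: integrableB_EFin => //; last exact: cst_integrable.
  exact: integrableZl_EFin (hAi x mA).
- by apply/measurable_EFinP/measurable_funX; exact: mh.
- by move=> r _; exact: sqr_ge0.
- move=> r _; rewrite -subr_ge0.
  have -> : h x r ^+ 2 - (2 * c * h x r - c ^+ 2) = (h x r - c) ^+ 2 by ring.
  exact: sqr_ge0.
Qed.

(** Cauchy-Schwarz with a free parameter instead of a square root: [slice_le] is used with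
    [c = 2 la] and [c = - 2 la]. A large [la] makes the second term small, after which a small set
    makes the first one small. *)
Let mass_le x A (la : R) : measurable A -> 0 < la ->
  `|mass_integral x A| <= la * weight A + C / (4 * la).
Proof.
move=> mA la0.
have sub : (\int[leb]_(r in A `&` D) ((h x r) ^+ 2)%:E <= C%:E)%E.
  apply: le_trans (hC x); apply: ge0_subset_integral => //.
  - exact: measurableI.
  - by apply/measurable_EFinP/measurable_funX; exact: mh.
  - by move=> r _; rewrite lee_fin sqr_ge0.
have key c : 2 * c * mass_integral x A - c ^+ 2 * weight A <= C.
  by rewrite -lee_fin; exact: le_trans (slice_le x c mA) sub.
have k1 := key (2 * la); have k2 := key (- (2 * la)).
rewrite ler_norml; apply/andP; split.
  rewrite -subr_ge0 -(pmulr_lge0 _ (_ : 0 < 4 * la)) ?mulr_gt0//.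
  have -> : (mass_integral x A - - (la * weight A + C / (4 * la))) * (4 * la) =
    C - (2 * (- (2 * la)) * mass_integral x A - (- (2 * la)) ^+ 2 * weight A).
    by field; rewrite lt0r_neq0.
  by rewrite subr_ge0.
rewrite -subr_ge0 -(pmulr_lge0 _ (_ : 0 < 4 * la)) ?mulr_gt0//.
have -> : (la * weight A + C / (4 * la) - mass_integral x A) * (4 * la) =
    C - (2 * (2 * la) * mass_integral x A - (2 * la) ^+ 2 * weight A).
  by field; rewrite lt0r_neq0.
by rewrite subr_ge0.
Qed.

Let weight_le (A B : set (measurableTypeR R)) : measurable A -> measurable B ->
  A `<=` B -> weight A <= weight B.
Proof.
move=> mA mB AB; rewrite fine_le ?leb_fin// le_measure ?inE//; try exact: measurableI.
exact: setSI.
Qed.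

Let weightT A : measurable A -> weight A <= N.
Proof.
move=> mA; apply: (le_trans (weight_le mA measurableT _)) => //.
rewrite /weight setTI; have -> : leb D = _ := lebesgue_measure_itv `[0, N]%R.
by rewrite /= lte_fin; case: ltP => //= _; rewrite subr0.
Qed.

Let nu0 (A : set (measurableTypeR R)) : R := lim (mass_integral x A @[x --> F]).

Let nu0_cvg A : measurable A -> mass_integral x A @[x --> F] --> nu0 A.
Proof.
move=> mA; apply: (@ultra_bounded_cvg _ _ _ _ _ (1 * N + C / (4 * 1))).
apply: filterE => x /=; apply: le_trans (mass_le x mA ltr01) _.
by rewrite lerD2r !mul1r weightT.
Qed.

Let nu0_le A la : measurable A -> 0 < la ->
  `|nu0 A| <= la * weight A + C / (4 * la).
Proof.
move=> mA la0.
have H : `|mass_integral x A| @[x --> F] --> `|nu0 A|.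
  by apply: cvg_norm; exact: nu0_cvg.
rewrite -(cvg_lim _ H)//; apply: limr_le; first exact: (cvgP _ H).
by apply: nearW => x; exact: mass_le.
Qed.

Let nu0U A B : measurable A -> measurable B -> A `&` B = set0 ->
  nu0 (A `|` B) = nu0 A + nu0 B.
Proof.
move=> mA mB AB.
have H2 : mass_integral x (A `|` B) @[x --> F] --> nu0 A + nu0 B.
  have -> : (fun x => mass_integral x (A `|` B)) =
      (fun x => mass_integral x A + mass_integral x B).
    apply/funext => x.
    rewrite /mass_integral setIUl Rintegral_setU//; try exact: measurableI.
      by rewrite -setIUl; apply: hAi; exact: measurableU.
    by apply/disj_set2P; rewrite setIACA AB set0I.
  by apply: cvgD; exact: nu0_cvg.
exact: cvg_unique (nu0_cvg (measurableU _ _ mA mB)) H2.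
Qed.

Let nu00 : nu0 set0 = 0.
Proof.
rewrite /nu0; have -> : (fun x => mass_integral x set0) = cst 0.
  by apply/funext => x; rewrite /mass_integral set0I Rintegral_set0.
exact: lim_cst.
Qed.

(* The limit of the set functions [A |-> \int_A h x] is countably additive and
   absolutely continuous because of the bound in L^2. *)
Definition weak_limit_charge (A : set (measurableTypeR R)) : \bar R := (nu0 A)%:E.

Let charge0 : weak_limit_charge set0 = 0%E.
Proof. by rewrite /weak_limit_charge nu00. Qed.

Let charge_fin A : measurable A -> weak_limit_charge A \is a fin_num.
Proof. by []. Qed.

Let charge_sigma : semi_sigma_additive weak_limit_charge.
Proof.
move=> A mA tA mUA; rewrite /weak_limit_charge.
pose U n := \big[setU/set0]_(0 <= i < n) A i.
have mU n : measurable (U n) by exact: bigsetU_measurable.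
have sumU n : \sum_(0 <= i < n) nu0 (A i) = nu0 (U n).
  elim: n => [|n IH]; first by rewrite /U !big_geq.
  rewrite big_nat_recr//= IH /U big_nat_recr//= nu0U//.
    exact: mU.
  rewrite big_mkord (@trivIset_bigsetUI _ xpredT)//.
  by apply: sub_trivIset tA.
under eq_fun do rewrite sumEFin sumU.
apply: cvg_EFin; first exact: nearW.
apply/cvgrPdist_le => e e0.
(* With this choice [C / (4 * la) <= e / 2]; the other half of [e] is left for the weight of the
   tail. *)
pose la := C / (2 * e) + 1; pose V := \bigcup_n A n.
have la0 : 0 < la by rewrite ltr_wpDl// divr_ge0// mulr_ge0// ltW.
have w_cvg : weight (U n) @[n --> \oo] --> weight V.
  have : (leb (U n `&` D)) @[n --> \oo] --> leb (V `&` D).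
    rewrite /V setI_bigcupl.
    have := @nondecreasing_cvg_mu _ _ _ leb (fun n => U n `&` D).
    have -> : \bigcup_n (U n `&` D) = \bigcup_n (A n `&` D).
      rewrite -!setI_bigcupl; congr (_ `&` D); apply/seteqP; split => r [n _].
        rewrite /U big_mkord -bigcup_mkord => -[i /= _ Ai]; by exists i.
      by exists n.+1 => //; rewrite /U big_nat_recr//=; right.
    apply.
    - by move=> n; exact: measurableI.
    - by apply: bigcup_measurable => n _; exact: measurableI.
    - move=> m n mn; apply/subsetPset; apply: setSI.
      rewrite /U !big_mkord; exact: subset_bigsetU.
  by move=> H; apply: fine_cvg; rewrite fineK// leb_fin.
have [M _ HM] : \forall n \near \oo, weight V - weight (U n) <= e / (2 * la).
  have e2 : 0 < e / (2 * la) by rewrite divr_gt0// mulr_gt0.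
  have /cvgrPdist_le /(_ _ e2) := w_cvg; apply: filterS => n.
  by apply: le_trans; exact: ler_norm.
exists M => // n Mn; have {}HM := HM n Mn.
have VE : V = U n `|` (V `\` U n).
  rewrite setDUK// => r; rewrite /U big_mkord -bigcup_mkord => -[i _ Ai].
  by exists i.
have mVU : measurable (V `\` U n) by exact: measurableD.
have dis : U n `&` (V `\` U n) = set0 by rewrite setDE setICA setICr setI0.
rewrite /= -/V.
have -> : nu0 V = nu0 (U n) + nu0 (V `\` U n) by rewrite -nu0U// -VE.
rewrite addrAC subrr add0r.
apply: le_trans (nu0_le mVU la0) _.
have wE : weight (V `\` U n) = weight V - weight (U n).
  have -> : weight V = weight (U n) + weight (V `\` U n).
    rewrite [in LHS]VE /weight setIUl measureU ?fineD ?leb_fin//;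
      try exact: measurableI.
    by rewrite setIACA dis set0I.
  by rewrite addrAC subrr add0r.
rewrite wE (splitr e) lerD//.
  by rewrite -ler_pdivlMl// (le_trans HM)// le_eqVlt; apply/orP; left; apply/eqP; field; rewrite lt0r_neq0.
rewrite ler_pdivrMr ?mulr_gt0// /la.
rewrite [leRHS](_ : _ = C + 2 * e); last by field; rewrite lt0r_neq0.
by rewrite lerDl mulr_ge0// ltW.
Qed.

HB.instance Definition _ := isCharge.Build _ _ _ weak_limit_charge
  charge0 charge_fin charge_sigma.

Lemma weak_limit_density : exists g : R -> R,
  leb.-integrable setT (EFin \o g) /\
  forall A, measurable A -> A `<=` D ->
    \int[leb]_(r in A) h x r @[x --> F] --> \int[leb]_(r in A) g r.
Proof.
have dom : weak_limit_charge `<< leb.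
  apply/null_content_dominatesP => A mA A0.
  rewrite /weak_limit_charge; congr EFin.
  have : weight A = 0.
    rewrite /weight (_ : leb (A `&` D) = 0%E)//.
    by apply: (subset_measure0 _ _ _ A0) => //; exact: measurableI.
  move=> w0; apply/eqP; rewrite -normr_le0 leNgt; apply/negP => n0.
  (* On a null set only [C / (4 * la)] remains, and this [la] brings it below the norm of [nu0 A], a
     contradiction. *)
  pose la := C / (2 * `|nu0 A|) + 1.
  have la0 : 0 < la by rewrite ltr_wpDl// divr_ge0// mulr_ge0.
  have := nu0_le mA la0; rewrite w0 mulr0 add0r leNgt => /negP; apply.
  rewrite ltr_pdivrMr ?mulr_gt0// /la.
  rewrite [ltRHS](_ : _ = 2 * C + 4 * `|nu0 A|); last by field; rewrite lt0r_neq0.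
  by rewrite mulr2n mulrDl mul1r -addrA ltrDl ltr_wpDl// mulr_gt0.
pose f := Radon_Nikodym weak_limit_charge leb.
have fE : EFin \o (fine \o f) = f.
  by apply/funext => r /=; rewrite fineK// Radon_Nikodym_fin_num.
exists (fine \o f); rewrite fE; split; first exact: Radon_Nikodym_integrable.
move=> A mA AD.
have -> : \int[leb]_(r in A) (fine \o f) r = nu0 A.
  have H : (nu0 A)%:E = (\int[leb]_(r in A) f r)%E := Radon_Nikodym_integral dom mA.
  rewrite /Rintegral -[RHS]/(fine (nu0 A)%:E) H; congr fine.
  by apply: eq_integral => r _; rewrite /= fineK// Radon_Nikodym_fin_num.
have := nu0_cvg mA; rewrite /mass_integral.
by rewrite (setIidl AD).
Qed.

(** Lower semicontinuity by linearization. On the slice where [g] lies in [[c, c + 1/m[], the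
    inequality [2 c y - c^2 <= y^2] bounds the energy of [h x] below by a linear expression, which
    passes to the limit; for [g] itself the loss is at most [1 / m^2] pointwise. As square
    integrability of [g] is not known beforehand, [g] is truncated first. *)
Lemma weak_limit_energy (g : R -> R) : leb.-integrable setT (EFin \o g) ->
  (forall A, measurable A -> A `<=` D ->
    \int[leb]_(r in A) h x r @[x --> F] --> \int[leb]_(r in A) g r) ->
  (\int[leb]_(r in D) ((g r) ^+ 2)%:E <= C%:E)%E.
Proof.
move=> gi gA.
have mg (A : set (measurableTypeR R)) : measurable_fun A g.
  apply: measurable_funTS; apply/measurable_EFinP; exact: measurable_int gi.
have mg2 (A : set (measurableTypeR R)) :
    measurable_fun A (fun r => ((g r) ^+ 2)%:E).
  exact/measurable_EFinP/measurable_funX.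
have g2_ge0 r : (0 <= ((g r) ^+ 2)%:E)%E by rewrite lee_fin sqr_ge0.
have gAi (A : set (measurableTypeR R)) : measurable A ->
    leb.-integrable (A `&` D) (EFin \o g).
  by move=> mA; apply: integrableS gi => //; exact: measurableI.
pose E (m : nat) : set (measurableTypeR R) := [set r | `|g r| <= m%:R] `&` D.
have mE m : measurable (E m).
  apply: measurableI => //.
  have := mg setT measurableT _ (measurable_itv `[- m%:R, m%:R]); rewrite setTI.
  by congr measurable; apply/seteqP; split => r; rewrite /= in_itv/= ler_norml.
have level m : (0 < m)%N ->
    (\int[leb]_(r in E m) ((g r) ^+ 2)%:E <= (C + N / m%:R ^+ 2)%:E)%E.
  move=> m0; have m0' : 0 < m%:R :> R by rewrite ltr0n.
  pose c (i : nat) : R := (i%:R - (m ^ 2)%N%:R) / m%:R.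
  pose A (i : nat) : set (measurableTypeR R) := [set r | c i <= g r < c i.+1].
  (* The slices start at [- m] and have width [1 / m]; the additional one, beginning at [m], catches
     the value [m] itself. *)
  pose K := (2 * m ^ 2).+1.
  have [I IE] : {s : seq nat | s = iota 0 K} by exact: exist.
  have uI : uniq I by rewrite IE iota_uniq.
  have cS i : c i.+1 = c i + m%:R^-1 by rewrite /c -natr1; field; rewrite lt0r_neq0.
  have c_le i j : (i <= j)%N -> c i <= c j.
    by move=> ij; rewrite /c ler_pM2r ?invr_gt0// lerD2r ler_nat.
  have mA i : measurable (A i).
    have := mg setT measurableT _ (measurable_itv `[c i, c i.+1[); rewrite setTI.
    by congr measurable; apply/seteqP; split => r; rewrite /= in_itv.
  have mAD i : measurable (A i `&` D) by exact: measurableI.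
  have tA : trivIset [set` I] (fun i => A i `&` D).
    move=> i j _ _ [r [[/= /andP[i1 i2] _] [/= /andP[j1 j2] _]]].
    case: (ltngtP i j) => // ij.
      by have := c_le _ _ ij; rewrite leNgt (le_lt_trans j1 i2).
    by have := c_le _ _ ij; rewrite leNgt (le_lt_trans i1 j2).
  have cover : E m `<=` \big[setU/set0]_(i <- I) (A i `&` D).
    move=> r [/=]; rewrite ler_norml => /andP[g1 g2] rD.
    pose i := Num.truncn ((g r + m%:R) * m%:R).
    have gm0 : 0 <= (g r + m%:R) * m%:R by rewrite mulr_ge0// -lerBlDr sub0r.
    have /andP[i1 i2] := truncn_itv gm0.
    have mm : (m ^ 2)%N%:R = m%:R * m%:R :> R by rewrite natrX expr2.
    have iK : (i < K)%N.
      rewrite ltnS -(@ler_nat R) (le_trans i1)// natrM mm mulrA ler_pM2r//.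
      by rewrite mulr2n mulrDl !mul1r lerD2r.
    rewrite -(@bigcup_seq _ _ (I) (fun i => A i `&` D)).
    exists i; first by have : i \in I by rewrite IE mem_iota.
    split => //; rewrite /= /c; apply/andP; split.
      by rewrite ler_pdivrMr// mm lerBlDr -mulrDl.
    by rewrite ltr_pdivlMr// mm ltrBrDr -mulrDl.
  have sum_int (f : R -> R) : measurable_fun D (fun r => (f r ^+ 2)%:E) ->
      (\int[leb]_(r in \big[setU/set0]_(i <- I) (A i `&` D))
        ((f r) ^+ 2)%:E)%E =
      (\sum_(i <- I) \int[leb]_(r in A i `&` D) ((f r) ^+ 2)%:E)%E.
    move=> mf; rewrite ge0_integral_bigsetU ?uI//.
      apply: measurable_funS mf => //.
      by rewrite -bigcup_seq => r [i _ []].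
    by move=> r _; rewrite lee_fin sqr_ge0.
  have subD : \big[setU/set0]_(i <- I) (A i `&` D) `<=` D.
    by rewrite -bigcup_seq => r [i _ []].
  have mBig : measurable (\big[setU/set0]_(i <- I) (A i `&` D)).
    by apply: bigsetU_measurable => i _.
  pose V (f : R -> R) := \sum_(i <- I)
    (2 * c i * (\int[leb]_(r in A i `&` D) f r) - c i ^+ 2 * weight (A i)).
  have VC x : V (h x) <= C.
    rewrite -lee_fin; apply: le_trans (hC x).
    have mhx : measurable_fun D (fun r => (h x r ^+ 2)%:E).
      by apply/measurable_EFinP/measurable_funX; exact: mh.
    apply: (@le_trans _ _ (\int[leb]_(r in \big[setU/set0]_(i <- I)
      (A i `&` D)) ((h x r) ^+ 2)%:E)%E); last first.
      by apply: ge0_subset_integral => // r _; rewrite lee_fin sqr_ge0.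
    rewrite sum_int// /V -sumEFin; apply: lee_sum => i _; exact: slice_le.
  have Vcvg : V (h x) @[x --> F] --> V g.
    apply: cvg_big => [|i _]; first exact: add_continuous.
    apply: cvgB; last exact: cvg_cst.
    by apply: cvgMl_tmp; apply: gA => //; exact: subIsetr.
  have VgC : V g <= C.
    rewrite -(cvg_lim _ Vcvg)//; apply: limr_le; first exact: (cvgP _ Vcvg).
    exact: nearW.
  apply: (@le_trans _ _ (\int[leb]_(r in \big[setU/set0]_(i <- I)
      (A i `&` D)) ((g r) ^+ 2)%:E)%E).
    by apply: ge0_subset_integral.
  rewrite sum_int//.
  apply: (@le_trans _ _ (\sum_(i <- I) (2 * c i *
     (\int[leb]_(r in A i `&` D) g r) - c i ^+ 2 * weight (A i) +
     m%:R ^- 2 * weight (A i))%:E)%E).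
    apply: lee_sum => i _.
    have i1 : leb.-integrable (A i `&` D) (EFin \o (fun r => 2 * c i * g r - c i ^+ 2)).
      apply: integrableB_EFin => //; last exact: cst_integrable.
      exact: integrableZl_EFin (gAi _ (mA i)).
    have i2 : leb.-integrable (A i `&` D) (EFin \o (fun=> m%:R ^- 2 : R)).
      exact: cst_integrable.
    rewrite -!cst_integral// -RintegralZl ?gAi//.
    rewrite -RintegralB//; [|exact: integrableZl_EFin (gAi _ (mA i))|exact: cst_integrable].
    rewrite -RintegralD// /Rintegral fineK; last first.
      by apply: integrable_fin_num => //; exact: integrableD_EFin.
    apply: ge0_le_integral => //.
    - have /integrableP[//] := integrableD_EFin (mAD i) i1 i2.
    move=> r [/= /andP[r1 r2] _]; rewrite lee_fin -subr_ge0.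
    have -> : 2 * c i * g r - c i ^+ 2 + m%:R ^- 2 - g r ^+ 2 =
      m%:R ^- 2 - (g r - c i) ^+ 2 by ring.
    rewrite subr_ge0 -exprVn lerXn2r ?nnegrE ?subr_ge0 ?invr_ge0//.
    by rewrite lerBlDl -cS ltW.
  rewrite sumEFin lee_fin big_split/= lerD// -mulr_sumr [leRHS]mulrC ler_pM2l ?invr_gt0 ?exprn_gt0//.
  rewrite -lee_fin -sumEFin.
  have -> : (\sum_(i <- I) (weight (A i))%:E =
      \sum_(i <- I) \int[leb]_(r in A i `&` D) (cst 1 r))%E.
    apply: eq_bigr => i _.
    by rewrite integral_cst// mul1e /weight fineK// leb_fin.
  rewrite -ge0_integral_bigsetU ?uI// integral_cst// mul1e.
  have <- : leb D = N%:E.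
    have -> : leb D = _ := lebesgue_measure_itv `[0, N]%R.
    by rewrite /= lte_fin; case: ltgtP N0 => // [_|<-] _; rewrite -?EFinB ?subr0.
  by apply: le_measure; rewrite ?inE.
have levelC n : (\int[leb]_(r in E n) ((g r) ^+ 2)%:E <= C%:E)%E.
  apply/lee_addgt0Pr => e e0.
  pose m := maxn n (Num.truncn (N / e)).+1.
  have m0 : (0 < m)%N by rewrite leq_max orbT.
  have m0' : 0 < m%:R :> R by rewrite ltr0n.
  apply: (@le_trans _ _ (\int[leb]_(r in E m) ((g r) ^+ 2)%:E)%E).
    apply: ge0_subset_integral => // r [/= gn rD]; split => //=.
    by rewrite (le_trans gn)// ler_nat leq_maxl.
  apply: le_trans (level m m0) _; rewrite -EFinD lee_fin lerD2l.
  rewrite ler_pdivrMr ?exprn_gt0//.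
  have h1 : N <= e * m%:R.
    rewrite -ler_pdivrMl// mulrC; apply: (le_trans (ltW (truncnS_gt _))).
    by rewrite ler_nat leq_maxr.
  have h2 : 1 <= m%:R :> R by rewrite ler1n.
  apply: (le_trans h1); rewrite ler_pM2l// expr2 ler_peMl// ltW//.
have UE : D = \bigcup_m E m.
  apply/seteqP; split => [r rD|r [m _ [_ //]]].
  exists (Num.truncn `|g r|).+1 => //; split => //=.
  exact: ltW (truncnS_gt _).
rewrite UE.
have cvgE : (\int[leb]_(r in E m) ((g r) ^+ 2)%:E)%E @[m --> \oo] -->
    (\int[leb]_(r in \bigcup_m E m) ((g r) ^+ 2)%:E)%E.
  apply: ge0_nondecreasing_set_cvg_integral => //.
  move=> m k mk; apply/subsetPset => r [/= gm rD]; split => //=.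
  by rewrite (le_trans gm)// ler_nat.
rewrite -(cvg_lim _ cvgE)//; apply: lime_le; last exact: nearW.
exact: (cvgP _ cvgE).
Qed.

End weak_limits.

(** * Limits of curves of bounded energy *)

Section energy_limits.
Context {R : realType} (beta : R).
Local Notation a := (2 * (1 - beta)).

Lemma energy_sqr (N : R) (x g : R -> R) : 0 <= N -> primitive_on N x g ->
  (\int[leb]_(r in `[0%R, N]) ((g r + a * x r) ^+ 2)%:E =
   8%:E * \int[leb]_(r in `[0%R, N]) (cw_lagrangian beta (x r) (g r))%:E)%E.
Proof.
move=> N0 xg; rewrite -ge0_integralZl_EFin//; last 2 first.
- by move=> r _; rewrite lee_fin cw_lagrangian_ge0.
- exact: measurable_lagrangian.
apply: eq_integral => r _; rewrite -EFinM cw_lagrangianE; congr (_%:E).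
by field.
Qed.

Lemma energy_unique (N : R) (x g h : R -> R) : 0 <= N -> primitive_on N x g ->
  primitive_on N x h ->
  (\int[leb]_(r in `[0%R, N]) (cw_lagrangian beta (x r) (g r))%:E =
   \int[leb]_(r in `[0%R, N]) (cw_lagrangian beta (x r) (h r))%:E)%E.
Proof.
move=> N0 xg xh; move: (N0); rewrite le_eqVlt => /predU1P[N0E|Npos].
  by rewrite -N0E set_itv1 !integral_set1.
apply: ge0_ae_eq_integral => //.
- exact: measurable_lagrangian.
- exact: measurable_lagrangian.
- by move=> r _; rewrite lee_fin cw_lagrangian_ge0.
- by move=> r _; rewrite lee_fin cw_lagrangian_ge0.
have H := primitive_on_unique Npos xg xh.
have H0 (c : R) : {ae leb, forall r : R, r != c}.
  exists [set c]; split => //; first exact: lebesgue_measure_set1.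
  by move=> r /= /negP/negPn/eqP.
have FF := @ae_filter_ringOfSetsType _ _ _ (@leb R).
have H1 := @filterI _ _ FF _ _ (H0 0) (H0 N).
have H2 := @filterI _ _ FF _ _ H H1.
apply: (@filterS _ _ FF) H2 => r [Hr [r0 rN]] /=.
rewrite in_itv/= => /andP[rge0 rleN].
congr (_%:E); congr cw_lagrangian; apply: Hr.
by rewrite in_itv/= lt0r r0 rge0 lt_neqAle rN.
Qed.

Lemma primitive_integrable (N : R) (x g : R -> R) : 0 <= N ->
  primitive_on N x g ->
  leb.-integrable (`[0, N] : set (measurableTypeR R)) (EFin \o x).
Proof.
move=> N0 xg; apply: continuous_compact_integrable; first exact: segment_compact.
exact: primitive_continuous xg.
Qed.

(** The square of [v + a x] is 8 times the Lagrangian, so these functions are bounded in L^2 and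
    have a weak limit [g]. Uniform convergence of the curves takes care of the terms [a x], and
    [g - a y] is then a density for the limit curve. *)
Lemma energy_limit (F : set_system (skorohod R)) {UF : UltraFilter F}
    (K : set (skorohod R)) (y : R -> R) (N C : R) :
  0 <= N -> 0 <= C -> F K ->
  (forall x, K x -> exists2 g, primitive_on N x g &
    (\int[leb]_(r in `[0%R, N]) (cw_lagrangian beta (x r) (g r))%:E <= C%:E)%E) ->
  {within `[0, N], continuous y} ->
  (forall e : R, 0 < e ->
    F [set x : skorohod R | forall t : R, 0 <= t <= N -> `|x t - y t| <= e]) ->
  exists2 g, primitive_on N y g &
    (\int[leb]_(r in `[0%R, N]) (cw_lagrangian beta (y r) (g r))%:E <= C%:E)%E.
Proof.
move=> N0 C0 FK HK cy unif.
have /choice[v vP] : forall x : skorohod R, exists g, K x -> primitive_on N x g /\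
    (\int[leb]_(r in `[0%R, N]) (cw_lagrangian beta (x r) (g r))%:E <= C%:E)%E.
  move=> x; case: (pselect (K x)) => [Kx|nKx]; last by exists x.
  by have [g g1 g2] := HK _ Kx; exists g.
(* Setting [h x] to zero outside [K] makes the L^2 bound hold for all [x]; since [F K], the limits
   are unaffected. *)
pose h (x : skorohod R) r := if `[< K x >] then v x r + a * x r else 0.
have hE x : K x -> h x = (fun r => v x r + a * x r).
  by move=> Kx; apply/funext => r; rewrite /h asboolT.
have h0 x : ~ K x -> h x = cst 0.
  by move=> Kx; apply/funext => r; rewrite /h asboolF.
have mD : measurable (`[0, N] : set (measurableTypeR R)) by [].
have hi x : leb.-integrable (`[0, N] : set (measurableTypeR R)) (EFin \o h x).
  case: (pselect (K x)) => [Kx|nKx].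
    rewrite hE//; have [xv _] := vP _ Kx.
    apply: integrableD_EFin => //; first by case: xv.
    by apply: integrableZl_EFin => //; exact: primitive_integrable xv.
  by rewrite h0//; apply: continuous_integrable_itv => ?; exact: cvg_cst.
have hC x : (\int[leb]_(r in `[0%R, N]) ((h x r) ^+ 2)%:E <= (8 * C)%:E)%E.
  case: (pselect (K x)) => [Kx|nKx].
    rewrite hE//; have [xv xC] := vP _ Kx.
    by rewrite energy_sqr// EFinM lee_wpmul2l.
  rewrite h0// integral0_eq ?lee_fin ?mulr_ge0// => r _.
  by rewrite /= expr0n.
have [g [gi gcvg]] := weak_limit_density N0 (mulr_ge0 (ler0n _ 8) C0) hi hC.
have gC := weak_limit_energy N0 hi hC gi gcvg.
have yi : leb.-integrable (`[0, N] : set (measurableTypeR R)) (EFin \o y).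
  by apply: continuous_compact_integrable => //; exact: segment_compact.
have xcvg t : 0 <= t <= N -> (x : skorohod R) t @[x --> F] --> y t.
  move=> tN; apply/cvgrPdist_le => e e0.
  by apply: filterS (unif e e0) => x /(_ t tN); rewrite distrC.
have sub t : t <= N -> `[0, t] `<=` `[0, N].
  by move=> tN; apply: subset_itvl; rewrite bnd_simp.
have icvg t : 0 <= t <= N ->
    \int[leb]_(r in `[0, t]) (x : skorohod R) r @[x --> F] -->
    \int[leb]_(r in `[0, t]) y r.
  move=> /andP[t0 tN]; apply/cvgrPdist_le => e e0.
  have e'0 : 0 < e / (N + 1) by rewrite divr_gt0// ltr_wpDl.
  apply: filterS2 FK (unif _ e'0) => x Kx xe.
  have [xv _] := vP _ Kx; have xi := primitive_integrable N0 xv.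
  have mt : measurable (`[0, t] : set (measurableTypeR R)) by [].
  have xti := integrableS mD mt (sub _ tN) xi.
  have yti := integrableS mD mt (sub _ tN) yi.
  rewrite -RintegralB//; apply: le_trans (le_normr_Rintegral _ _) _ => //.
    exact: integrableB_EFin.
  have ci : leb.-integrable (`[0, t] : set (measurableTypeR R))
      (EFin \o cst (e / (N + 1))).
    by apply: continuous_integrable_itv => ?; exact: cvg_cst.
  apply: (@le_trans _ _ (\int[leb]_(r in `[0, t]) cst (e / (N + 1)) r)).
    apply: le_Rintegral => //.
      by have := integrable_norm (integrableB_EFin mt yti xti).
    move=> r /=; rewrite in_itv/= => /andP[r0 rt].
    by rewrite distrC; apply: xe; rewrite r0 (le_trans rt).
  rewrite Rintegral_cst//= lebesgue_measure_itv/= lte_fin.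
  case: ltP => t0' /=; last by rewrite mulr0 ltW.
  rewrite subr0 mulrAC ler_pdivrMr ?ler_wpM2l ?ltW//.
  by rewrite (le_lt_trans tN)// ltrDl.
  by rewrite ltr_wpDl.
have gN : leb.-integrable (`[0, N] : set (measurableTypeR R)) (EFin \o g).
  by apply: integrableS gi.
have prim : primitive_on N y (fun r => g r - a * y r).
  split; first by apply: integrableB_EFin => //; exact: integrableZl_EFin.
  move=> t tN; have /andP[t0 tN'] := tN.
  have mt : measurable (`[0, t] : set (measurableTypeR R)) by [].
  have yti := integrableS mD mt (sub _ tN') yi.
  have gti := integrableS mD mt (sub _ tN') gN.
  rewrite RintegralB//; last exact: integrableZl_EFin.
  rewrite RintegralZl//.
  have lim1 : (x : skorohod R) 0 + (\int[leb]_(r in `[0, t]) h x r -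
      a * \int[leb]_(r in `[0, t]) x r) @[x --> F] -->
      y 0 + (\int[leb]_(r in `[0, t]) g r - a * \int[leb]_(r in `[0, t]) y r).
    apply: cvgD; first by apply: xcvg; rewrite lexx.
    apply: cvgB; first by apply: gcvg => //; exact: sub.
    by apply: cvgM; [exact: cvg_cst|exact: icvg].
  apply: (cvg_unique _ (xcvg t tN)) => //.
  apply: cvg_trans lim1; apply: near_eq_cvg.
  apply: filterS FK => x Kx; have [xv _] := vP _ Kx.
  have xti := integrableS mD mt (sub _ tN') (primitive_integrable N0 xv).
  have vti := integrableS mD mt (sub _ tN') xv.1.
  rewrite hE// RintegralD//; last exact: integrableZl_EFin.
  by rewrite RintegralZl// addrK -xv.2.
exists (fun r => g r - a * y r) => //.
rewrite -(@lee_pmul2l _ 8%:E)// -energy_sqr// -EFinM.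
apply: le_trans (gC UF); rewrite le_eqVlt; apply/orP; left; apply/eqP.
by apply: eq_integral => r _; rewrite subrK.
Qed.

Variable I0 : R -> \bar R.
Hypothesis I0_good : good_rate_function I0.

Lemma cw_rate_finite (x : skorohod R) (c : R) : (cw_rate beta I0 x <= c%:E)%E ->
  exists g, (forall T, 0 <= T -> primitive_on T x g) /\
    (I0 (x 0%R) + \int[leb]_(r in `[0%R, +oo[)
      (cw_lagrangian beta (x r) (g r))%:E <= c%:E)%E.
Proof.
rewrite /cw_rate; case: asboolP => // xac H.
by exists (velocity x); split => //; exact: velocityP.
Qed.

Lemma cw_rate_ge0 (x : skorohod R) : (0 <= cw_rate beta I0 x)%E.
Proof.
rewrite /cw_rate; case: asboolP => // _.
by apply: adde_ge0; [exact: I0_good.1|exact: energy_ge0].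
Qed.

Lemma cw_rate_init (x : skorohod R) (c : R) : (cw_rate beta I0 x <= c%:E)%E ->
  (I0 (x 0%R) <= c%:E)%E.
Proof.
move=> /cw_rate_finite[g [_]]; apply: le_trans.
by rewrite leeDl// energy_ge0.
Qed.

(** The optimal slope [D / (2 dV)] in [tilt_le_energy] gives [D^2 / (4 dV) <= c]: weighted curves of
    bounded rate are uniformly 1/2-Hölder with respect to the clock. *)
Lemma cw_rate_modulus (x : skorohod R) (c s t : R) :
  (cw_rate beta I0 x <= c%:E)%E -> 0 <= s -> s <= t ->
  (expR (a * t) * x t - expR (a * s) * x s) ^+ 2 <=
  4 * c * (clock a t - clock a s).
Proof.
move=> /cw_rate_finite[g [xg gc]] s0; rewrite le_eqVlt => /predU1P[->|st].
  by rewrite !subrr expr0n mulr0.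
set D := expR _ * _ - _.
have V0 : 0 < clock a t - clock a s by rewrite subr_gt0 clock_lt.
have := @tilt_le_energy R beta t x g (D / (2 * (clock a t - clock a s))) s t
  (xg _ (le_trans s0 (ltW st))) s0 (ltW st) (lexx _).
rewrite -/D => H.
have {}H : ((D / (2 * (clock a t - clock a s)) * D -
    (D / (2 * (clock a t - clock a s))) ^+ 2 * (clock a t - clock a s))%:E <= c%:E)%E.
  apply: le_trans H _; apply: le_trans gc.
  apply: (@le_trans _ _ (\int[leb]_(r in `[0%R, +oo[)
      (cw_lagrangian beta (x r) (g r))%:E)%E).
    apply: ge0_subset_integral => //.
    - exact: measurable_lagrangian_halfline.
    - by move=> r _; rewrite lee_fin cw_lagrangian_ge0.
    - move=> r /=; rewrite !in_itv/= andbT => /andP[sr _].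
      by rewrite ltW// (le_lt_trans s0).
  by rewrite leeDr// I0_good.1.
move: H; rewrite lee_fin.
have -> : D / (2 * (clock a t - clock a s)) * D -
    (D / (2 * (clock a t - clock a s))) ^+ 2 * (clock a t - clock a s) =
    D ^+ 2 / (4 * (clock a t - clock a s)) by field; rewrite lt0r_neq0.
by rewrite ler_pdivrMr ?mulr_gt0// mulrA (mulrC c).
Qed.

Lemma clock_lipschitz (N s t : R) : 0 <= s -> s <= t -> t <= N ->
  clock a t - clock a s <= 2 * expR (`|2 * a| * N) * (t - s).
Proof.
move=> s0 st tN.
have [z /andP[sz zt] ->] := MVT_derive st (@is_derive_clock R a).
rewrite ler_wpM2r ?subr_ge0// ler_wpM2l// ler_expR.
apply: le_trans (ler_norm _) _; rewrite normrM ler_wpM2l//.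
by rewrite ger0_norm ?(le_trans zt)// (le_trans s0).
Qed.

End energy_limits.

Section goodness.
Context {R : realType} (beta : R).
Local Notation a := (2 * (1 - beta)).
Variable I0 : R -> \bar R.
Hypothesis I0_good : good_rate_function I0.

Lemma uniform_skorohod_near (N e : R) (x y : skorohod R) : 0 <= e ->
  (forall t, 0 <= t <= N -> `|y t - x t| <= e) -> skorohod_near N e (x, y).
Proof.
move=> e0 H; exists id; split => //; first exact: time_change_id.
by move=> s _; rewrite subrr normr0.
Qed.

Lemma uniform_skorohod_cvg (F : set_system (skorohod R)) {FF : Filter F}
    (y : skorohod R) :
  (forall N e : R, 0 < e ->
    F [set x : skorohod R | forall t : R, 0 <= t <= N -> `|x t - y t| <= e]) ->
  F --> y.
Proof.
move=> H; apply/cvg_entourageP => A [N [e [e0 NA]]]; rewrite near_simpl.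
apply: filterS (H N e e0) => x xe; apply: NA.
by apply: uniform_skorohod_near => //; exact: ltW.
Qed.

Lemma cw_rate_bound (c t : R) : 0 <= c -> 0 <= t -> exists B : R,
  forall x : skorohod R, (cw_rate beta I0 x <= c%:E)%E -> `|x t| <= B.
Proof.
move=> c0 t0; have [B [_ HB]] := compact_bounded (I0_good.2 c c0).
have {}HB y : (I0 y <= c%:E)%E -> `|y| <= B + 1.
  by move=> Hy; apply: (HB (B + 1)) => //; rewrite ltrDl.
(* The second bracket bounds the increment [D] from time 0 through the inequality between the norm
   of [D] and [1 + D^2]. *)
exists (expR (- (a * t)) * ((B + 1) + (1 + 4 * c * clock a t))) => x xc.
have := cw_rate_modulus I0_good xc (lexx 0) t0.
rewrite mulr0 expR0 mul1r clock0 subr0 => H.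
have x0 := HB _ (cw_rate_init xc).
have -> : x t = expR (- (a * t)) * (expR (a * t) * x t).
  by rewrite mulrA -expRD addNr expR0 mul1r.
rewrite normrM ger0_norm ?expR_ge0// ler_wpM2l ?expR_ge0//.
have -> : expR (a * t) * x t = x 0 + (expR (a * t) * x t - x 0) by ring.
apply: (le_trans (ler_normD _ _)); apply: lerD => //.
move: H; set D := _ - x 0 => H; rewrite -real_normK ?num_real// in H.
have := sqr_ge0 (`|D| - 1); have := normr_ge0 D; nra.
Qed.

Lemma sqr_le_norm (x y : R) : 0 <= y -> x ^+ 2 <= y ^+ 2 -> `|x| <= y.
Proof. by move=> y0 H; rewrite -ler_sqr ?nnegrE// real_normK ?num_real. Qed.

Lemma grid_point (N t : R) (M : nat) : 0 <= t -> t <= N ->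
  exists2 k : 'I_M.+1, k%:R * (N / M.+1%:R) <= t &
    t - k%:R * (N / M.+1%:R) <= N / M.+1%:R.
Proof.
move=> t0 tN; have [Npos|] := ltP 0 N; last first.
  move=> N0'; have tE : t = 0 by apply/eqP; rewrite eq_le t0 (le_trans tN).
  have NE : N = 0 by apply/eqP; rewrite eq_le N0' -{1}tE tN.
  by exists ord0; rewrite /= mul0r tE// subrr NE mul0r.
have s0 : 0 < N / M.+1%:R by rewrite divr_gt0.
have tdiv0 : 0 <= t / (N / M.+1%:R) by rewrite divr_ge0// ltW.
(* The minimum with [M] only matters for [t = N], which belongs to the last cell. *)
pose k := minn (Num.truncn (t / (N / M.+1%:R))) M.
have kM : (k < M.+1)%N by rewrite ltnS geq_minr.
exists (Ordinal kM) => /=.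
  rewrite -ler_pdivlMr// (@le_trans _ _ (Num.truncn (t / (N / M.+1%:R)))%:R)//.
    by rewrite ler_nat geq_minl.
  by rewrite truncn_le.
rewrite lerBlDr -{1}[N / _]mul1r -mulrDl -ler_pdivrMr// nat1r.
rewrite /k /minn; case: ifP => _; first exact: ltW (truncnS_gt _).
by rewrite ler_pdivrMr// mulrCA divff ?mulr1.
Qed.

(** As in the Arzelà-Ascoli theorem: limits at each time exist by boundedness and inherit the common
    modulus; proximity at finitely many grid times is an event of the filter, and the modulus
    extends it to [[0, N]]. *)
Lemma cw_rate_ultra_cvg (F : set_system (skorohod R)) {UF : UltraFilter F}
    (c : R) : 0 <= c -> F [set x | (cw_rate beta I0 x <= c%:E)%E] ->
  exists y : skorohod R, (forall T, 0 <= T -> {within `[0, T], continuous y}) /\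
    forall N e : R, 0 < e ->
    F [set x : skorohod R | forall t : R, 0 <= t <= N -> `|x t - y t| <= e].
Proof.
move=> c0 FK.
have ev t : 0 <= t -> cvg ((x : skorohod R) t @[x --> F]).
  move=> t0; have [B HB] := cw_rate_bound c0 t0.
  by apply: (@ultra_bounded_cvg _ _ _ _ _ B); exact: filterS FK.
pose y0 t := lim ((x : skorohod R) t @[x --> F]).
pose u (x : skorohod R) t := expR (a * t) * x t.
have ucvg t : 0 <= t -> u x t @[x --> F] --> expR (a * t) * y0 t.
  by move=> t0; apply: cvgM; [exact: cvg_cst|exact: ev].
have mod0 s t : 0 <= s -> s <= t ->
    (expR (a * t) * y0 t - expR (a * s) * y0 s) ^+ 2 <=
    4 * c * (clock a t - clock a s).
  move=> s0 st; have t0 := le_trans s0 st.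
  have C : (u x t - u x s) ^+ 2 @[x --> F] -->
      (expR (a * t) * y0 t - expR (a * s) * y0 s) ^+ 2.
    have CB : u x t - u x s @[x --> F] -->
      expR (a * t) * y0 t - expR (a * s) * y0 s.
      by apply: cvgB; exact: ucvg.
    by rewrite expr2; under eq_fun do rewrite expr2; apply: cvgM.
  apply: (@ler_cvg_to _ _ _ _ _ (cst (4 * c * (clock a t - clock a s))) _ _ C).
    exact: cvg_cst.
  by apply: filterS FK => x xc; exact: (cw_rate_modulus I0_good xc s0 st).
have small (N e : R) : 0 <= N -> 0 < e -> exists2 de, 0 < de &
    forall v : R -> R, (forall s t, 0 <= s -> s <= t ->
      (v t - v s) ^+ 2 <= 4 * c * (clock a t - clock a s)) ->
    forall s t, 0 <= s -> s <= t -> t <= N -> t - s <= de -> `|v t - v s| <= e.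
  move=> N0 e0; have [L LE] : {L | L = 4 * c * (2 * expR (`|2 * a| * N))}
    by exact: exist.
  have L0 : 0 <= L by rewrite LE !mulr_ge0// expR_ge0.
  have L1 : 0 < L + 1 by rewrite ltr_wpDl.
  exists (e ^+ 2 / (L + 1)); first by rewrite divr_gt0// exprn_gt0.
  move=> v Hv s t s0 st tN tsd; apply: sqr_le_norm; first exact: ltW.
  apply: le_trans (Hv _ _ s0 st) _.
  apply: (@le_trans _ _ (L * (t - s))).
    rewrite LE -[leRHS]mulrA; apply: ler_wpM2l; first by rewrite mulr_ge0.
    exact: clock_lipschitz.
  move: tsd; rewrite ler_pdivlMr//.
  have : 0 <= t - s by rewrite subr_ge0. nra.
have cu T : 0 <= T -> {within `[0, T], continuous (fun t => expR (a * t) * y0 t)}.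
  move=> T0; apply/subspace_continuousP => s; rewrite /= in_itv/= => /andP[s0 sT].
  apply/cvgrPdist_le => e e0; have [de de0 Hde] := small T e T0 e0.
  have {}Hde := Hde _ mod0.
  rewrite near_withinE; near=> t => /=; rewrite in_itv/= => /andP[t0 tT].
  have tsd : `|s - t| < de.
    by near: t; apply: cvgr_dist_lt => //; exact: cvg_id.
  have [st|ts] := leP s t.
    rewrite distrC; apply: Hde => //; apply: le_trans (ltW tsd).
    by rewrite distrC ler_norm.
  by apply: Hde => //; [exact: ltW|apply: le_trans (ltW tsd); exact: ler_norm].
have cy0 T : 0 <= T -> {within `[0, T], continuous y0}.
  move=> T0; have -> : y0 = (fun t => expR ((- a) * t) * (expR (a * t) * y0 t)).
    by apply/funext => t; rewrite mulrA -expRD mulNr addNr expR0 mul1r.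
  apply/subspace_continuousP => s sT; apply: cvgM.
    by apply: cvg_within_filter; exact: continuous_expRM.
  by have /subspace_continuousP := cu T T0; exact.
have [y yE] := continuous_skorohod cy0.
exists y; split.
  move=> T T0; apply: (@subspace_eq_continuous _ _ _ y0); last exact: cy0.
  by move=> t; rewrite inE/= in_itv/= => /andP[t0 _]; rewrite /from_subspace yE.
move=> N e e0.
have [N0|N0] := ltP N 0.
  apply: filterS FK => x _ t /andP[t0 tN].
  by have := lt_le_trans N0 (le_trans t0 tN); rewrite ltxx.
(* The three parts are the modulus of [x], the distance at a grid time and the modulus of the limit;
   the exponential removes the weight [e^(a t)]. *)
have [e' e'E] : {e' : R | e' = e / (3 * expR (`|a| * N))} by exact: exist.
have e'0 : 0 < e' by rewrite e'E divr_gt0// mulr_gt0// expR_gt0.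
have [de de0 Hde] := small N e' N0 e'0.
have [M MP] : exists M : nat, N / M.+1%:R <= de.
  exists (Num.truncn (N / de)); rewrite ler_pdivrMr// mulrC -ler_pdivrMr//.
  exact: ltW (truncnS_gt _).
pose g (k : nat) : R := k%:R * (N / M.+1%:R).
have g0 k : 0 <= g k by rewrite mulr_ge0// divr_ge0.
have Fg : F [set x | forall k : 'I_M.+1, `|u x (g k) - expR (a * g k) * y0 (g k)| <= e'].
  apply: filter_forall => k; have := ucvg _ (g0 k).
  by move=> /cvgrPdist_le/(_ _ e'0); apply: filterS => x; rewrite distrC.
apply: filterS2 FK Fg => x xc xg t /andP[t0 tN].
have [k kt tk] := grid_point M t0 tN.
rewrite -/(g k) in kt tk; have {}tk := le_trans tk MP.
have tE (v : R -> R) : v t = expR (- (a * t)) * (expR (a * t) * v t).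
  by rewrite mulrA -expRD addNr expR0 mul1r.
rewrite yE// tE (tE y0) -mulrBr normrM ger0_norm ?expR_ge0//.
have d1 := Hde _ (fun s t => @cw_rate_modulus _ _ _ I0_good x c s t xc) _ _ (g0 k) kt tN tk.
have d2 := Hde _ mod0 _ _ (g0 k) kt tN tk.
have d3 := xg k.
have d : `|u x t - expR (a * t) * y0 t| <= 3 * e'.
  move: d1 d2 d3; rewrite -/(u x t) -/(u x (g k)) !ler_norml; lra.
have dE : expR (- (a * t)) <= expR (`|a| * N).
  rewrite ler_expR (le_trans (ler_norm _))// normrN normrM ler_wpM2l//.
  by rewrite ger0_norm.
apply: le_trans (ler_pM (expR_ge0 _) (normr_ge0 _) dE d) _.
by rewrite e'E le_eqVlt; apply/orP; left; apply/eqP; field; rewrite lt0r_neq0// expR_gt0.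
Unshelve. all: by end_near. Qed.

(** For the limit [y] to have rate at most [c], the initial cost and the energy must be controlled
    jointly. By lower semicontinuity of [I0], eventually [I0 (x 0) > I0 (y 0) - e], which leaves at
    most [c - I0 (y 0) + e] for the energy up to any [N]. Then [e] vanishes and [N] grows;
    uniqueness of the density identifies the velocities obtained for the various [N] and [e]. *)
Lemma cw_rate_good : good_rate_function (cw_rate beta I0).
Proof.
split; first exact: cw_rate_ge0.
move=> c c0; rewrite compact_ultra => F UF FK.
have [y [cy unif]] := cw_rate_ultra_cvg c0 FK.
exists y; split; last exact: uniform_skorohod_cvg.
have x0y : (x : skorohod R) 0 @[x --> F] --> y 0.
  apply/cvgrPdist_le => e e0; apply: filterS (unif 0 e e0) => x xe.
  by rewrite distrC; apply: xe; rewrite !lexx.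
have closedI (v : R) : 0 <= v -> closed [set z | (I0 z <= v%:E)%E].
  by move=> v0; apply: compact_closed; [exact: norm_hausdorff|exact: I0_good.2].
have Iy : (I0 (y 0%R) <= c%:E)%E.
  apply: (closed_cvg _ (closedI c c0) _ _ x0y).
  by apply: filterS FK => x; exact: cw_rate_init.
have [i iE] : exists i, I0 (y 0) = i%:E :> \bar R.
  by move: Iy (I0_good.1 (y 0)); case: (I0 (y 0)) => [r| |] //; exists r.
have i0 : 0 <= i by have := I0_good.1 (y 0); rewrite iE lee_fin.
have ic : i <= c by move: Iy; rewrite iE lee_fin.
have Fi (e : R) : 0 < e -> F [set x : skorohod R | ((i - e)%:E < I0 (x 0%R))%E].
  move=> e0; have [ie|ie] := ltP (i - e) 0.
    by apply: filterS filterT => x _; rewrite /= (lt_le_trans _ (I0_good.1 _)).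
  have oi : open (~` [set z | (I0 z <= (i - e)%:E)%E]).
    by apply: closed_openC; exact: closedI.
  have yi : (~` [set z | (I0 z <= (i - e)%:E)%E]) (y 0).
    by rewrite /= iE lee_fin => H; lra.
  have Fo : F [set x : skorohod R | ~ (I0 (x 0%R) <= (i - e)%:E)%E].
    exact: x0y _ (open_nbhs_nbhs (conj oi yi)).
  by apply: filterS Fo => x /= /negP; rewrite -ltNge.
have energy_le (x : skorohod R) (N v w : R) : 0 <= N ->
    (cw_rate beta I0 x <= v%:E)%E -> (w%:E <= I0 (x 0%R))%E ->
    exists2 g, primitive_on N x g &
    (\int[leb]_(r in `[0%R, N]) (cw_lagrangian beta (x r) (g r))%:E <= (v - w)%:E)%E.
  move=> N0 xv xw; have [g [xg gv]] := cw_rate_finite xv.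
  exists g; first exact: xg.
  rewrite EFinB leeBrDr//.
  apply: le_trans gv; rewrite addeC; apply: leeD => //.
  apply: ge0_subset_integral => //.
  - exact: measurable_lagrangian_halfline.
  - by move=> r _; rewrite lee_fin cw_lagrangian_ge0.
  - by move=> r /=; rewrite !in_itv/= andbT => /andP[].
have energy_y (N e : R) : 0 <= N -> 0 < e -> exists2 g, primitive_on N y g &
    (\int[leb]_(r in `[0%R, N]) (cw_lagrangian beta (y r) (g r))%:E <=
     (c - i + e)%:E)%E.
  move=> N0 e0; apply: (energy_limit (F := F) N0 _
    (filterI FK (Fi e e0)) _ (cy N N0) (unif N)); first by lra.
  move=> x /= [xc /ltW xi]; have [g xg gv] := energy_le _ _ _ _ N0 xc xi.
  by exists g => //; rewrite (_ : c - i + e = c - (i - e))//; ring.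
have yac : abs_continuous y.
  by move=> N N0; have [g yg _] := energy_y N 1 N0 ltr01; exists g.
have yv := velocityP yac.
rewrite /= (cw_rate_primitive beta I0 yv) iE.
have -> : c%:E = (i%:E + (c - i)%:E)%E by rewrite -EFinD; congr (_%:E); ring.
apply: leeD => //; apply: energy_halfline_le => // n.
apply/lee_addgt0Pr => e e0; rewrite -EFinD.
have [g yg] := energy_y n%:R e (ler0n _ _) e0.
by rewrite (energy_unique beta (ler0n _ _) yg (yv _ (ler0n _ _))).
Qed.

End goodness.

(** * Measurability and separation in the Skorohod space *)

Section discretization.
Context {R : realType}.
Implicit Types (x : skorohod R) (N e : R).

(** Let [s] be the supremum of the times reachable by such a partition. The left limit at [s] shows
    that [s] is reachable, and right continuity at [s] that some later time is; hence the reachable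
    times are unbounded. *)
Lemma cadlag_partition x N e : 0 < e -> exists (r : nat) (t : nat -> R),
  [/\ t 0%N = 0, forall i, (i < r)%N -> t i < t i.+1, N < t r &
    forall i s, (i < r)%N -> t i <= s < t i.+1 -> `|x s - x (t i)| <= e].
Proof.
move=> e0.
pose P (u : R) := exists (r : nat) (t : nat -> R),
  [/\ t 0%N = 0, forall i, (i < r)%N -> t i < t i.+1, t r = u &
    forall i s, (i < r)%N -> t i <= s < t i.+1 -> `|x s - x (t i)| <= e].
have P0 : P 0 by exists 0%N, (fun=> 0).
have Pext u v : P u -> u < v ->
    (forall s, u <= s < v -> `|x s - x u| <= e) -> P v.
  move=> [r [t [t0 tS tr tx]]] uv Huv.
  exists r.+1, (fun i => if (i <= r)%N then t i else v).
  split => //.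
  - move=> i; rewrite ltnS => ir; rewrite ir.
    case: ifP => [/tS //|/negbT]; rewrite -ltnNge ltnS => ri.
    by have -> : i = r; [apply/eqP; rewrite eqn_leq ir|rewrite tr].
  - by rewrite ltnn.
  - move=> i s; rewrite ltnS => ir; rewrite ir.
    case: ifP => [ir'|/negbT]; first exact: tx.
    rewrite -ltnNge ltnS => ri.
    have -> : i = r by apply/eqP; rewrite eqn_leq ir.
    by rewrite tr; exact: Huv.
have Pge0 u : P u -> 0 <= u.
  move=> [r [t [t0 tS <- _]]]; rewrite -t0.
  elim: r tS => [//|r IH] tS; apply: le_trans (IH _) (ltW (tS r _)) => //.
  by move=> i ir; apply: tS; rewrite ltnS ltnW.
apply: contrapT => nE.
have ub u : P u -> u <= N.
  move=> Pu; rewrite leNgt; apply/negP => Nu; apply: nE.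
  by have [r [t [t0 tS tr tx]]] := Pu; exists r, t; rewrite tr.
have hsS : has_sup P by split; [exists 0|exists N => u /ub].
pose s := sup P.
have us u : P u -> u <= s by move=> Pu; apply: ub_le_sup => //; case: hsS.
have s0 : 0 <= s by exact: us.
have Ps : P s.
  move: (s0); rewrite le_eqVlt => /predU1P[<-//|spos].
  have /cvg_ex[/= L HL] := @traj_llim R x s spos.
  have e20 : 0 < e / 2 by rewrite divr_gt0.
  have /cvgrPdist_le/(_ _ e20) := HL.
  rewrite near_withinE => -[de /= de0 Hde].
  have [u Pu su] := sup_adherent de0 hsS.
  have := us _ Pu; rewrite le_eqVlt => /predU1P[<-//|ult].
  have near_L v : u <= v < s -> `|L - x v| <= e / 2.
    move=> /andP[uv vs]; apply: Hde => //=.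
    by rewrite gtr0_norm ?subr_gt0// ltrBlDr -ltrBlDl (lt_le_trans su).
  apply: (Pext _ _ Pu ult) => v uvs.
  have := near_L _ uvs; have := near_L u; rewrite lexx ult => /(_ isT).
  by rewrite !ler_norml; lra.
have /cvgrPdist_le/(_ _ e0) := @traj_rcont R x s s0.
rewrite near_withinE => -[de /= de0 Hde].
have : P (s + de / 2).
  apply: Pext Ps _ _; first by rewrite ltrDl divr_gt0.
  move=> v /andP[]; rewrite le_eqVlt => /predU1P[<-|sv] vd.
    by rewrite subrr normr0 ltW.
  rewrite distrC; apply: Hde => //=.
  by rewrite ltr0_norm ?subr_lt0// opprB; lra.
by move=> /us; rewrite gerDl leNgt divr_gt0.
Qed.

Lemma partition_gap (r : nat) (t : nat -> R) :
  (forall i, (i < r)%N -> t i < t i.+1) ->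
  exists2 g, 0 < g & forall i j, (i < j)%N -> (j <= r)%N -> g <= t j - t i.
Proof.
elim: r => [|r IH] tS; first by exists 1 => // i j ij; rewrite leqn0 => /eqP j0; rewrite j0 in ij.
have [|g g0 Hg] := IH; first by move=> i ir; apply: tS; rewrite ltnS ltnW.
exists (Num.min g (t r.+1 - t r)); first by rewrite lt_min g0 subr_gt0 tS.
move=> i j ij; rewrite leq_eqVlt => /predU1P[jE|]; last first.
  by rewrite ltnS => jr; rewrite ge_min Hg.
rewrite jE ge_min; apply/orP; right; rewrite lerB//.
move: ij; rewrite jE ltnS leq_eqVlt => /predU1P[->//|ir].
by rewrite -subr_ge0 ltW// (lt_le_trans g0)// Hg.
Qed.

Lemma partition_cell (r : nat) (t : nat -> R) (s : R) : t 0%N <= s < t r ->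
  exists2 i, (i < r)%N & t i <= s < t i.+1.
Proof.
elim: r => [|r IH] /andP[ts st]; first by have := le_lt_trans ts st; rewrite ltxx.
have [srt|trs] := ltP s (t r); last by exists r; rewrite ?trs.
by have [|i ir H] := IH; [rewrite ts|exists i; rewrite // ltnS ltnW].
Qed.

(** A shift with Lipschitz constant [1/2] cannot destroy strict monotonicity, and the intermediate
    value theorem gives surjectivity. *)
Lemma shift_time_change (phi : R -> R) : phi 0 = 0 -> (forall s, 0 <= phi s) ->
  (forall s u, `|phi s - phi u| <= `|s - u| / 2) ->
  time_change (fun s => s + phi s).
Proof.
move=> p0 pge lip; split; [|split].
- move=> s u _ _ su; have := lip s u.
  by rewrite distrC (distrC s) [X in _ <= X / _]gtr0_norm ?subr_gt0// ler_norml; lra.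
- move=> y; rewrite /= in_itv/= andbT => y0.
  have cphi : continuous (fun s => s + phi s).
    move=> s; apply: cvgD; first exact: cvg_id.
    apply/cvgrPdist_le => e e0; near=> u.
    apply: le_trans (lip s u) _.
    have : `|s - u| < e by near: u; apply: cvgr_dist_lt => //; exact: cvg_id.
    by have := normr_ge0 (s - u); lra.
  have [||c] := @IVT R (fun s => s + phi s) 0 y y y0.
  + exact: continuous_subspaceT.
  + by rewrite p0 addr0 ge_min y0/= le_max lerDl pge orbT.
  + by rewrite in_itv/= => /andP[c0 _] cy; exists c => //; rewrite /= in_itv/= c0.
- by move=> s; rewrite /= !in_itv/= !andbT => s0; rewrite addr_ge0.
Unshelve. all: by end_near. Qed.

(* McShane's formula: [phi s] is the minimum of [h] and of the
   [v i + `|s - t i| / 2]. *)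
Lemma McShane_min (r : nat) (t v : nat -> R) (h : R) : 
  exists phi : R -> R,
  [/\ forall s, phi s <= h, forall s i, (i < r)%N -> phi s <= v i + `|s - t i| / 2,
   forall s c, c <= h -> (forall i, (i < r)%N -> c <= v i + `|s - t i| / 2) -> c <= phi s &
   forall s u, `|phi s - phi u| <= `|s - u| / 2].
Proof.
elim: r => [|r [phi [p1 p2 p3 p4]]].
  by exists (fun=> h); split => // s u; rewrite subrr normr0 divr_ge0.
exists (fun s => Num.min (phi s) (v r + `|s - t r| / 2)); split.
- by move=> s; rewrite ge_min p1.
- move=> s i; rewrite ltnS leq_eqVlt ge_min => /predU1P[->|ir].
    by rewrite lexx orbT.
  by rewrite p2.
- move=> s c ch ci; rewrite le_min p3 ?ci// => i ir.
  by apply: ci; rewrite ltnS ltnW.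
- move=> s u; have H1 := p4 s u.
  have H2 : `|(v r + `|s - t r| / 2) - (v r + `|u - t r| / 2)| <= `|s - u| / 2.
    have := ler_dist_dist (s - t r) (u - t r).
    rewrite opprB addrA subrK.
    have := normr_ge0 (s - u); rewrite !ler_norml; lra.
  move: H1 H2; set A := v r + _; set B := v r + _; set p := phi s; set q := phi u.
  by case: (leP p A) => ?; case: (leP q B) => ?; rewrite !ler_norml; lra.
Qed.

End discretization.

(** * Approximation by sampled paths *)

Section step_paths.
Context {R : realType}.
Implicit Types (x : skorohod R) (N e : R).

Section step_path.
Variables (f : nat -> R) (k : nat).
Local Notation K := (k.+1%:R : R).

Let g (t : R) : R := f (Num.truncn (t * K)).

Let K0 : 0 < K. Proof. by []. Qed.

Let step_rcont t : 0 <= t -> g s @[s --> t^'+] --> g t.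
Proof.
move=> t0; have tK : 0 <= t * K by rewrite mulr_ge0.
apply: cvg_near_cst.
have tl : t < (Num.truncn (t * K)).+1%:R / K.
  by rewrite ltr_pdivlMr// truncnS_gt.
near=> s; rewrite /g; congr (f _); apply: truncn_def.
have ts : t < s by near: s; exact: nbhs_right_gt.
rewrite -ltr_pdivlMr//; apply/andP; split; last by near: s; exact: nbhs_right_lt.
by rewrite (@le_trans _ _ (t * K))// ?truncn_le// ler_wpM2r// ltW.
Unshelve. all: by end_near. Qed.

Let step_llim t : 0 < t -> cvg (g s @[s --> t^'-]).
Proof.
move=> t0; have tK : 0 < t * K by rewrite mulr_gt0.
have [c [cl cr]] : exists c : nat, c%:R < t * K /\ t * K <= c.+1%:R.
  have /andP[] := truncn_itv (ltW tK); rewrite le_eqVlt => /predU1P[E H|H1 H2].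
    move: E; case: (Num.truncn _) => [E|n E].
      by rewrite -E ltxx in tK.
    by exists n; rewrite -E lexx ltr_nat.
  by exists (Num.truncn (t * K)); rewrite ltW.
apply/cvg_ex; exists (f c); apply: cvg_near_cst.
have tl : c%:R / K < t by rewrite ltr_pdivrMr.
near=> s; rewrite /g; congr (f _); apply: truncn_def.
have st : s < t by near: s; exact: nbhs_left_lt.
apply/andP; split; last by rewrite (lt_le_trans _ cr)// ltr_pM2r.
by rewrite -ler_pdivrMr// ltW//; near: s; exact: nbhs_left_gt.
Unshelve. all: by end_near. Qed.

Let step_neg t : t < 0 -> g t = g 0.
Proof.
move=> t0; rewrite /g mul0r truncn0; congr (f _); apply/truncn0Pn.
by rewrite -ltNge (lt_trans _ (@ltr01 R))// pmulr_llt0.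
Qed.

Definition step_path : skorohod R := Skorohod step_rcont step_llim step_neg.

End step_path.

(* The cap on [j] makes [sampled_path k x] depend on finitely many values of
   [x] only. *)
Definition sampled_path (k : nat) x : skorohod R :=
  step_path (fun j => x ((minn j (k.+1 * k.+1))%:R / k.+1%:R)) k.

Lemma nat_ceil (y : R) : 0 <= y -> exists c : nat, y <= c%:R < y + 1.
Proof.
move=> /truncn_itv /andP[]; rewrite le_eqVlt => /predU1P[E _|H1 H2].
  by exists (Num.truncn y); rewrite E lexx ltrDl ltr01.
by exists (Num.truncn y).+1; rewrite ltW//= -natr1 ltrD2r.
Qed.

(** The jumps of a sampled path occur at sampling times, so it is close to [x] only after a time
    change. Once the sampling step is at most half the smallest gap of a partition adapted to [x],
    the small shifts prescribed at the partition points extend to a function with Lipschitz constant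
    [1/2]. *)
Lemma sampled_path_near x N e : 0 < e ->
  \forall k \near \oo, skorohod_near N e (x, sampled_path k x).
Proof.
move=> e0; have e20 : 0 < e / 2 by rewrite divr_gt0.
have [r [t [t0 tS tr tx]]] := cadlag_partition x N e20.
have [g g0 gap] := partition_gap tS.
have g20 : 0 < g / 2 by rewrite divr_gt0.
near=> k.
have Kg : (k.+1%:R : R)^-1 <= g / 2.
  by apply: ltW; near: k; exact: (near_infty_natSinv_lt (PosNum g20)).
have Ke : (k.+1%:R : R)^-1 <= e.
  by apply: ltW; near: k; exact: (near_infty_natSinv_lt (PosNum e0)).
(* The sampling indices met up to time [N], shifted by at most 1, do not exceed
   [(N + 1) * K <= K * K], so the cap in [sampled_path] is not reached. *)
have KN : N + 1 <= (k.+1%:R : R).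
  by rewrite -natr1 lerD2r; near: k; exact: nbhs_infty_ger.
pose K := k.+1%:R : R; have K0 : 0 < K by rewrite /K.
rewrite -/K in Kg Ke KN.
have t_ge0 i : (i <= r)%N -> 0 <= t i.
  rewrite -t0; case: i => [//|i] ir.
  by rewrite -subr_ge0 (le_trans (ltW g0))// gap.
have /choice[c cP] : forall i : nat, exists c : nat, (i <= r)%N ->
    t i * K <= c%:R < t i * K + 1.
  move=> i; have [ir|] := boolP (i <= r)%N; last by exists 0%N.
  have [|c cc] := @nat_ceil (t i * K); first by rewrite mulr_ge0 ?t_ge0// ltW.
  by exists c.
have [phi [p1 p2 p3 p4]] := McShane_min r.+1 t (fun i => (c i)%:R / K - t i) K^-1.
have v0 i : (i <= r)%N -> 0 <= (c i)%:R / K - t i.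
  by move=> /cP/andP[H _]; rewrite subr_ge0 ler_pdivlMr.
have vK i : (i <= r)%N -> (c i)%:R / K - t i <= K^-1.
  move=> /cP/andP[_ H]; rewrite lerBlDr -{2}[K^-1]mul1r -[X in _ + X](mulfK (lt0r_neq0 K0)) -mulrDl.
  by rewrite ler_pM2r ?invr_gt0// addrC ltW.
have phi_t i : (i <= r)%N -> phi (t i) = (c i)%:R / K - t i.
  move=> ir; apply/eqP; rewrite eq_le; apply/andP; split.
    by have := p2 (t i) i; rewrite ltnS ir subrr normr0 mul0r addr0; exact.
  apply: (p3); first exact: vK.
  move=> j; rewrite ltnS => jr; have vi := vK i ir; have vj := v0 j jr.
  have [->|ij] := eqVneq i j; first by rewrite subrr normr0 mul0r addr0.
  have H : g / 2 <= `|t i - t j| / 2.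
    rewrite ler_pM2r//; case: (ltngtP i j) ij => [ij|ji|//] _.
      by rewrite distrC (le_trans (gap _ _ ij jr))// ler_norm.
    by rewrite (le_trans (gap _ _ ji ir))// ler_norm.
  by apply: (le_trans vi (le_trans Kg (le_trans H _))); rewrite lerDr.
have phi_ge0 s : 0 <= phi s.
  apply: p3; first by rewrite invr_ge0 ltW.
  by move=> i; rewrite ltnS => /v0 H; rewrite addr_ge0// divr_ge0.
have phi0 : phi 0 = 0.
  have := phi_t 0%N (leq0n _); rewrite t0 => ->.
  have := cP 0%N (leq0n _); rewrite t0 mul0r add0r => /andP[_].
  by rewrite -[1]/(1%:R) ltr_nat ltnS leqn0 => /eqP ->; rewrite mul0r subrr.
have tl := shift_time_change phi0 phi_ge0 p4.
have l_t i : (i <= r)%N -> t i + phi (t i) = (c i)%:R / K.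
  by move=> ir; rewrite phi_t// addrC subrK.
(* This time change moves each [t i] to the next sampling time [c i / K]. *)
exists (fun s => s + phi s); split => //.
  by move=> s _; rewrite addrAC subrr add0r ger0_norm// (le_trans (p1 s)).
move=> s /andP[s0 sN].
have [|i ir /andP[ts st]] := @partition_cell _ r t s.
  by rewrite t0 s0 (le_lt_trans sN).
have ls0 : 0 <= s + phi s by rewrite addr_ge0.
have lsK0 : 0 <= (s + phi s) * K by rewrite mulr_ge0// ltW.
rewrite /sampled_path /= -/K; set q := Num.truncn _.
have qK : (q <= k.+1 * k.+1)%N.
  rewrite -(ler_nat R) natrM -/K; apply: (@le_trans _ _ ((s + phi s) * K)).
    by rewrite truncn_le.
  rewrite ler_wpM2r ?(ltW K0)//; have := p1 s.
  have : K^-1 <= 1 by rewrite invf_le1// -[1]/(1%:R) ler_nat.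
  move=> K1 ps; apply: (le_trans _ KN); apply: lerD => //.
  exact: le_trans ps K1.
rewrite (minn_idPl qK).
have cq : (c i <= q)%N.
  rewrite truncn_ge_nat// -ler_pdivrMr// -l_t ?(ltnW ir)//.
  move: ts; rewrite le_eqVlt => /predU1P[->//|ts]; apply: ltW.
  by apply: tl.1 => //; rewrite in_itv/= andbT// t_ge0// ltnW.
have qc : (q < c i.+1)%N.
  rewrite truncn_lt_nat// -ltr_pdivlMr// -l_t//.
  by apply: tl.1 => //; rewrite in_itv/= andbT// t_ge0.
have H1 : t i <= q%:R / K < t i.+1.
  rewrite ler_pdivlMr// ltr_pdivrMr//; apply/andP; split.
    have /andP[H _] := cP i (ltnW ir); apply: le_trans H _.
    by rewrite ler_nat.
  have /andP[_ H] := cP i.+1 ir; rewrite -(ltrD2r 1) natr1.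
  by apply: le_lt_trans H; rewrite ler_nat.
have := tx i _ ir H1; have := tx i s ir; rewrite ts st => /(_ isT).
by rewrite !ler_norml; lra.
Unshelve. all: by end_near. Qed.

Lemma sampled_path_cvg x : sampled_path k x @[k --> \oo] --> x.
Proof.
apply/cvg_entourageP => A [N [e [e0 NA]]]; rewrite near_simpl.
by apply: filterS (sampled_path_near x N e0) => k xk; exact: NA.
Qed.

End step_paths.

(** * Measurability of the trajectories *)

Section skorohod_measurability.
Context {R : realType} {d : measure_display} {T : measurableType d} {n : nat}
  (S : 'I_n -> R) (X : T -> skorohod R).
Hypotheses (mX : forall t : R, 0 <= t -> measurable_fun setT (fun w => X w t))
  (XS : forall w (t : R), 0 <= t -> exists i, X w t = S i).

(** Finitely many sampling times and finitely many states leave finitely many sampled paths, so [B]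
    may be arbitrary. *)
Lemma measurable_sampled_path k (B : set (skorohod R)) :
  measurable [set w | B (sampled_path k (X w))].
Proof.
pose M := (k.+1 * k.+1)%N.
pose grid (j : nat) : R := j%:R / k.+1%:R.
have grid0 j : 0 <= grid j by rewrite divr_ge0.
pose path (v : {ffun 'I_M.+1 -> 'I_n}) : skorohod R :=
  step_path (fun j => S (v (inord (minn j M)))) k.
have -> : [set w | B (sampled_path k (X w))] =
    \bigcup_(v in [set v | B (path v)])
      \bigcap_(j in [set: 'I_M.+1]) [set w | X w (grid j) = S (v j)].
  have pathE w (v : {ffun 'I_M.+1 -> 'I_n}) : (forall j : 'I_M.+1, X w (grid j) = S (v j)) ->
      sampled_path k (X w) = path v.
    move=> H; rewrite /sampled_path /path; congr (step_path _ k).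
    by apply/funext => j; rewrite -H inordK// ltnS geq_minr.
  apply/seteqP; split=> [w /= Bw|w [v /= Bv Hv]].
    have /choice[v vP] : forall j : 'I_M.+1, exists i, X w (grid j) = S i.
      by move=> j; exact: XS.
    have H (j : 'I_M.+1) : X w (grid j) = S ([ffun j => v j] j) by rewrite ffunE.
    exists [ffun j => v j]; first by rewrite /= -(pathE w).
    by move=> j _; exact: H.
  by rewrite (pathE w v)// => j; exact: Hv.
apply: fin_bigcup_measurable => // v _; apply: fin_bigcap_measurable => // j _.
have := mX (grid0 j) measurableT (measurable_set1 (S (v j))).
by rewrite setTI.
Qed.

(** A path lies in [U] iff, for some [j], its sampled paths eventually lie in the set [V j] of the
    points whose neighbourhood of index [j] is contained in [U]. This is a countable combination of
    the events of [measurable_sampled_path], where [V j] need not be measurable. *)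
Lemma measurable_skorohod_open (U : set (skorohod R)) : open U ->
  measurable (X @^-1` U).
Proof.
move=> oU.
pose V (j : nat) := [set z : skorohod R |
  forall y, skorohod_near j%:R j.+1%:R^-1 (z, y) -> U y].
have -> : X @^-1` U = \bigcup_j \bigcup_m \bigcap_(k in [set k | (m <= k)%N])
    [set w | V j (sampled_path k (X w))].
  apply/seteqP; split=> w /=.
    move=> Uw; have := open_nbhs_nbhs (conj oU Uw).
    rewrite -nbhs_entourageE => -[A entA AU].
    have [B entB BA] := entourage_split_ex entA.
    have [N [e [e0 NB]]] := entB.
    have [j [Nj je]] : exists j : nat, N <= j%:R /\ j.+1%:R^-1 <= e.
      exists (maxn (Num.truncn N).+1 (Num.truncn e^-1)); split.
        by rewrite (le_trans (ltW (truncnS_gt _)))// ler_nat leq_maxl.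
      rewrite invf_ple ?posrE//; apply: le_trans (ltW (truncnS_gt _)) _.
      by rewrite ler_nat ltnS leq_maxr.
    have [m _ mP] : \forall k \near \oo, B (X w, sampled_path k (X w)).
      by have /cvg_entourageP := @sampled_path_cvg R (X w); exact.
    exists j => //; exists m => // k /= mk y Hy; apply: AU; apply/xsectionP; apply: BA.
    exists (sampled_path k (X w)); first exact: mP.
    by apply: NB; apply: skorohod_nearS Hy.
  move=> [j _ [m _ H]].
  have entI : entourage ((skorohod_near j%:R j.+1%:R^-1 :
      set (skorohod R * skorohod R))^-1)%relation.
    apply: entourage_inv; exists j%:R, j.+1%:R^-1; split => //.
  have [m' _ m'P] : \forall k \near \oo,
      skorohod_near j%:R j.+1%:R^-1 (sampled_path k (X w), X w).
    by have /cvg_entourageP/(_ _ entI) := @sampled_path_cvg R (X w).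
  by apply: (H (maxn m m')); [rewrite /= leq_maxl|apply: m'P; rewrite /= leq_maxr].
apply: bigcup_measurable => j _; apply: bigcup_measurable => m _.
by apply: bigcap_measurable => [|k _]; [exists m => /=|exact: measurable_sampled_path].
Qed.

End skorohod_measurability.

(** * Separation of compact and closed sets *)

Section separation.
Context {R : realType}.

(** Each point of [K] has a neighbourhood on which one index [j] works, and compactness makes [j]
    uniform. The upper bound can therefore be tested on a finite horizon with a fixed precision. *)
Lemma compact_closed_separation (K A : set (skorohod R)) :
  compact K -> closed A -> K `&` A = set0 ->
  exists N e : R, [/\ 0 < N, 0 < e & forall x y, K x -> skorohod_near N e (x, y) -> ~ A y].
Proof.
move=> cK cA KA.
have H : \forall j \near \oo, K `<=` [set x | forall y,
    skorohod_near j%:R (j.+1%:R^-1) (x, y) -> ~ A y].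
  move/compact_near_coveringP : cK; apply => x Kx.
  have nAx : (~` A) x by move=> Ax; have : (K `&` A) x by []; rewrite KA.
  have := open_nbhs_nbhs (conj (closed_openC cA) nAx).
  rewrite -nbhs_entourageE => -[E entE EA].
  have [B entB BE] := entourage_split_ex entE.
  have [N [e [e0 NB]]] := entB.
  have Hj : \forall j \near \oo, N <= j%:R /\ (j.+1%:R : R)^-1 <= e.
    have h1 := @nbhs_infty_ger R N.
    have h2 := near_infty_natSinv_lt (PosNum e0).
    by apply: filterS2 h1 h2 => j -> /ltW.
  have Bx : nbhs x (xsection B x) by exact: nbhs_entourage.
  exists (xsection B x, [set j | N <= j%:R /\ (j.+1%:R : R)^-1 <= e]) => //.
  move=> [z j] /= [/xsectionP Bz [Nj je]] y zy; apply: EA; apply/xsectionP.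
  by apply: BE; exists z => //; apply: NB; exact: skorohod_nearS zy.
have [j _ jP] := H.
exists j.+1%:R, j.+2%:R^-1; split => // x y Kx xy.
exact: (jP j.+1 (leqnSn j) x Kx y xy).
Qed.

End separation.

(** * Large deviations as exponential bounds *)

Section exponential_scale.
Context {R : realType}.
Implicit Types (u : nat -> \bar R) (r : nat -> R) (p : nat -> \bar R).
Local Open Scope ereal_scope.

Lemma limn_esup_lt u (c : \bar R) : limn_esup u < c ->
  \forall n \near \oo, u n < c.
Proof.
move=> /ereal_inf_lt[_ [V Voo <-] supV].
apply: filterS Voo => n Vn; apply: le_lt_trans supV.
by apply: ereal_sup_ubound; exists n.
Qed.

Lemma limn_esup_le u (c : \bar R) : (\forall n \near \oo, u n <= c) ->
  limn_esup u <= c.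
Proof.
move=> H; apply: (@le_trans _ _ (ereal_sup (u @` [set n | u n <= c]))).
  by apply: ereal_inf_lbound; exists [set n | u n <= c].
by apply: ge_ereal_sup => _ [n /= nc <-].
Qed.

Lemma limn_einf_gt u (c : \bar R) : c < limn_einf u ->
  \forall n \near \oo, c < u n.
Proof.
move=> H; have : limn_esup (-%E \o u) < - c by rewrite limn_esupN lteN2.
by move=> /limn_esup_lt; apply: filterS => n; rewrite /= lteN2.
Qed.

Lemma limn_einf_ge u (c : \bar R) : (\forall n \near \oo, c <= u n) ->
  c <= limn_einf u.
Proof.
move=> H; rewrite -leeN2 -limn_esupN; apply: limn_esup_le.
by apply: filterS H => n; rewrite /= leeN2.
Qed.

(** The convention [lne 0 = -oo] makes this equivalence hold for [p = 0] as well, so null events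
    need no separate treatment. *)
Lemma lne_scale_le (r c : R) (p : R) : (0 < r)%R -> (0 <= p)%R ->
  (r^-1%:E * lne p%:E <= (- c)%:E) = (p <= expR (- (r * c)))%R.
Proof.
move=> r0; rewrite le_eqVlt => /predU1P[<-|p0].
  rewrite le0_lneNy// gt0_muleNy ?lte_fin ?invr_gt0// leNye.
  by rewrite ltW// expR_gt0.
rewrite lne_EFin// -EFinM lee_fin mulrC ler_pdivrMr// mulNr mulrC.
by rewrite -{2}[p]lnK ?posrE// ler_expR mulrC.
Qed.

Lemma lne_scale_ge (r c : R) (p : R) : (0 < r)%R -> (0 <= p)%R ->
  ((- c)%:E <= r^-1%:E * lne p%:E) = (expR (- (r * c)) <= p)%R.
Proof.
move=> r0; rewrite le_eqVlt => /predU1P[<-|p0].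
  rewrite le0_lneNy// gt0_muleNy ?lte_fin ?invr_gt0//.
  by rewrite [RHS]leNgt expR_gt0 /= leeNy_eq.
rewrite lne_EFin// -EFinM lee_fin mulrC ler_pdivlMr// mulNr mulrC.
by rewrite -{2}[p]lnK ?posrE// ler_expR mulrC.
Qed.

End exponential_scale.

Section LDP_bounds.
Context {R : realType} {F : topologicalType} (d : nat -> measure_display)
  (T : forall n, measurableType (d n)) (P : forall n, probability (T n) R)
  (X : forall n, T n -> F) (r : nat -> R) (I : F -> \bar R).
Arguments X : clear implicits.
Hypothesis r0 : \forall n \near \oo, 0 < r n.
Hypothesis mX : forall n, (0 < n)%N -> forall U, open U -> measurable (X n @^-1` U).

Lemma measurable_closed_preimage n (A : set F) : (0 < n)%N -> closed A ->
  measurable (X n @^-1` A).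
Proof.
move=> n0 cA; rewrite -[A]setCK -[_ @^-1` _]/(~` (X n @^-1` ~` A)).
by apply: measurableC; apply: mX => //; exact: closed_openC.
Qed.

Lemma LDP_upper_exp (A : set F) (c : R) : closed A ->
  (limn_esup (fun n => (r n)^-1%:E * lne (P n (X n @^-1` A))) <=
    - ereal_inf (I @` A))%E ->
  (c%:E < ereal_inf (I @` A))%E ->
  \forall n \near \oo, Pr (P n) (X n @^-1` A) <= expR (- (r n * c)).
Proof.
move=> cA H cI; have {}H := le_lt_trans H _.
have /limn_esup_lt lt : (limn_esup (fun n => (r n)^-1%:E * lne (P n (X n @^-1` A)))
    < (- c)%:E)%E.
  by apply: H; rewrite EFinN lteN2.
near=> n; have n0 : (0 < n)%N by near: n; exact: nbhs_infty_gt.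
rewrite -lne_scale_le ?Pr_ge0//; last by near: n.
rewrite Pr_EFin; last exact: measurable_closed_preimage.
by apply: ltW; near: n.
Unshelve. all: by end_near. Qed.

Lemma LDP_lower_exp (U : set F) (x : F) (i c : R) : open U ->
  (- ereal_inf (I @` U) <=
    limn_einf (fun n => (r n)^-1%:E * lne (P n (X n @^-1` U))))%E ->
  U x -> I x = i%:E -> i < c ->
  \forall n \near \oo, expR (- (r n * c)) <= Pr (P n) (X n @^-1` U).
Proof.
move=> oU H Ux Ix ic.
have /limn_einf_gt lt : ((- c)%:E <
    limn_einf (fun n => (r n)^-1%:E * lne (P n (X n @^-1` U))))%E.
  apply: lt_le_trans H; rewrite EFinN lteN2.
  apply: (@le_lt_trans _ _ i%:E); last by rewrite lte_fin.
  by apply: ereal_inf_lbound; exists x.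
near=> n; have n0 : (0 < n)%N by near: n; exact: nbhs_infty_gt.
rewrite -lne_scale_ge ?Pr_ge0//; last by near: n.
rewrite Pr_EFin; last exact: mX.
by apply: ltW; near: n.
Unshelve. all: by end_near. Qed.

(** A bound with arbitrary slack [eta] suffices, since levels strictly below the infimum, or above
    [I x], leave room to absorb it. Levels [c <= 0] in the upper bound follow from [Pr <= 1]. *)
Lemma LDP_exp : good_rate_function I ->
  (forall (A : set F) (c : R), closed A -> 0 < c ->
    (c%:E < ereal_inf (I @` A))%E ->
    forall eta : R, 0 < eta ->
    \forall n \near \oo, Pr (P n) (X n @^-1` A) <= expR (- (r n * (c - eta)))) ->
  (forall (U : set F) (x : F) (i eta : R), open U -> U x -> I x = i%:E -> 0 < eta ->
    \forall n \near \oo, expR (- (r n * (i + eta))) <= Pr (P n) (X n @^-1` U)) ->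
  LDP P X r I.
Proof.
move=> gI ub lb; split => //.
- move=> A cA.
  have Iinf : (0 <= ereal_inf (I @` A))%E.
    by apply: le_ereal_inf_tmp => _ [x _ <-]; exact: gI.1.
  have key (c : R) : (c%:E < ereal_inf (I @` A))%E ->
      (limn_esup (fun n => (r n)^-1%:E * lne (P n (X n @^-1` A))) <= (- c)%:E)%E.
    move=> cI; apply: limn_esup_le.
    have [c0|c0] := leP c 0.
      near=> n; have n0 : (0 < n)%N by near: n; exact: nbhs_infty_gt.
      rewrite -Pr_EFin; last exact: measurable_closed_preimage.
      have rn : 0 < r n by near: n.
      rewrite lne_scale_le ?Pr_ge0//.
      apply: (@le_trans _ _ 1); first by apply: Pr_le1; exact: measurable_closed_preimage.
      by rewrite -expR0 ler_expR oppr_ge0 mulr_ge0_le0// ltW.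
    have [c' cc' c'I] : exists2 c', c < c' & (c'%:E < ereal_inf (I @` A))%E.
      move: cI; case: (ereal_inf _) => [v| |] //=; rewrite ?lte_fin => cv.
        by exists ((c + v) / 2); rewrite ?lte_fin; lra.
      by exists (c + 1); rewrite ?ltry//; lra.
    have := ub A c' cA (lt_trans c0 cc') c'I (c' - c); rewrite subr_gt0 => /(_ cc') H.
    near=> n; have n0 : (0 < n)%N by near: n; exact: nbhs_infty_gt.
    rewrite -Pr_EFin; last exact: measurable_closed_preimage.
    rewrite lne_scale_le ?Pr_ge0//; last by near: n.
    have -> : c = c' - (c' - c) by ring.
    by near: n.
  move: key Iinf; case: (ereal_inf _) => [v| |] // key _.
    apply/lee_addgt0Pr => e e0; rewrite -EFinN -EFinD.
    have -> : - v + e = - (v - e) by ring.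
    by apply: key; rewrite lte_fin ltrBlDr ltrDl.
  rewrite leeNr leye_eq; apply/eqP/eqyP => v v0.
  by rewrite leeNr; apply: key; rewrite ltry.
- move=> U oU; rewrite leeNl; apply: le_ereal_inf_tmp => _ [x Ux <-].
  rewrite leeNl.
  have := gI.1 x; case Ix : (I x) => [i| |] // _; last by rewrite leNye.
  apply/lee_subgt0Pr => e e0; rewrite -EFinN -EFinB.
  apply: limn_einf_ge; have H := lb U x i e oU Ux Ix e0.
  near=> n; have n0 : (0 < n)%N by near: n; exact: nbhs_infty_gt.
  rewrite -Pr_EFin; last exact: mX.
  have -> : - i - e = - (i + e) by ring.
  rewrite lne_scale_ge ?Pr_ge0//; last by near: n.
  by near: n.
Unshelve. all: by end_near. Qed.

End LDP_bounds.

(** * Outer bounds and limits of events *)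

Section outer_bounds.
Context {R : realType} {d : measure_display} {T : measurableType d}
  (P : probability T R).
Implicit Types (A : set T) (B : R).

(** Events such as a bound at all times of an interval involve uncountably many times; bounding a
    measurable superset avoids proving them measurable. *)
Definition outer_le A B := exists E, [/\ measurable E, A `<=` E & Pr P E <= B].

Lemma outer_le_mono A A' B B' : A' `<=` A -> B <= B' ->
  outer_le A B -> outer_le A' B'.
Proof.
move=> AA BB [E [mE AE EB]]; exists E; split => //.
  exact: subset_trans AE.
exact: le_trans BB.
Qed.

Lemma outer_le_setU A A' B B' : outer_le A B -> outer_le A' B' ->
  outer_le (A `|` A') (B + B').
Proof.
move=> [E [mE AE EB]] [E' [mE' AE' EB']]; exists (E `|` E'); split.
- exact: measurableU.
- exact: setUSS.
- by apply: le_trans (Pr_setU P mE mE') _; exact: lerD.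
Qed.

Lemma outer_le_bigcup (I : finType) (A : I -> set T) B :
  (forall i, outer_le (A i) B) -> outer_le (\bigcup_i A i) (#|I|%:R * B).
Proof.
move=> H; have Hs (s : seq I) : outer_le (\bigcup_(i in [set i | i \in s]) A i)
    ((size s)%:R * B).
  elim: s => [|i s IH].
    exists set0; split => //; first by move=> w [].
    by rewrite mul0r /Pr measure0.
  apply: outer_le_mono (outer_le_setU (H i) IH).
    move=> w [j /=]; rewrite inE => /predU1P[->|js] Aw; first by left.
    by right; exists j.
  by rewrite /= -nat1r mulrDl mul1r.
apply: outer_le_mono (Hs (enum I)).
  by move=> w [i _ Aw]; exists i => //=; rewrite mem_enum.
by rewrite cardE.
Qed.

(** Continuity from below along the tail intersections of the measurable covers. *)
Lemma outer_le_liminf (A : nat -> set T) B J0 :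
  (forall J, (J0 <= J)%N -> outer_le (A J) B) ->
  outer_le [set w | exists j, forall J, (j <= J)%N -> A J w] B.
Proof.
move=> H.
have /choice[E EP] : forall J, exists E, measurable E /\
    ((J0 <= J)%N -> A J `<=` E /\ Pr P E <= B).
  move=> J; have [/H[E [mE AE EB]]|_] := boolP (J0 <= J)%N; first by exists E.
  by exists set0.
pose F j := \bigcap_(J in [set J | (j + J0 <= J)%N]) E J.
have mF j : measurable (F j).
  apply: bigcap_measurable => [|J _]; last exact: (EP J).1.
  by exists (j + J0)%N => /=.
have mFU : measurable (\bigcup_j F j) by exact: bigcup_measurable.
exists (\bigcup_j F j); split => //.
  move=> w [j Hj]; exists j => // J /= jJ.
  apply: ((EP J).2 _).1; first by rewrite (leq_trans _ jJ)// leq_addl.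
  by apply: Hj; rewrite (leq_trans _ jJ)// leq_addr.
have ndF : nondecreasing_seq F.
  move=> i j ij; apply/subsetPset => w Fw J /= jJ; apply: Fw => /=.
  by rewrite (leq_trans _ jJ)// leq_add2r.
have FB j : (P (F j) <= B%:E)%E.
  rewrite -Pr_EFin// lee_fin.
  have [_ /(_ (leq_addl _ _))[_ EB]] := EP (j + J0)%N.
  apply: le_trans EB; apply: le_Pr => //; first exact: (EP _).1.
  by move=> w; apply => /=.
have cvgF := nondecreasing_cvg_mu (mu := P) mF mFU ndF.
rewrite -lee_fin Pr_EFin// -(cvg_lim _ cvgF)//; apply: lime_le.
  by apply/cvg_ex; eexists; exact: cvgF.
exact: nearW.
Qed.

(** Continuity from above along the tail unions. The limsup, unlike the liminf, inherits lower
    bounds, and one good grid among infinitely many is enough in the use below. *)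
Lemma Pr_limsup (E : nat -> set T) B J0 : (forall J, measurable (E J)) ->
  (forall J, (J0 <= J)%N -> B <= Pr P (E J)) ->
  measurable [set w | forall j, exists2 J, (j <= J)%N & E J w] /\
  B <= Pr P [set w | forall j, exists2 J, (j <= J)%N & E J w].
Proof.
move=> mE EB.
pose F j := \bigcup_(J in [set J | (j <= J)%N]) E J.
have mF j : measurable (F j) by apply: bigcup_measurable.
have mFI : measurable (\bigcap_j F j) by apply: bigcapT_measurable.
have -> : [set w | forall j, exists2 J, (j <= J)%N & E J w] = \bigcap_j F j.
  apply/seteqP; split=> w /= H j.
    by move=> _; have [J jJ Ew] := H j; exists J.
  by have [J /= jJ Ew] := H j I; exists J.
split => //.
have niF : nonincreasing_seq F.
  move=> i j ij; apply/subsetPset => w [J /= jJ Ew]; exists J => //=.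
  exact: leq_trans jJ.
have cvgF : (P \o F) n @[n --> \oo] --> P (\bigcap_n F n).
  by apply: nonincreasing_cvg_mu => //; rewrite -ge0_fin_numE// fin_num_measure.
rewrite -lee_fin Pr_EFin// -(cvg_lim _ cvgF)//; apply: lime_ge.
  by apply/cvg_ex; eexists; exact: cvgF.
apply: nearW => j /=; rewrite -Pr_EFin// lee_fin.
apply: (@le_trans _ _ (Pr P (E (maxn j J0)))); first by rewrite EB// leq_maxr.
by apply: le_Pr => // w Ew; exists (maxn j J0) => //=; rewrite leq_maxl.
Qed.

End outer_bounds.

(** * Events along refining grids *)

Section refined_grids.
Context {R : realType}.
Implicit Types (p u : nat -> R).

(** Slopes constant on coarse cells of [L] fine steps telescope inside each cell; the last term is
    an incomplete cell. *)
Lemma coarse_sum (L : nat) p u k j : (j <= L)%N -> (0 < L)%N ->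
  \sum_(i < k * L + j) p (i %/ L)%N * (u i.+1 - u i) =
  \sum_(l < k) p l * (u (l.+1 * L)%N - u (l * L)%N) +
  p k * (u (k * L + j)%N - u (k * L)%N).
Proof.
move=> + L0; elim: k j => [|k IHk] j.
  rewrite big_ord0 add0r mul0n add0n; elim: j => [|j IH] jL.
    by rewrite big_ord0 subrr mulr0.
  by rewrite big_ord_recr /= IH 1?ltnW// divn_small//; ring.
elim: j => [_|j IH jL].
  rewrite addn0 subrr mulr0 addr0 [in LHS]mulSnr IHk// big_ord_recr /=.
  by rewrite mulSnr.
rewrite addnS big_ord_recr /= IH 1?ltnW//.
by rewrite divnMDl// divn_small// addn0; ring.
Qed.

Lemma near_right_harmonic (de : R) (Q : R -> Prop) : 0 < de ->
  (\forall h \near 0^'+, Q h) ->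
  exists J0, forall J, (J0 <= J)%N -> Q (de / J.+1%:R).
Proof.
move=> de0 [e /= e0 He].
exists (Num.truncn (de / e)) => J JJ.
have h0 : 0 < de / J.+1%:R by rewrite divr_gt0.
apply: He => //=; rewrite sub0r normrN gtr0_norm// ltr_pdivrMr// mulrC -ltr_pdivrMr//.
by apply: lt_le_trans (truncnS_gt _) _; rewrite ler_nat ltnS.
Qed.

Lemma refined_timeE (de : R) (J l : nat) :
  (l * J.+1)%:R * (de / J.+1%:R) = l%:R * de.
Proof.
by rewrite natrM -mulrA [J.+1%:R * _]mulrCA divff ?mulr1// pnatr_eq0.
Qed.

(** By right continuity a strict excess persists just after [t], where all fine grids have a point,
    still in cell [k]. If [t] is the right end of the cell, it belongs to every grid itself. *)
Lemma grid_exceeds (f : R -> R) (de t v c : R) (k : nat) : 0 < de ->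
  f s @[s --> t^'+] --> f t -> k%:R * de <= t <= k.+1%:R * de ->
  c < `|f t - v| -> exists J0, forall J, (J0 <= J)%N -> exists i,
    [/\ (k * J.+1 <= i)%N, (i <= k.+1 * J.+1)%N &
      c < `|f (i%:R * (de / J.+1%:R)) - v|].
Proof.
move=> de0 ft /andP[kt]; rewrite le_eqVlt => /predU1P[->|tk] cf.
  exists 0%N => J _; exists (k.+1 * J.+1)%N; split => //.
    by rewrite leq_mul2r leqnSn orbT.
  by rewrite refined_timeE.
have cv : `|f s - v| @[s --> t^'+] --> `|f t - v|.
  by apply: cvg_norm; apply: cvgB => //; exact: cvg_cst.
have [e /= e0 He] := cvgr_gt _ cv _ cf.
exists (Num.truncn (de / e)) => J JJ.
pose L := J.+1%:R : R; have L0 : 0 < L by [].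
have h0 : 0 < de / L by rewrite divr_gt0.
have he : de / L < e.
  rewrite ltr_pdivrMr// mulrC -ltr_pdivrMr//.
  by apply: lt_le_trans (truncnS_gt _) _; rewrite ler_nat ltnS.
have t0 : 0 <= t by apply: le_trans kt; rewrite mulr_ge0// ltW.
have [|i /andP[ti it]] := @nat_ceil R (t / (de / L)).
  by rewrite divr_ge0// ltW.
have tih : t <= i%:R * (de / L) by rewrite -ler_pdivrMr.
have iht : i%:R * (de / L) < t + de / L.
  by rewrite -ltr_pdivlMr// mulrDl divff// lt0r_neq0.
have kE (l : nat) : (l * J.+1)%:R * (de / L) = l%:R * de.
  exact: refined_timeE.
exists i; split.
- rewrite -(ler_nat R) -(ler_pM2r h0) kE; exact: le_trans tih.
- rewrite -ltnS -(ltr_nat R) -(ltr_pM2r h0) (lt_trans iht)//.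
  by rewrite -[in ltRHS]natr1 mulrDl mul1r kE ltrD2r.
- move: tih; rewrite le_eqVlt => /predU1P[<-//|tih]; apply: He => //=.
  by rewrite ltr0_norm ?subr_lt0// opprB ltrBlDl (lt_trans iht)// ltrD2l.
Qed.

End refined_grids.

(** * Bounds over coarse cells *)

Section cell_bounds.
Context {R : realType} (beta : R) (n : nat) (b : R)
  {d : measure_display} {T : measurableType d} (P : probability T R)
  (m : T -> skorohod R).
Hypotheses (n0 : (0 < n)%N) (b0 : 0 < b) (mP : cw_process beta n P m).
Local Notation a := (2 * (1 - beta)).
Local Notation X := (fun w => m w : R -> R).
Variables (r K Q eta N : R) (M : nat).
Hypothesis rE : r = n%:R * b ^- 2.
Hypotheses (Q0 : 0 <= Q) (eta0 : 0 < eta) (N0 : 0 < N) (M0 : (0 < M)%N).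
Hypothesis ham : forall x q, `|x| <= K -> `|q| <= Q ->
    `|cw_hamiltonian beta n b x q - (2 * q ^+ 2 - 2 * (1 - beta) * x * q)|
      <= eta.

Definition cell_time (N : R) (M k : nat) : R := k%:R * (N / M%:R).
Local Notation t := (cell_time N M).
Local Notation V k := (clock a (t k.+1) - clock a (t k)).

Definition weighted_path (a b : R) (x : skorohod R) (s : R) : R :=
  expR (a * s) * (b * x s).
Local Notation u w := (weighted_path a b (m w)).

Let de0 : 0 < N / M%:R. Proof. by rewrite divr_gt0// ltr0n. Qed.

Lemma weighted_path_rcont (a' b' : R) (x : skorohod R) (s : R) : 0 <= s ->
  weighted_path a' b' x v @[v --> s^'+] --> weighted_path a' b' x s.
Proof.
move=> s0; apply: cvgM; last by apply: cvgM; [exact: cvg_cst|exact: traj_rcont].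
by apply: cvg_at_right_filter; exact: continuous_expRM.
Qed.

Lemma fine_timeE J k : (k * J.+1)%:R * (N / M%:R / J.+1%:R) = t k.
Proof. exact: refined_timeE. Qed.

Lemma grid_scaled_cell J w k :
  grid_scaled X a (N / M%:R / J.+1%:R) b w (k * J.+1)%N = u w (t k).
Proof. by rewrite /grid_scaled fine_timeE. Qed.

Lemma coarse_tilt J (p : nat -> R) w k j : (j <= J.+1)%N ->
  let h := N / M%:R / J.+1%:R in
  \sum_(i < k * J.+1 + j) grid_tilt X a h b (fun i => p (i %/ J.+1)%N) w i =
  \sum_(l < k) (p l * (u w (t l.+1) - u w (t l)) - p l ^+ 2 * V l) +
  (p k * (grid_scaled X a h b w (k * J.+1 + j)%N - u w (t k)) -
   p k ^+ 2 * (clock a ((k * J.+1 + j)%:R * h) - clock a (t k))).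
Proof.
move=> jJ h; rewrite /grid_tilt sumrB.
rewrite (coarse_sum p (grid_scaled X a h b w) k jJ)//.
rewrite (coarse_sum (fun i => p i ^+ 2) (fun i => clock a (i%:R * h)) k jJ)//.
rewrite !grid_scaled_cell fine_timeE.
under [in LHS]eq_bigr do rewrite !grid_scaled_cell.
under [X in _ - (X + _)]eq_bigr do rewrite !fine_timeE.
by rewrite sumrB; ring.
Qed.

Lemma cell_time_le k : (k <= M)%N -> 0 <= t k <= N.
Proof.
move=> kM; rewrite /cell_time mulr_ge0 ?(ltW de0)//=.
by rewrite mulrCA ler_piMr ?(ltW N0)// ler_pdivrMr ?ltr0n// mul1r ler_nat.
Qed.

(** The sum involves the path at the nodes only, so a single fine grid suffices and no limit is
    taken. *)
Lemma tilt_bound (p : nat -> R) (G : set R) (c : R) :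
  (forall k, `|p k| * expR (`|a| * N) <= Q) ->
  outer_le P [set w | [/\ G (b * m w 0),
      forall s, 0 <= s <= N -> `|b * m w s| <= K &
      c <= \sum_(k < M) (p k * (u w (t k.+1) - u w (t k)) - p k ^+ 2 * V k)]]
    (expR (- (r * (c - 2 * eta * N))) * Pr P (start_in b m G)).
Proof.
move=> pQ.
have [J0 HJ] := near_right_harmonic de0
  (grid_upper_bound n0 b0 mP N rE Q0 eta0 ham).
have {HJ} := HJ J0 (leqnn _) (M * J0.+1)%N (fun i => p (i %/ J0.+1)%N) c G.
rewrite fine_timeE; have /andP[_ tM] := cell_time_le (leqnn M).
move=> /(_ tM (fun i => pQ _))[E [mE PE HE]].
exists E; split => // w [Gw wK wc]; apply: HE => //.
exists (M * J0.+1)%N => //; split.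
  move=> i iM; apply: wK.
  have h0 : 0 < N / M%:R / J0.+1%:R by rewrite divr_gt0.
  rewrite mulr_ge0 ?(ltW h0)//= (le_trans _ tM)// -(fine_timeE J0).
  by rewrite ler_pM2r// ler_nat ltnW.
have := coarse_tilt (J := J0) p w M (leq0n _); rewrite addn0 => ->.
by rewrite grid_scaled_cell fine_timeE !subrr !mulr0 subr0 addr0.
Qed.

Lemma unweighted_le (x : skorohod R) (s c : R) : 0 <= s <= N ->
  `|weighted_path a b x s| <= c -> `|b * x s| <= expR (`|a| * N) * c.
Proof.
move=> /andP[s0 sN] H.
have -> : b * x s = expR (- (a * s)) * weighted_path a b x s.
  by rewrite /weighted_path mulrA -expRD addNr expR0 mul1r.
rewrite normrM ger0_norm ?expR_ge0//; apply: ler_pM => //.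
rewrite ler_expR (le_trans (ler_norm _))// normrN normrM ler_wpM2l//.
by rewrite ger0_norm.
Qed.

Lemma cell_clock_gt0 k : 0 < V k.
Proof. by rewrite subr_gt0 clock_lt// ltr_pM2r// ltr_nat. Qed.

Section oscillations.
Variables (K0 rho c : R).
Hypotheses (rho0 : 0 < rho)
  (cV : forall k, (k < M)%N -> c <= rho ^+ 2 / (4 * V k))
  (QV : forall k, (k < M)%N -> rho / (2 * V k) * expR (`|a| * N) <= Q)
  (KM : expR (`|a| * N) * (K0 + M%:R * rho) <= K).

Let grid_oscillation (J : nat) : set T := [set w | `|b * m w 0| <= K0 /\
  exists i k, [/\ (k < M)%N, (k * J.+1 <= i)%N, (i <= k.+1 * J.+1)%N &
    rho < `|u w (i%:R * (N / M%:R / J.+1%:R)) - u w (t k)|]].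

(* The first failure over all cells: before it the path is bounded by [K]. *)
Let grid_oscillation_step (J : nat) w : grid_oscillation J w ->
  exists i k, [/\ (k < M)%N, (k * J.+1 < i)%N, (i <= k.+1 * J.+1)%N,
    rho < `|u w (i%:R * (N / M%:R / J.+1%:R)) - u w (t k)| &
    forall l, (l < i)%N -> `|b * m w (l%:R * (N / M%:R / J.+1%:R))| <= K].
Proof.
move=> [w0 [i0 [k0 [kM0 ki0 ik0 wi0]]]].
set h := N / M%:R / J.+1%:R in wi0 *.
have h0 : 0 < h by rewrite /h divr_gt0.
pose bad i := [exists k : 'I_M, [&& (k * J.+1 <= i)%N, (i <= k.+1 * J.+1)%N &
  rho < `|u w (i%:R * h) - u w (t k)|]].
have ex_bad : exists i, bad i.
  by exists i0; apply/existsP; exists (Ordinal kM0); rewrite /= ki0 ik0.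
case: (ex_minnP ex_bad) => i /existsP[k /and3P[ki ik wi]] imin.
have good l k' : (l < i)%N -> (k' < M)%N -> (k' * J.+1 <= l)%N ->
    (l <= k'.+1 * J.+1)%N -> `|u w (l%:R * h) - u w (t k')| <= rho.
  move=> li kM' kl lk; rewrite leNgt; apply/negP => H.
  have : bad l by apply/existsP; exists (Ordinal kM'); rewrite /= kl lk.
  by move=> /imin; rewrite leqNgt li.
have ki' : (k * J.+1 < i)%N.
  rewrite ltn_neqAle ki andbT; apply/eqP => E; move: wi.
  by rewrite -E /h fine_timeE subrr normr0 ltNge ltW.
have u_t k' : (k' <= k)%N -> `|u w (t k')| <= K0 + k'%:R * rho.
  elim: k' => [_|k' IH kk'].
    by rewrite /cell_time /weighted_path !mul0r mulr0 expR0 mul1r addr0.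
  have li : (k'.+1 * J.+1 < i)%N by rewrite (leq_ltn_trans _ ki')// leq_mul2r kk' orbT.
  have := good _ k' li; rewrite (ltn_trans kk' (ltn_ord k)) leq_mul2r leqnSn orbT leqnn.
  move=> /(_ isT isT isT); rewrite /h fine_timeE => H.
  have -> : k'.+1%:R * rho = k'%:R * rho + rho by rewrite -natr1 mulrDl mul1r.
  have := IH (ltnW kk').
  by move: H; rewrite !ler_norml; lra.
exists i, k; split => // l li; apply: le_trans KM; apply: unweighted_le.
  rewrite mulr_ge0 ?(ltW h0)//=.
  have /andP[_ tN] := cell_time_le (ltn_ord k); apply: le_trans tN.
  rewrite -(fine_timeE J) ler_pM2r// ler_nat.
  exact: leq_trans (ltnW li) ik.
have lk : (l %/ J.+1 <= k)%N by rewrite -ltnS ltn_divLR// (leq_trans li).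
have := good l (l %/ J.+1)%N li (leq_ltn_trans lk (ltn_ord k)) (leq_trunc_div _ _).
rewrite ltnW ?ltn_ceil// => /(_ isT) H1.
have H2 := u_t _ lk.
have H3 : (l %/ J.+1)%:R * rho + rho <= M%:R * rho.
  by rewrite -{2}[rho]mul1r -mulrDl natr1 ler_pM2r// ler_nat (leq_ltn_trans lk).
have -> : u w (l%:R * h) = u w (t (l %/ J.+1)) + (u w (l%:R * h) - u w (t (l %/ J.+1))).
  by ring.
apply: le_trans (ler_normD _ _) _; apply: le_trans (lerD H2 H1) _.
by rewrite -addrA lerD2l.
Qed.

(** An oscillation at an arbitrary time shows on all sufficiently fine grids, so the event lies in
    the liminf of the grid events, whose bound does not depend on [J]. *)
Let grid_oscillation_bound J0 : (forall J, (J0 <= J)%N ->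
  outer_le P (grid_oscillation J) ((2 * M)%:R * expR (- (r * (c - 2 * eta * N))))) ->
  outer_le P [set w | `|b * m w 0| <= K0 /\ exists k s, [/\ (k < M)%N,
    t k <= s <= t k.+1 & rho < `|u w s - u w (t k)|]]
  ((2 * M)%:R * expR (- (r * (c - 2 * eta * N)))).
Proof.
move=> /outer_le_liminf; apply: outer_le_mono => // w [w0 [k [s [kM ts ws]]]] /=.
have s0 : 0 <= s.
  by have /andP[H _] := cell_time_le (ltnW kM); apply: le_trans H _; case/andP: ts.
have [j Hj] := grid_exceeds de0 (@weighted_path_rcont a b (m w) s s0) ts ws.
exists j => J /Hj[i [ki ik wi]]; split => //.
by exists i, k.
Qed.

(** For each cell and each sign, the slope is [rho / (2 V)] up to sign on that cell and zero
    elsewhere. An increment beyond [rho] there brings the exponent to at least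
    [rho^2 / (2 V) - rho^2 / (4 V) >= c]; the factor [2 * M] counts these choices. *)
Lemma oscillation_bound :
  outer_le P [set w | `|b * m w 0| <= K0 /\ exists k s, [/\ (k < M)%N,
    t k <= s <= t k.+1 & rho < `|u w s - u w (t k)|]]
  ((2 * M)%:R * expR (- (r * (c - 2 * eta * N)))).
Proof.
have [J0 HJ] := near_right_harmonic de0
  (grid_upper_bound n0 b0 mP N rE Q0 eta0 ham).
apply: (grid_oscillation_bound (J0 := J0)) => J {}/HJ HJ.
pose sl (s : bool) (k : nat) : R := (-1) ^+ s * (rho / (2 * V k)).
pose p (ks : 'I_M * bool) (l : nat) : R := if l == ks.1 then sl ks.2 ks.1 else 0.
have V0 := cell_clock_gt0.
have sl_norm s k : `|sl s k| = rho / (2 * V k).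
  rewrite /sl normrM normrX normrN1 expr1n mul1r gtr0_norm//.
  by rewrite divr_gt0// mulr_gt0.
have pQ ks k : `|p ks k| * expR (`|a| * N) <= Q.
  rewrite /p; case: ifP => _; last by rewrite normr0 mul0r.
  by rewrite sl_norm QV.
have /andP[_ tM] := cell_time_le (leqnn M).
pose A (ks : 'I_M * bool) : set T := [set w | `|b * m w 0| <= K0 /\
  exists2 j, (j <= M * J.+1)%N &
    (forall i, (i < j)%N -> `|b * m w (i%:R * (N / M%:R / J.+1%:R))| <= K) /\
    c <= \sum_(i < j) grid_tilt X a (N / M%:R / J.+1%:R) b
      (fun i => p ks (i %/ J.+1)%N) w i].
have HA ks : outer_le P (A ks) (expR (- (r * (c - 2 * eta * N)))).
  have := HJ (M * J.+1)%N (fun i => p ks (i %/ J.+1)%N) c [set y | `|y| <= K0].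
  rewrite fine_timeE => /(_ tM (fun i => pQ _ _))[E [mE PE HE]].
  exists E; split => //; first by move=> w [w0 wj]; exact: HE.
  apply: le_trans PE _; rewrite ler_piMr ?expR_ge0//.
  by apply: Pr_le1; exact: (measurable_start_in b n0 mP).
apply: outer_le_mono (outer_le_bigcup HA); last first.
  by rewrite card_prod card_ord card_bool mulnC.
move=> w wJ; have [i [k [kM ki ik wi wK]]] := grid_oscillation_step wJ.
set D := u w _ - u w (t k) in wi.
have iE : i = (k * J.+1 + (i - k * J.+1))%N by rewrite subnKC// ltnW.
exists (Ordinal kM, D < 0) => //; split; first by case: wJ.
exists i; first by rewrite (leq_trans ik)// leq_mul2r kM orbT.
have jJ : (i - k * J.+1 <= J.+1)%N by rewrite leq_subLR -mulSnr.
split => //; have /= := coarse_tilt (p (Ordinal kM, D < 0)) w k jJ.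
rewrite -iE => ->; rewrite big1 ?add0r; last first.
  by move=> l _; rewrite /p /= ltn_eqF// mul0r expr0n mul0r subrr.
rewrite /p /= eqxx; set s := D < 0.
have -> : sl s k * (grid_scaled X a (N / M%:R / J.+1%:R) b w i - u w (t k)) =
    rho / (2 * V k) * `|D|.
  rewrite -[X in sl s k * X]/D /sl /s; case: ltrP => D0.
    by rewrite ltr0_norm// expr1; ring.
  by rewrite ger0_norm// expr0; ring.
have -> : sl s k ^+ 2 = (rho / (2 * V k)) ^+ 2.
  by rewrite -(sl_norm s k) real_normK// num_real.
have HV : clock a (i%:R * (N / M%:R / J.+1%:R)) - clock a (t k) <= V k.
  rewrite lerD2r clock_le// -(fine_timeE J).
  by apply: ler_wpM2r; [rewrite divr_ge0// ltW|rewrite ler_nat].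
have q0 : 0 < rho / (2 * V k) by rewrite divr_gt0// mulr_gt0.
apply: le_trans (cV kM) _.
apply: (@le_trans _ _ (rho / (2 * V k) * rho - (rho / (2 * V k)) ^+ 2 * V k)).
  rewrite le_eqVlt; apply/orP; left; apply/eqP.
  by have := lt0r_neq0 (V0 k); set v := V k => v0; field.
apply: lerB; first by rewrite ler_pM2l// ltW.
by rewrite ler_pM2l// exprn_gt0.
Qed.

End oscillations.

End cell_bounds.

(** * Bounds for a fixed number of spins *)

Section path_classes.
Context {R : realType} (beta : R).
Local Notation a := (2 * (1 - beta)).
Variables (N : R) (M : nat) (rho : R).
Hypotheses (N0 : 0 < N) (M0 : (0 < M)%N) (rho0 : 0 < rho).
Local Notation t := (cell_time N M).
Local Notation V k := (clock a (t k.+1) - clock a (t k)).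

Lemma cell_time_last : t M = N.
Proof. by rewrite /cell_time mulrC divfK// pnatr_eq0 -lt0n. Qed.

Lemma cell_time_lt k : t k < t k.+1.
Proof. by rewrite ltr_pM2r ?divr_gt0 ?ltr0n// ltr_nat. Qed.

Lemma cell_exists s : 0 <= s -> s <= N ->
  exists2 k, (k < M)%N & t k <= s <= t k.+1.
Proof.
move=> s0 sN; have [sltN|] := ltP s (t M).
  have [|k kM /andP[ks sk]] := @partition_cell _ M t s.
    by rewrite {1}/cell_time mul0r s0.
  by exists k => //; rewrite ks ltW.
rewrite cell_time_last => Ns; have sE : s = N by apply/eqP; rewrite eq_le sN.
exists M.-1; first by rewrite prednK.
by have := cell_time_lt M.-1; rewrite prednK// cell_time_last sE => /ltW ->; rewrite lexx.
Qed.

(** Rounding to a multiple of [rho / M] goes towards zero. This gives [y^2 <= y z], so the exponent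
    with the rounded slope is never below the cost of the rounded increment. *)
Lemma round_increment (z : R) : `|z| <= rho -> exists j : 'I_(M + M).+1,
  let y := (j%:R - M%:R) * (rho / M%:R) in
  [/\ y ^+ 2 <= y * z, `|z - y| <= rho / M%:R & `|y| <= rho].
Proof.
move=> zr; have M0' : 0 < M%:R :> R by rewrite ltr0n.
have s0 : 0 < rho / M%:R by rewrite divr_gt0.
pose q := Num.truncn (`|z| / (rho / M%:R)).
have /andP[q1 q2] : (q%:R <= `|z| / (rho / M%:R) < q.+1%:R).
  by apply: truncn_itv; rewrite divr_ge0// ltW.
rewrite ler_pdivlMr// in q1; rewrite ltr_pdivrMr// -natr1 mulrDl mul1r in q2.
have qM : (q <= M)%N.
  rewrite -(ler_nat R) -(ler_pM2r s0) (le_trans q1)// (le_trans zr)//.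
  by rewrite mulrC divfK// lt0r_neq0.
have qr : 0 <= q%:R * (rho / M%:R) by rewrite mulr_ge0// ltW.
have [zneg|zpos] := ltP z 0.
  have jM : (M - q < (M + M).+1)%N by rewrite ltnS (leq_trans (leq_subr _ _))// leq_addr.
  exists (Ordinal jM) => y; have yE : y = - (q%:R * (rho / M%:R)).
    by rewrite /y /= natrB//; ring.
  rewrite (ltr0_norm zneg) in q1 q2 zr.
  rewrite yE; split.
  - by rewrite sqrrN expr2 mulNr -mulrN; apply: ler_wpM2l.
  - by rewrite ler_norml; apply/andP; split; lra.
  - by rewrite normrN ger0_norm// (le_trans q1).
have jM : (M + q < (M + M).+1)%N by rewrite ltnS leq_add2l.
exists (Ordinal jM) => y; have yE : y = q%:R * (rho / M%:R).
  by rewrite /y /= natrD; ring.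
rewrite (ger0_norm zpos) in q1 q2 zr.
rewrite yE; split.
- by rewrite expr2; apply: ler_wpM2l.
- by rewrite ler_norml; apply/andP; split; lra.
- by rewrite ger0_norm// (le_trans q1).
Qed.

Definition class_step (l : {ffun 'I_M -> 'I_(M + M).+1}) (k : nat) : R :=
  if insub k is Some i then ((l i)%:R - M%:R) * (rho / M%:R) else 0.

(** The optimal slope for the rounded increment; its cost on the cell is
    [class_step l k ^+ 2 / (4 V k)]. *)
Definition class_slope l k : R := class_step l k / (2 * V k).

Definition class_cost l : R := \sum_(k < M) class_slope l k ^+ 2 * V k.

Lemma class_step_out l k : (M <= k)%N -> class_step l k = 0.
Proof. by move=> Mk; rewrite /class_step insubF// ltnNge Mk. Qed.

Lemma class_step_bound l k : `|class_step l k| <= rho.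
Proof.
rewrite /class_step; case: insubP => [i _ _|_]; last by rewrite normr0 ltW.
have M0' : 0 < M%:R :> R by rewrite ltr0n.
rewrite normrM (gtr0_norm (divr_gt0 rho0 M0')) mulrCA -[leRHS]mulr1 ler_pM2l//.
rewrite ler_pdivrMr// mul1r ler_norml; have := ltn_ord (l i).
rewrite ltnS -(ler_nat R) natrD; have : 0 <= (l i)%:R :> R by [].
by lra.
Qed.

Let cgt0 k : 0 < V k.
Proof. by rewrite subr_gt0 clock_lt// ltr_pM2r ?divr_gt0 ?ltr0n// ltr_nat. Qed.

(** The distance [4 * rho] adds up the error of the initial value, the rounding errors ([rho / M] on
    each of at most [M] cells), and the variations of [u] and of the polygonal curve within a
    cell. *)
Lemma path_class (u : R -> R) (y0 : R) :
  (forall k s, (k < M)%N -> t k <= s <= t k.+1 -> `|u s - u (t k)| <= rho) ->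
  `|u 0 - y0| <= rho ->
  exists l, class_cost l <= \sum_(k < M) (class_slope l k *
      (u (t k.+1) - u (t k)) - class_slope l k ^+ 2 * V k) /\
    forall z : R -> R,
    (forall k s, (k < M)%N -> t k <= s <= t k.+1 ->
      z s = y0 + \sum_(j < k) 2 * class_slope l j * V j +
        2 * class_slope l k * (clock a s - clock a (t k))) ->
    forall s, 0 <= s <= N -> `|u s - z s| <= 4 * rho.
Proof.
move=> osc u0.
have tS k : t k < t k.+1 by rewrite ltr_pM2r ?divr_gt0 ?ltr0n// ltr_nat.
have inc (k : 'I_M) : `|u (t k.+1) - u (t k)| <= rho.
  by apply: osc => //; rewrite lexx ltW.
have /choice[f fP] : forall k : 'I_M, exists j : 'I_(M + M).+1,
    let y := (j%:R - M%:R) * (rho / M%:R) in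
    [/\ y ^+ 2 <= y * (u (t k.+1) - u (t k)),
     `|(u (t k.+1) - u (t k)) - y| <= rho / M%:R & `|y| <= rho].
  by move=> k; exact: round_increment.
pose l := [ffun k => f k].
have lE (k : 'I_M) : class_step l k = ((f k)%:R - M%:R) * (rho / M%:R).
  by rewrite /class_step valK ffunE.
exists l; split.
  apply: ler_sum => k _; have [H1 _ _] := fP k.
  rewrite -lE in H1; have V0 := cgt0 k; rewrite lerBrDr /class_slope.
  set v := V k in V0 *; set D := _ - _ in H1 *; set y := class_step _ _ in H1 *.
  have -> : (y / (2 * v)) ^+ 2 * v + (y / (2 * v)) ^+ 2 * v = y ^+ 2 / (2 * v).
    by field; exact: lt0r_neq0.
  by rewrite [leRHS]mulrAC ler_pM2r// invr_gt0 mulr_gt0.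
move=> z zP s /andP[s0 sN].
have [k kM /andP[ks sk]] := cell_exists s0 sN.
have kI : (k < M)%N := kM.
rewrite (zP k) ?ks//.
have sumE j : (j <= M)%N ->
    `|u (t j) - u 0 - \sum_(i < j) 2 * class_slope l i * V i| <= j%:R * (rho / M%:R).
  elim: j => [_|j IH jM].
    by rewrite big_ord0 {1}/cell_time !mul0r subrr subr0 normr0.
  rewrite big_ord_recr /=; have [_ H2 _] := fP (Ordinal jM); rewrite -lE /= in H2.
  have -> : 2 * class_slope l j * V j = class_step l j.
    by rewrite /class_slope; have := lt0r_neq0 (cgt0 j); set v := V j => v0; field.
  have := IH (ltnW jM); rewrite -natr1 mulrDl mul1r; move: H2.
  by rewrite !ler_norml; lra.
have H1 := sumE k (ltnW kM).
have kr : k%:R * (rho / M%:R) <= rho.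
  by rewrite mulrCA ler_piMr ?(ltW rho0)// ler_pdivrMr ?ltr0n// mul1r ler_nat ltnW.
have H2 := osc k s kM; rewrite ks sk in H2; have {}H2 := H2 isT.
have H3 : `|2 * class_slope l k * (clock a s - clock a (t k))| <= rho.
  apply: le_trans (class_step_bound l k).
  have -> : class_step l k = 2 * class_slope l k * V k.
    by rewrite /class_slope; have := lt0r_neq0 (cgt0 k); set v := V k => v0; field.
  rewrite ![`|_ * (_ - _)|]normrM ler_wpM2l// ger0_norm ?subr_ge0 ?clock_le//.
  by rewrite ger0_norm ?(ltW (cgt0 k))// lerB// clock_le.
move: u0 H1 H2 H3; set S := \sum_(_ < _) _; set W := _ * (clock a s - _).
by rewrite !ler_norml; lra.
Qed.

End path_classes.

(** * Union bound over the classes of paths *)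

Section class_bounds.
Context {R : realType} (beta : R) (n : nat) (b : R)
  {d : measure_display} {T : measurableType d} (P : probability T R)
  (m : T -> skorohod R).
Hypotheses (n0 : (0 < n)%N) (b0 : 0 < b) (mP : cw_process beta n P m).
Local Notation a := (2 * (1 - beta)).
Variables (r K Q eta N : R) (M : nat).
Hypothesis rE : r = n%:R * b ^- 2.
Hypotheses (Q0 : 0 <= Q) (eta0 : 0 < eta) (N0 : 0 < N) (M0 : (0 < M)%N).
Hypothesis ham : forall x q, `|x| <= K -> `|q| <= Q ->
    `|cw_hamiltonian beta n b x q - (2 * q ^+ 2 - 2 * (1 - beta) * x * q)|
      <= eta.
Local Notation t := (cell_time N M).
Local Notation V k := (clock a (t k.+1) - clock a (t k)).
Local Notation u w := (weighted_path a b (m w)).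

Variables (K0 rho c cosc e B : R) (I0 : R -> \bar R) (A : set (skorohod R))
  (I : nat) (y : 'I_I -> R) (J : 'I_I -> set R).
Hypotheses (rho0 : 0 < rho)
  (cV : forall k, (k < M)%N -> cosc <= rho ^+ 2 / (4 * V k))
  (QV : forall k, (k < M)%N -> rho / (2 * V k) * expR (`|a| * N) <= Q)
  (KM : expR (`|a| * N) * (K0 + M%:R * rho) <= K).
Hypotheses (cover : forall x, `|x| <= K0 -> exists i, J i x)
  (Jy : forall i x, J i x -> `|x - y i| <= rho)
  (I00 : forall x, (0 <= I0 x)%E)
  (sep : forall x z, (cw_rate beta I0 x <= c%:E)%E -> skorohod_near N e (x, z) ->
    ~ A z)
  (rhoe : expR (`|a| * N) * (4 * rho) <= e)
  (B0 : 0 <= B)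
  (classB : forall i (l : {ffun 'I_M -> 'I_(M + M).+1}), (c%:E < I0 (y i) + (class_cost beta N rho l)%:E)%E ->
    expR (- (r * (class_cost beta N rho l - 2 * eta * N))) *
      Pr P (start_in b m (J i)) <= B).

(** A class matters only if its polygonal curve, started at the representative [y i], costs more
    than [c]: otherwise the curve lies in the sublevel set and the path, within [e] of it, cannot be
    in [A]. Each remaining class is bounded by [tilt_bound] with its own slopes. *)
Lemma class_union_bound :
  outer_le P [set w | A (skorohod_scale b (m w)) /\ `|b * m w 0| <= K0]
    ((2 * M)%:R * expR (- (r * (cosc - 2 * eta * N))) +
     #|{: 'I_I * {ffun 'I_M -> 'I_(M + M).+1}}|%:R * B).
Proof.
have V0 k : 0 < V k by exact: cell_clock_gt0.
pose cost := @class_cost R beta N M rho; pose p := @class_slope R beta N M rho.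
pose C (il : 'I_I * {ffun 'I_M -> 'I_(M + M).+1}) : set T :=
  [set w | (c%:E < I0 (y il.1) + (cost il.2)%:E)%E /\
    [/\ J il.1 (b * m w 0), forall s, 0 <= s <= N -> `|b * m w s| <= K &
      cost il.2 <= \sum_(k < M) (p il.2 k * (u w (t k.+1) - u w (t k)) -
        p il.2 k ^+ 2 * V k)]].
have pQ l k : `|p l k| * expR (`|a| * N) <= Q.
  rewrite /p /class_slope; have [kM|Mk] := ltnP k M; last first.
    by rewrite class_step_out// mul0r normr0 mul0r.
  apply: le_trans (QV kM); rewrite ler_wpM2r ?expR_ge0// normrM normfV.
  have vp : 0 < 2 * V k by rewrite mulr_gt0.
  by rewrite (gtr0_norm vp) ler_pM2r ?invr_gt0//; exact: class_step_bound.
have HC il : outer_le P (C il) B.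
  case: il => i l; have [h|h] := pselect (c%:E < I0 (y i) + (cost l)%:E)%E; last first.
    exists set0; split => //; first by move=> w [].
    by rewrite /Pr measure0.
  have := tilt_bound n0 b0 mP rE Q0 eta0 N0 M0 ham (J i) (cost l) (pQ l).
  apply: outer_le_mono; last exact: classB.
  by move=> w [_].
have H1 := oscillation_bound n0 b0 mP rE Q0 eta0 N0 M0 ham rho0 cV QV KM.
apply: outer_le_mono (outer_le_setU H1 (outer_le_bigcup HC)) => // w [Aw w0].
have [wosc|wosc] := pselect (exists k s, [/\ (k < M)%N, t k <= s <= t k.+1 &
    rho < `|u w s - u w (t k)|]); first by left.
right; have {}wosc k s : (k < M)%N -> t k <= s <= t k.+1 ->
    `|u w s - u w (t k)| <= rho.
  by move=> kM ks; rewrite leNgt; apply/negP => H; apply: wosc; exists k, s.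
have u0E : u w 0 = b * m w 0 by rewrite /weighted_path mulr0 expR0 mul1r.
have [i Ji] := cover w0.
have [||l [l1 l2]] := @path_class R beta N M rho N0 M0 rho0 (u w) (y i).
- exact: wosc.
- by rewrite u0E; exact: Jy.
exists (i, l) => //; split.
  rewrite /= ltNge; apply/negP => H.
  have [|||x [x1 x2]] := @polygonal_path R beta I0 (y i) t (p l) M.
  + by rewrite /cell_time mul0r.
  + by move=> k; exact: cell_time_lt.
  + exact: I00.
  have {}l2 := l2 _ x1.
  apply: (@sep x (skorohod_scale b (m w))) Aw; first exact: le_trans x2 H.
  have e0 : 0 <= e by apply: le_trans rhoe; rewrite mulr_ge0 ?expR_ge0// mulr_ge0// ltW.
  apply: uniform_skorohod_near => // s /andP[s0 sN].
  have := l2 s; rewrite s0 sN => /(_ isT) H4.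
  have -> : skorohod_scale b (m w) s - x s =
      expR (- (a * s)) * (u w s - expR (a * s) * x s).
    by rewrite /weighted_path -mulrBr mulrA -expRD addNr expR0 mul1r.
  apply: le_trans rhoe; rewrite normrM ger0_norm ?expR_ge0//; apply: ler_pM => //.
  rewrite ler_expR (le_trans (ler_norm _))// normrN normrM ler_wpM2l//.
  by rewrite ger0_norm.
split => // s /andP[s0 sN]; apply: le_trans KM; apply: unweighted_le.
  by rewrite s0.
have u_t k : (k <= M)%N -> `|u w (t k)| <= K0 + k%:R * rho.
  elim: k => [_|k IH kM]; first by rewrite {1}/cell_time !mul0r addr0 u0E.
  have := wosc k (t k.+1) kM; rewrite lexx ltW ?cell_time_lt// => /(_ isT).
  have := IH (ltnW kM).
  have -> : k.+1%:R * rho = k%:R * rho + rho by rewrite -natr1 mulrDl mul1r.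
  by rewrite !ler_norml; lra.
have [k kM ks] := cell_exists N0 M0 s0 sN.
have := wosc k s kM ks; have := u_t k (ltnW kM).
have : k%:R * rho + rho <= M%:R * rho.
  by rewrite -{2}[rho]mul1r -mulrDl natr1 ler_pM2r// ler_nat.
by rewrite !ler_norml; lra.
Qed.

End class_bounds.

(** * Probability of a tube *)

Section tube_bounds.
Context {R : realType} (beta : R) (n : nat) (b : R)
  {d : measure_display} {T : measurableType d} (P : probability T R)
  (m : T -> skorohod R).
Hypotheses (n0 : (0 < n)%N) (b0 : 0 < b) (mP : cw_process beta n P m).
Local Notation a := (2 * (1 - beta)).
Local Notation X := (fun w => m w : R -> R).
Variables (r K Q eta N : R) (M : nat).
Hypothesis rE : r = n%:R * b ^- 2.
Hypotheses (Q0 : 0 <= Q) (eta0 : 0 < eta) (N0 : 0 < N) (M0 : (0 < M)%N).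
Hypothesis ham : forall x q, `|x| <= K -> `|q| <= Q ->
    `|cw_hamiltonian beta n b x q - (2 * q ^+ 2 - 2 * (1 - beta) * x * q)|
      <= eta.
Local Notation t := (cell_time N M).
Local Notation V k := (clock a (t k.+1) - clock a (t k)).
Local Notation u w := (weighted_path a b (m w)).

Variables (v : R -> R) (p : nat -> R) (rho rho2 th La : R).
Hypotheses (rho0 : 0 <= rho) (rho20 : 0 < rho2) (th0 : 0 < th)
  (v_rcont : forall s, 0 <= s -> v z @[z --> s^'+] --> v s)
  (v_osc : forall k s, (k < M)%N -> t k <= s <= t k.+1 -> `|v s - v (t k)| <= rho)
  (pE : forall k, (k < M)%N -> v (t k.+1) - v (t k) = 2 * p k * V k)
  (pQ : forall k, (`|p k| + th) * expR (`|a| * N) <= Q)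
  (KM : expR (`|a| * N) * (`|v 0| + 2 * rho2 + (M%:R + 1) * rho) <= K)
  (LaE : \sum_(k < M) p k ^+ 2 * V k + 2 * rho2 * \sum_(k < M) `|p k| <= La).

Let V0 k : 0 < V k. Proof. exact: cell_clock_gt0. Qed.

Let cell_drift k s : (k < M)%N -> t k <= s <= t k.+1 ->
  `|2 * p k * (clock a s - clock a (t k))| <= rho.
Proof.
move=> kM /andP[ks sk]; apply: (@le_trans _ _ `|2 * p k * V k|); last first.
  by rewrite -pE//; apply: v_osc => //; rewrite lexx ltW// cell_time_lt.
rewrite ![`|_ * (_ - _)|]normrM ler_wpM2l// ger0_norm ?subr_ge0 ?clock_le//.
by rewrite ger0_norm ?(ltW (V0 k))// lerB// clock_le.
Qed.

Let drift_sum k : (k <= M)%N -> \sum_(l < k) 2 * p l * V l = v (t k) - v 0.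
Proof.
elim: k => [_|k IH kM]; first by rewrite big_ord0 /cell_time mul0r subrr.
by rewrite big_ord_recr /= IH 1?ltnW// -pE//; ring.
Qed.

Let v_cell k : (k <= M)%N -> `|v (t k) - v 0| <= k%:R * rho.
Proof.
elim: k => [_|k IH kM]; first by rewrite /cell_time !mul0r subrr normr0.
have -> : k.+1%:R * rho = k%:R * rho + rho by rewrite -natr1 mulrDl mul1r.
have := IH (ltnW kM); have := v_osc kM (s := t k.+1).
rewrite lexx ltW ?cell_time_lt// => /(_ isT).
by rewrite !ler_norml; lra.
Qed.

Let de0 : 0 < N / M%:R. Proof. by rewrite divr_gt0// ltr0n. Qed.

Lemma coarse_drift J k j : (j <= J.+1)%N ->
  let h := N / M%:R / J.+1%:R in
  \sum_(i < k * J.+1 + j) 2 * p (i %/ J.+1)%N * clock_step a h i =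
  \sum_(l < k) 2 * p l * V l +
  2 * p k * (clock a ((k * J.+1 + j)%:R * h) - clock a (t k)).
Proof.
move=> jJ h.
rewrite (coarse_sum (fun i => 2 * p i) (fun i => clock a (i%:R * h)) k jJ)//.
rewrite fine_timeE; congr (_ + _); apply: eq_bigr => l _.
by rewrite !fine_timeE.
Qed.

(** The event is the limsup of the grid events. A path leaving the tube at some time would leave it
    on all sufficiently fine grids, so infinitely many good grids exclude this. The radius is made
    of the deviation and the initial distance ([rho2] each) and of the variations of the drift and
    of [v] within a cell ([rho] each). *)
Lemma tube_lower_bound : exists E, [/\ measurable E,
  expR (- (r * La)) * ((expR (- (4 * r * eta * N)) -
    2 * expR (- (r * (th * rho2 - th ^+ 2 * clock a N)) + 2 * r * eta * N)) *
    Pr P (start_in b m [set y | `|y - v 0| < rho2])) <= Pr P E &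
  forall w, E w -> forall s, 0 <= s <= N -> `|u w s - v s| <= 2 * rho2 + 2 * rho].
Proof.
have [J0 HJ] := near_right_harmonic de0
  (grid_lower_bound n0 b0 mP N rE Q0 eta0 ham).
pose h J := N / M%:R / J.+1%:R.
have h0 J : 0 < h J by rewrite /h divr_gt0.
pose q J i := p (i %/ J.+1)%N.
set B := expR _ * _.
have cell_fine J k i : (k * J.+1 <= i)%N -> (i <= k.+1 * J.+1)%N ->
    t k <= i%:R * h J <= t k.+1.
  move=> ki ik; apply/andP; split; rewrite -(fine_timeE N M J) -/(h J).
    by apply: ler_wpM2r; [exact: ltW|rewrite ler_nat].
  by apply: ler_wpM2r; [exact: ltW|rewrite ler_nat].
have /choice[E EP] : forall J, exists E, measurable E /\ ((J0 <= J)%N ->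
    B <= Pr P E /\ forall w, E w -> `|b * m w 0 - v 0| < rho2 /\
      forall j, (j <= M * J.+1)%N -> `|grid_deviation beta b m (h J) (q J) w j| < rho2).
  move=> J; have [JJ|_] := boolP (J0 <= J)%N; last by exists set0.
  have := HJ J JJ (M * J.+1)%N (q J) th rho2 La [set y | `|y - v 0| < rho2].
  rewrite fine_timeE cell_time_last// => /(_ (lexx _) (fun i => pQ _) th0 rho20).
  case.
  - move=> j x0 y jM /= x0v H; apply: le_trans KM.
    pose k := (j %/ J.+1)%N; pose j' := (j %% J.+1)%N.
    have jE : j = (k * J.+1 + j')%N by rewrite /k /j' -divn_eq.
    have j'J : (j' <= J.+1)%N by rewrite ltnW// ltn_pmod.
    have kM : (k <= M)%N by rewrite -(leq_pmul2r (ltn0Sn J)) (leq_trans _ jM)// jE leq_addr.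
    have := coarse_drift k j'J; rewrite -jE drift_sum// => dr.
    move: H; rewrite dr => H.
    have H2 : `|2 * p k * (clock a (j%:R * h J) - clock a (t k))| <= rho.
      (* The end of the grid opens a cell [M] for which no bound on the drift is available, but its
         share of the drift is zero. *)
      move: kM; rewrite leq_eqVlt => /predU1P[kM|kM].
        have j0 : j' = 0%N.
          apply/eqP; rewrite -leqn0 -(leq_add2l (k * J.+1)) -jE addn0.
          by rewrite (leq_trans jM)// kM.
        by rewrite jE j0 addn0 fine_timeE subrr mulr0 normr0.
      apply: cell_drift => //; apply: cell_fine.
        exact: leq_trunc_div.
      by apply: ltnW; exact: ltn_ceil.
    have H3 := v_cell kM.
    have kMr : k%:R * rho <= M%:R * rho by rewrite ler_wpM2r// ler_nat.
    have jN : 0 <= j%:R * h J <= N.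
      rewrite mulr_ge0 ?(ltW (h0 _))//= -[leRHS](cell_time_last N M0).
      rewrite -(fine_timeE N M J) -/(h J).
      by apply: ler_wpM2r; [exact: ltW|rewrite ler_nat].
    rewrite -[y]mul1r; have /andP[jN0 jN1] := jN.
    have -> : 1 * y = expR (- (a * (j%:R * h J))) * (expR (a * (j%:R * h J)) * y).
      by rewrite mulrA -expRD addNr expR0.
    rewrite normrM ger0_norm ?expR_ge0//; apply: ler_pM => //.
      rewrite ler_expR (le_trans (ler_norm _))// normrN normrM ler_wpM2l//.
      by rewrite ger0_norm.
    set Y := expR _ * y in H *; set W := 2 * p k * _ in H H2.
    have H4 := le_trans H3 kMr; rewrite (mulrDl M%:R 1 rho) mul1r.
    set Mr := M%:R * rho in H4 *; set S := v (t k) in H H4.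
    have H5 := lexx `|v 0|; move: H H2 H4 x0v H5; rewrite !ltr_norml !ler_norml.
    by move=> /andP[? ?] /andP[? ?] /andP[? ?] /andP[? ?] /andP[? ?]; apply/andP; split; lra.
  - move=> D D0 HD; apply: le_trans LaE.
    have cs := coarse_sum (fun i => p i ^+ 2) (fun i => clock a (i%:R * h J)) M (leq0n J.+1) isT.
    have cD := coarse_sum p D M (leq0n J.+1) isT.
    rewrite addn0 subrr mulr0 addr0 in cs; rewrite addn0 subrr mulr0 addr0 in cD.
    rewrite big_split /= cD.
    have -> : \sum_(i < M * J.+1) q J i ^+ 2 * clock_step a (h J) i =
        \sum_(l < M) p l ^+ 2 * V l.
      by rewrite -[LHS]/(\sum_(i < M * J.+1) _) cs; apply: eq_bigr => l _; rewrite !fine_timeE.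
    (* Inside the tube the deviation changes by at most [2 * rho2] over a cell, whence the second
       term of [LaE]. *)
    rewrite addrC lerD2l mulr_sumr; apply: ler_sum => l _.
    apply: le_trans (ler_norm _) _; rewrite normrM mulrC ler_wpM2r//.
    have d1 := HD (l.+1 * J.+1)%N; rewrite leq_mul2r ltn_ord orbT in d1.
    have d2 := HD (l * J.+1)%N; rewrite leq_mul2r (ltnW (ltn_ord l)) orbT in d2.
    have {}d1 := d1 isT; have {}d2 := d2 isT.
    apply: (le_trans (ler_normB _ _)); rewrite mulr2n mulrDl mul1r.
    by apply: lerD; exact: ltW.
  - by move=> E [mE EB EP]; exists E.
have [mE BE] := @Pr_limsup _ _ _ P E B J0 (fun J => (EP J).1)
  (fun J JJ => ((EP J).2 JJ).1).
eexists; split; [exact: mE|exact: BE|move=> w Ew s /andP[s0 sN]].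
rewrite leNgt; apply/negP => Hs.
have [k kM ks] := cell_exists N0 M0 s0 sN.
pose f z := u w z - v z.
have fr : f z @[z --> s^'+] --> f s.
  by apply: cvgB; [exact: weighted_path_rcont|exact: v_rcont].
have fs : 2 * rho2 + 2 * rho < `|f s - 0| by rewrite subr0.
have [j0 Hj0] := grid_exceeds de0 fr ks fs.
have [J jJ EJ] := Ew (maxn j0 J0).
have [i [ki ik]] := Hj0 J (leq_trans (leq_maxl _ _) jJ).
have [_ /(_ w EJ)[w0 wdev]] := (EP J).2 (leq_trans (leq_maxr _ _) jJ).
have iM : (i <= M * J.+1)%N by rewrite (leq_trans ik)// leq_mul2r kM orbT.
have {wdev} := wdev i iM.
have iE : i = (k * J.+1 + (i - k * J.+1))%N by rewrite subnKC.
have jJ' : (i - k * J.+1 <= J.+1)%N by rewrite leq_subLR -mulSnr.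
have dr := coarse_drift k jJ'; rewrite -iE drift_sum ?(ltnW kM)// in dr.
rewrite /grid_deviation dr => H1.
have H2 := cell_drift kM (cell_fine J k i ki ik).
have H3 := v_osc kM (cell_fine J k i ki ik).
rewrite subr0 /f ltNge => /negP; apply.
rewrite -/(h J); set z := i%:R * h J in H1 H2 H3 *.
have UE : grid_scaled X a (h J) b w i = u w z by [].
rewrite UE in H1; set W := 2 * p k * _ in H1 H2.
have -> : u w z - v z = (u w z - b * m w 0 - (v (t k) - v 0 + W)) +
  (b * m w 0 - v 0) + W - (v z - v (t k)) by ring.
apply: (le_trans (ler_normB _ _)).
have -> : 2 * rho2 + 2 * rho = rho2 + rho2 + rho + rho by ring.
apply: lerD => //; apply: (le_trans (ler_normD _ _)); apply: lerD => //.
by apply: (le_trans (ler_normD _ _)); apply: lerD; exact: ltW.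
Qed.

End tube_bounds.

(** * Asymptotic bounds *)

Section upper_asymptotics.
Context {R : realType} (beta : R) (hbeta : 0 <= beta)
    (d : nat -> measure_display) (T : forall n, measurableType (d n))
    (P : forall n, probability (T n) R) (m : forall n, T n -> skorohod R)
    (b : nat -> R) (I0 : R -> \bar R).
Arguments m : clear implicits.
Hypotheses (hm : forall n, (0 < n)%N -> cw_process beta n (P n) (m n))
    (b_gt0 : forall n, (0 < n)%N -> 0 < b n)
    (b_oo : b n @[n --> \oo] --> +oo)
    (b_small : (b n) ^+ 2 * n%:R^-1 @[n --> \oo] --> (0 : R))
    (hI0 : LDP P (fun n w => b n * m n w 0) (fun n => n%:R * (b n) ^- 2) I0).
Local Notation a := (2 * (1 - beta)).
Local Notation r n := (n%:R * (b n) ^- 2 : R).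

Lemma speed_cvg (C : R) : \forall n \near \oo, C <= r n.
Proof.
pose C' := `|C| + 1; have C'0 : 0 < C' by rewrite ltr_wpDl.
have C'V : 0 < C'^-1 by rewrite invr_gt0.
have /cvgrPdist_lt/(_ _ C'V) H := b_small.
near=> n; have n0 : (0 < n)%N by near: n; exact: nbhs_infty_gt.
have bn0 := b_gt0 n0.
have r0 : 0 < (b n) ^+ 2 * n%:R^-1 by rewrite mulr_gt0 ?exprn_gt0 ?invr_gt0 ?ltr0n.
have : `|0 - (b n) ^+ 2 * n%:R^-1| < C'^-1 by near: n.
rewrite sub0r normrN gtr0_norm// => lt.
have -> : r n = ((b n) ^+ 2 * n%:R^-1)^-1 by rewrite invf_div.
apply: (@le_trans _ _ C'); first by rewrite /C' (le_trans (ler_norm _))// lerDl.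
by rewrite -[C']invrK lef_pV2 ?posrE// ltW.
Unshelve. all: by end_near. Qed.

Lemma hamiltonian_eventually (K Q eta : R) : 0 < eta ->
  \forall n \near \oo, forall x q, `|x| <= K -> `|q| <= Q ->
    `|cw_hamiltonian beta n (b n) x q - (2 * q ^+ 2 - 2 * (1 - beta) * x * q)| <= eta.
Proof.
move=> eta0; have [B HB] := cw_hamiltonian_cvg hbeta K Q eta0.
have /cvgryPge/(_ B) bB := b_oo.
near=> n; have n0 : (0 < n)%N by near: n; exact: nbhs_infty_gt.
by apply: HB => //; [near: n|exact: b_gt0].
Unshelve. all: by end_near. Qed.

Lemma expR_absorb (C eta : R) : 0 < eta ->
  \forall n \near \oo, C <= expR (r n * eta).
Proof.
move=> eta0; have H := speed_cvg (C / eta).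
near=> n; have : C / eta <= r n by near: n.
rewrite ler_pdivrMr// => /le_trans; apply.
by apply: le_trans (expR_ge1Dx _); rewrite lerDr.
Unshelve. all: by end_near. Qed.

(** A class of paths needs one initial value that serves both as the start of its polygonal curve
    and, up to [eta], as the initial cost of the whole interval. *)
Lemma near_minimizer (G : set R) (eta : R) : 0 < eta -> G !=set0 ->
  exists2 y, G y & forall z : R, (z%:E < I0 y)%E ->
    ((z - eta)%:E < ereal_inf (I0 @` G))%E.
Proof.
move=> eta0 [y0 Gy0]; have inf0 : (0 <= ereal_inf (I0 @` G))%E.
  by apply: le_ereal_inf_tmp => _ [x _ <-]; case: hI0 => -[+ _ _ _ _]; exact.
case E : (ereal_inf _) inf0 => [v| |] // _; last by exists y0 => // z _; rewrite ltry.
have /ereal_inf_lt[_ [y Gy <-] Iy] : (ereal_inf (I0 @` G) < (v + eta)%:E)%E.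
  by rewrite E lte_fin ltrDl.
exists y => // z /lt_trans/(_ Iy); rewrite !lte_fin; lra.
Qed.

Lemma cell_clock_le (N : R) (M k : nat) : 0 < N -> (0 < M)%N -> (k < M)%N ->
  clock a (cell_time N M k.+1) - clock a (cell_time N M k) <=
  2 * expR (`|2 * a| * N) * (N / M%:R).
Proof.
move=> N0 M0 kM; have /andP[t0 _] := cell_time_le N0 M0 (ltnW kM).
have /andP[_ tN] := cell_time_le N0 M0 kM.
apply: le_trans (clock_lipschitz beta t0 (ltW (cell_time_lt N0 M0 k)) tN) _.
have -> // : cell_time N M k.+1 - cell_time N M k = N / M%:R.
by rewrite /cell_time -mulrBl -natr1 addrAC subrr add0r mul1r.
Qed.

Lemma measurable_path n : (0 < n)%N -> forall U, open U ->
  measurable ((fun w => skorohod_scale (b n) (m n w)) @^-1` U).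
Proof.
move=> n0 U oU; have [mX XS _] := hm n0.
apply: (@measurable_skorohod_open _ _ _ _ (fun i : 'I_n.+1 => b n * cw_state R i)) => //.
  by move=> s s0 /=; apply: measurable_funM => //; exact: mX.
by move=> w s s0; have [i wi] := XS w s s0; exists i; rewrite /= wi.
Qed.

(** The constants depend on one another in this order: [c] determines [N] and [e], these [rho], then
    [M], [Q] and [eta]. Only then does [n] grow, with finitely many classes whose number is absorbed
    in [expR (r n * (eta0 / 2))]. *)
Lemma cw_upper_bound (A : set (skorohod R)) (c eta0 : R) : closed A -> 0 < c ->
  (c%:E < ereal_inf (cw_rate beta I0 @` A))%E -> 0 < eta0 ->
  \forall n \near \oo,
    Pr (P n) ((fun w => skorohod_scale (b n) (m n w)) @^-1` A) <=
    expR (- (r n * (c - eta0))).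
Proof.
move=> cA c0 cI eta00; have [gI0 mI0 ubI0 _] := hI0.
have r_gt0 : \forall n \near \oo, 0 < r n.
  by apply: filterS (speed_cvg 1) => n; exact: lt_le_trans.
have [N [e [N0 e0 sep]]] : exists N e : R, [/\ 0 < N, 0 < e & forall x y,
    (cw_rate beta I0 x <= c%:E)%E -> skorohod_near N e (x, y) -> ~ A y].
  apply: compact_closed_separation cA _; first exact: ((cw_rate_good beta gI0).2 c (ltW c0)).
  rewrite -subset0 => x /= [xc Ax]; have : (cw_rate beta I0 x <= c%:E)%E := xc.
  apply/negP; rewrite -ltNge; apply: lt_le_trans cI _.
  by apply: ereal_inf_lbound; exists x.
have [K0 [K00 K0P]] : exists K0 : R, 0 < K0 /\ forall y, (I0 y <= c%:E)%E -> `|y| < K0.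
  have [B [_ HB]] := compact_bounded (gI0.2 c (ltW c0)).
  exists (`|B| + 2); split; first by rewrite ltr_wpDl.
  move=> y Iy; apply: (@le_lt_trans _ _ (`|B| + 1)); last by rewrite ltrD2l ltr1n.
  by apply: HB => //; rewrite (le_lt_trans (ler_norm _))// ltrDl.
have cl0 : closed [set y : R | K0 <= `|y|].
  have -> : [set y : R | K0 <= `|y|] = (fun y : R => `|y|) @^-1` [set y | K0 <= y] by [].
  by apply: closed_comp; [move=> y _; exact: norm_continuous|exact: closed_ge].
have init : \forall n \near \oo, Pr (P n) (start_in (b n) (m n) [set y | K0 <= `|y|]) <=
    expR (- (r n * (c - eta0 / 2))).
  apply: (LDP_upper_exp (T := T) (P := P) r_gt0 mI0 _ (ubI0 _ _)).
  - exact: cl0.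
  - exact: cl0.
  - apply: (@lt_le_trans _ _ c%:E); first by rewrite lte_fin; lra.
    apply: le_ereal_inf_tmp => _ [y /= Ky <-]; rewrite leNgt; apply/negP => /ltW/K0P.
    by rewrite ltNge Ky.
have [rho rhoE] : {rho : R | rho = e / (4 * expR (`|a| * N))} by exact: exist.
have rho0 : 0 < rho by rewrite rhoE divr_gt0// mulr_gt0// expR_gt0.
have rhoe : expR (`|a| * N) * (4 * rho) <= e.
  rewrite rhoE le_eqVlt; apply/orP; left; apply/eqP; field.
  by rewrite lt0r_neq0// expR_gt0.
have [L LE] : {L : R | L = 2 * expR (`|2 * a| * N)} by exact: exist.
have L0 : 0 < L by rewrite LE mulr_gt0// expR_gt0.
(* With this many cells the clock of a cell is small enough for an oscillation to cost [c + 1]; the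
   extra 1 pays for the error [2 * eta * N]. *)
have [M [M0 MP]] : exists M : nat, (0 < M)%N /\ 4 * L * N * (c + 1) <= M%:R * rho ^+ 2.
  exists (Num.truncn (4 * L * N * (c + 1) / rho ^+ 2)).+1; split => //.
  rewrite -ler_pdivrMr ?exprn_gt0//; exact: ltW (truncnS_gt _).
pose V k := clock a (cell_time N M k.+1) - clock a (cell_time N M k).
have V0 k : 0 < V k by exact: cell_clock_gt0.
have cV k : (k < M)%N -> c + 1 <= rho ^+ 2 / (4 * V k).
  move=> kM; rewrite ler_pdivlMr ?mulr_gt0//.
  have := cell_clock_le N0 M0 kM; rewrite -LE -/(V k) => VL.
  have M0' : 0 < M%:R :> R by rewrite ltr0n.
  have {}VL : V k * M%:R <= L * N by rewrite mulrA -ler_pdivlMr// in VL *.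
  rewrite -(ler_pM2r M0') [leRHS]mulrC; apply: le_trans MP.
  have -> : (c + 1) * (4 * V k) * M%:R = 4 * (c + 1) * (V k * M%:R) by ring.
  have -> : 4 * L * N * (c + 1) = 4 * (c + 1) * (L * N) by ring.
  by apply: ler_wpM2l => //; lra.
have [Q QE] : {Q : R | Q = (\sum_(k < M) rho / (2 * V k)) * expR (`|a| * N)} by exact: exist.
have qV0 k : 0 <= rho / (2 * V k) by rewrite divr_ge0 ?(ltW rho0)// mulr_ge0// ltW.
have Q0 : 0 <= Q by rewrite QE mulr_ge0 ?expR_ge0// sumr_ge0.
have QV k : (k < M)%N -> rho / (2 * V k) * expR (`|a| * N) <= Q.
  move=> kM; rewrite QE ler_wpM2r ?expR_ge0// (bigD1 (Ordinal kM))//= lerDl.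
  by rewrite sumr_ge0.
have [eta [eta_gt0 eta1 eta2]] : exists eta : R,
    [/\ 0 < eta, 2 * eta * N <= 1 & 2 * eta * N <= eta0 / 4].
  exists (Num.min 1 (eta0 / 4) / (2 * N)).
  have -> : 2 * (Num.min 1 (eta0 / 4) / (2 * N)) * N = Num.min 1 (eta0 / 4).
    by field; exact: lt0r_neq0.
  rewrite divr_gt0 ?mulr_gt0// ?lt_min ?ltr01 ?divr_gt0//.
  by rewrite !ge_min !lexx orbT.
(* Intervals of length [rho] covering [[- K0, K0]], taken closed so that the upper bound for the
   initial values applies to them. *)
pose I := (Num.truncn (2 * K0 / rho)).+1.
pose J (i : 'I_I) : set R := [set x | - K0 + i%:R * rho <= x <= - K0 + i.+1%:R * rho].
have cover x : `|x| <= K0 -> exists i, J i x.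
  rewrite ler_norml => /andP[x1 x2].
  have iI : (Num.truncn ((x + K0) / rho) < I)%N.
    by rewrite ltnS le_truncn// ler_pM2r ?invr_gt0//; lra.
  exists (Ordinal iI) => /=.
  have xr0 : 0 <= (x + K0) / rho by rewrite divr_ge0 ?(ltW rho0)//; lra.
  have /andP[] := truncn_itv xr0; rewrite ler_pdivlMr// ltr_pdivrMr// => H1 H2.
  by apply/andP; split; lra.
have J0 i : J i !=set0.
  by exists (- K0 + i%:R * rho); rewrite /J/= lexx/= lerD2l ler_pM2r// ler_nat.
have eta4 : 0 < eta0 / 4 by rewrite divr_gt0.
have /choice[y yP] : forall i, exists y, J i y /\ forall z : R, (z%:E < I0 y)%E ->
    ((z - eta0 / 4)%:E < ereal_inf (I0 @` J i))%E.
  by move=> i; have [y Jy yz] := near_minimizer eta4 (J0 i); exists y.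
have Jy i x : J i x -> `|x - y i| <= rho.
  have [+ _] := yP i; rewrite /J/= -natr1 mulrDl mul1r => /andP[? ?] /andP[? ?].
  by rewrite ler_norml; apply/andP; split; lra.
have cJ i : closed (J i).
  rewrite /J; have -> : [set x | - K0 + i%:R * rho <= x <= - K0 + i.+1%:R * rho] =
      `[- K0 + i%:R * rho, - K0 + i.+1%:R * rho]%classic.
    by apply/seteqP; split => x; rewrite /= in_itv.
  exact: itv_closed.
pose cost := @class_cost R beta N M rho.
have classes : \forall n \near \oo, forall il : 'I_I * {ffun 'I_M -> 'I_(M + M).+1},
    (c%:E < I0 (y il.1) + (cost il.2)%:E)%E ->
    Pr (P n) (start_in (b n) (m n) (J il.1)) <=
    expR (- (r n * (c - cost il.2 - eta0 / 4))).
  apply: filter_forall => -[i l] /=.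
  have [h|h] := pselect (c%:E < I0 (y i) + (cost l)%:E)%E; last first.
    by apply: filterS filterT => n _ /h.
  have {}h : ((c - cost l)%:E < I0 (y i))%E by rewrite EFinB lteBlDr.
  have [_ /(_ _ h) hJ] := yP i.
  by apply: filterS (LDP_upper_exp (T := T) (P := P) r_gt0 mI0 (cJ i) (ubI0 _ (cJ i)) hJ).
have eta20 : 0 < eta0 / 2 by rewrite divr_gt0.
have absorb := expR_absorb (1 + (2 * M)%:R +
  #|{: 'I_I * {ffun 'I_M -> 'I_(M + M).+1}}|%:R) eta20.
have ham := hamiltonian_eventually (expR (`|a| * N) * (K0 + M%:R * rho)) Q eta_gt0.
near=> n.
have n0 : (0 < n)%N by near: n; exact: nbhs_infty_gt.
have rn0 : 0 < r n by near: n.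
have mn := hm n0; have bn0 := b_gt0 n0.
have hamn : forall x q, `|x| <= expR (`|a| * N) * (K0 + M%:R * rho) -> `|q| <= Q ->
    `|cw_hamiltonian beta n (b n) x q - (2 * q ^+ 2 - 2 * (1 - beta) * x * q)| <= eta.
  by near: n.
have initn : Pr (P n) (start_in (b n) (m n) [set y | K0 <= `|y|]) <=
    expR (- (r n * (c - eta0 / 2))) by near: n.
have classn : forall il : 'I_I * {ffun 'I_M -> 'I_(M + M).+1},
    (c%:E < I0 (y il.1) + (cost il.2)%:E)%E ->
    Pr (P n) (start_in (b n) (m n) (J il.1)) <=
    expR (- (r n * (c - cost il.2 - eta0 / 4))) by near: n.
have absn : 1 + (2 * M)%:R + #|{: 'I_I * {ffun 'I_M -> 'I_(M + M).+1}}|%:R <=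
    expR (r n * (eta0 / 2)) by near: n.
have B0 : 0 <= expR (- (r n * (c - eta0 / 2))) by exact: expR_ge0.
have classB i (l : {ffun 'I_M -> 'I_(M + M).+1}) :
    (c%:E < I0 (y i) + (class_cost beta N rho l)%:E)%E ->
    expR (- (r n * (class_cost beta N rho l - 2 * eta * N))) *
      Pr (P n) (start_in (b n) (m n) (J i)) <= expR (- (r n * (c - eta0 / 2))).
  move=> h; have {h}h := classn (i, l) h.
  apply: (le_trans (ler_wpM2l (expR_ge0 _) h)); rewrite -expRD ler_expR /=.
  rewrite -/(cost l) -opprD lerN2 -mulrDr ler_pM2l//; lra.
have := class_union_bound n0 bn0 mn erefl Q0 eta_gt0 N0 M0 hamn rho0
  cV QV (lexx _) cover Jy gI0.1 sep rhoe B0 classB.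
move=> U1.
have U2 : outer_le (P n) (start_in (b n) (m n) [set y | K0 <= `|y|])
    (expR (- (r n * (c - eta0 / 2)))).
  by exists (start_in (b n) (m n) [set y | K0 <= `|y|]); split => //;
    exact: (measurable_start_in (b n) n0 mn).
have [E [mE AE PE]] := outer_le_setU U1 U2.
have mA := measurable_closed_preimage (T := T) measurable_path n0 cA.
apply: (@le_trans _ _ (Pr (P n) E)).
  apply: le_Pr => //; apply: subset_trans AE => w Aw.
  have [w0|w0] := leP `|b n * m n w 0| K0; first by left.
  by right; exact: ltW.
apply: (le_trans PE).
apply: (@le_trans _ _ ((1 + (2 * M)%:R + #|{: 'I_I * {ffun 'I_M -> 'I_(M + M).+1}}|%:R) *
    expR (- (r n * (c - eta0 / 2))))).
  set B := expR (- (r n * (c - eta0 / 2))); set m2 : R := (2 * M)%:R.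
  set q : R := #|_|%:R.
  have -> : (1 + m2 + q) * B = m2 * B + q * B + B by ring.
  rewrite !lerD2r; apply: ler_wpM2l; first exact: ler0n.
  by rewrite ler_expR lerN2 ler_pM2l//; lra.
apply: (le_trans (ler_wpM2r (expR_ge0 _) absn)); rewrite -expRD ler_expR.
by rewrite le_eqVlt; apply/orP; left; apply/eqP; field; rewrite lt0r_neq0.
Unshelve. all: by end_near. Qed.

End upper_asymptotics.

(** * The lower bound *)

Section lower_asymptotics.
Context {R : realType} (beta : R) (hbeta : 0 <= beta)
    (d : nat -> measure_display) (T : forall n, measurableType (d n))
    (P : forall n, probability (T n) R) (m : forall n, T n -> skorohod R)
    (b : nat -> R) (I0 : R -> \bar R).
Arguments m : clear implicits.
Hypotheses (hm : forall n, (0 < n)%N -> cw_process beta n (P n) (m n))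
    (b_gt0 : forall n, (0 < n)%N -> 0 < b n)
    (b_oo : b n @[n --> \oo] --> +oo)
    (b_small : (b n) ^+ 2 * n%:R^-1 @[n --> \oo] --> (0 : R))
    (hI0 : LDP P (fun n w => b n * m n w 0) (fun n => n%:R * (b n) ^- 2) I0).
Local Notation a := (2 * (1 - beta)).
Local Notation r n := (n%:R * (b n) ^- 2 : R).

Lemma cw_lower_bound (U : set (skorohod R)) (x : skorohod R) (i eta0 : R) :
  open U -> U x -> cw_rate beta I0 x = i%:E -> 0 < eta0 ->
  \forall n \near \oo, expR (- (r n * (i + eta0))) <=
    Pr (P n) ((fun w => skorohod_scale (b n) (m n w)) @^-1` U).
Proof.
move=> oU Ux Ix eta00; have [gI0 mI0 _ lbI0] := hI0.
have r_gt0 : \forall n \near \oo, 0 < r n.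
  by apply: filterS (speed_cvg b_gt0 b_small 1) => n; exact: lt_le_trans.
have [N [e [N0 e0 near_U]]] : exists N e : R, [/\ 0 < N, 0 < e &
    forall y, skorohod_near N e (x, y) -> U y].
  have := open_nbhs_nbhs (conj oU Ux).
  rewrite -nbhs_entourageE => -[A [N [e [e0 NA]]] AU].
  exists (Num.max N 1), e; rewrite lt_max ltr01 orbT; split => // y xy; apply: AU.
  by apply/xsectionP; apply: NA; apply: skorohod_nearS xy; rewrite // le_max lexx.
have i_ge0 : 0 <= i by have := cw_rate_ge0 beta gI0 x; rewrite Ix lee_fin.
have xi : (cw_rate beta I0 x <= i%:E)%E by rewrite Ix.
have [g [xg gi]] := cw_rate_finite xi.
have [i0 i0E] : exists i0, I0 (x 0) = i0%:E :> \bar R.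
  by have := cw_rate_init xi; have := gI0.1 (x 0); case: (I0 (x 0)) => [z| |]//; exists z.
rewrite i0E in gi.
have energy : (\int[lebesgue_measure]_(s in `[0%R, +oo[)
    (cw_lagrangian beta (x s) (g s))%:E <= (i - i0)%:E)%E.
  by rewrite EFinB leeBrDl.
pose v := weighted_path a 1 x.
have vE s : v s = expR (a * s) * x s by rewrite /v /weighted_path mul1r.
have v0 : v 0 = x 0 by rewrite vE mulr0 expR0 mul1r.
have [rho rhoE] : {rho : R | rho = e / (4 * expR (`|a| * N))} by exact: exist.
have rho0 : 0 < rho by rewrite rhoE divr_gt0// mulr_gt0// expR_gt0.
have rhoe : expR (`|a| * N) * (4 * rho) <= e.
  rewrite rhoE le_eqVlt; apply/orP; left; apply/eqP; field.
  by rewrite lt0r_neq0// expR_gt0.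
have [L LE] : {L : R | L = 2 * expR (`|2 * a| * N)} by exact: exist.
have L0 : 0 < L by rewrite LE mulr_gt0// expR_gt0.
(* By [cw_rate_modulus], a cell of clock at most [L * N / M] then moves [v] by at most [rho]. *)
have [M [M0 MP]] : exists M : nat, (0 < M)%N /\ 4 * i * (L * N) <= M%:R * rho ^+ 2.
  exists (Num.truncn (4 * i * (L * N) / rho ^+ 2)).+1; split => //.
  rewrite -ler_pdivrMr ?exprn_gt0//; exact: ltW (truncnS_gt _).
have M0' : 0 < M%:R :> R by rewrite ltr0n.
pose t := cell_time N M.
pose V k := clock a (t k.+1) - clock a (t k).
have V0 k : 0 < V k by exact: cell_clock_gt0.
have VL k : (k < M)%N -> V k * M%:R <= L * N.
  move=> kM; have := cell_clock_le beta N0 M0 kM; rewrite -LE -/(V k) => VL.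
  by rewrite mulrA -ler_pdivlMr// in VL *.
have t_ge0 k : 0 <= t k by rewrite /t /cell_time mulr_ge0// divr_ge0// ltW.
have v_osc k s : (k < M)%N -> t k <= s <= t k.+1 -> `|v s - v (t k)| <= rho.
  move=> kM /andP[ks sk]; apply: sqr_le_norm; first exact: ltW.
  rewrite !vE; apply: le_trans (cw_rate_modulus gI0 xi (t_ge0 k) ks) _.
  apply: (@le_trans _ _ (4 * i * V k)).
    by apply: ler_wpM2l; [rewrite mulr_ge0|rewrite lerB// clock_le].
  rewrite -(ler_pM2r M0') [leRHS]mulrC; apply: le_trans MP.
  rewrite -[leLHS]mulrA; apply: ler_wpM2l; first by rewrite mulr_ge0.
  exact: VL.
pose p k := if (k < M)%N then (v (t k.+1) - v (t k)) / (2 * V k) else 0.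
have pE k : (k < M)%N -> v (t k.+1) - v (t k) = 2 * p k * V k.
  by move=> kM; rewrite /p kM; have := lt0r_neq0 (V0 k); set w := V k => w0; field.
have cost_le : \sum_(k < M) p k ^+ 2 * V k <= i - i0.
  rewrite -lee_fin; apply: le_trans energy.
  have := @tilt_sum_le_energy R beta x g p t M xg.
  rewrite {1}/t /cell_time mul0r => /(_ erefl) H.
  apply: le_trans (H _); last by move=> k; exact: ltW (cell_time_lt N0 M0 k).
  rewrite lee_fin le_eqVlt; apply/orP; left; apply/eqP; apply: eq_bigr => k _.
  by rewrite -!vE pE//; rewrite -/(V k); ring.
pose S1 := \sum_(k < M) `|p k|.
have S10 : 0 <= S1 by rewrite sumr_ge0.
(* The tube has to be narrow for two reasons: to stay within [e] of the curve, and to keep its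
   excess cost [2 * rho2 * S1] small. *)
have [rho2 [rho20 rho2r rho2S]] : exists rho2 : R,
    [/\ 0 < rho2, rho2 <= rho & 2 * rho2 * S1 <= eta0 / 4].
  have S1p : 0 < S1 + 1 by rewrite ltr_wpDl.
  exists (Num.min rho (eta0 / 8 / (S1 + 1))); split.
  - by rewrite lt_min rho0 !divr_gt0.
  - by rewrite ge_min lexx.
  - apply: (@le_trans _ _ (2 * (eta0 / 8 / (S1 + 1)) * (S1 + 1))).
      apply: ler_pM => //; last by rewrite lerDl.
        by rewrite mulr_ge0// le_min ltW//= !divr_ge0// ltW.
      by rewrite ler_pM2l// ge_min lexx orbT.
    by rewrite -mulrA divfK ?lt0r_neq0//; lra.
have C0 : 0 < clock a N by rewrite -(clock0 a) clock_lt.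
(* This maximizes [th * rho2 - th ^+ 2 * clock a N], the gain on leaving the tube; [ka] is the
   maximum. *)
have [th thE] : {th : R | th = rho2 / (2 * clock a N)} by exact: exist.
have th0 : 0 < th by rewrite thE divr_gt0// mulr_gt0.
have [ka kaE] : {ka : R | ka = rho2 ^+ 2 / (4 * clock a N)} by exact: exist.
have ka0 : 0 < ka by rewrite kaE divr_gt0 ?exprn_gt0// mulr_gt0.
have thka : th * rho2 - th ^+ 2 * clock a N = ka.
  by rewrite thE kaE; field; exact: lt0r_neq0.
have [Q QE] : {Q : R | Q = (S1 + th) * expR (`|a| * N)} by exact: exist.
have Q0 : 0 <= Q by rewrite QE mulr_ge0 ?expR_ge0// addr_ge0// ltW.
have pQ k : (`|p k| + th) * expR (`|a| * N) <= Q.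
  rewrite QE ler_wpM2r ?expR_ge0// lerD2r.
  have [kM|Mk] := boolP (k < M)%N; last by rewrite /p (negbTE Mk) normr0.
  by rewrite /S1 (bigD1 (Ordinal kM))//= lerDl sumr_ge0.
(* The first bound leaves [ka / 2] of the gain after all generator errors (4 from the lower
   estimate, 2 from the upper one); the second keeps the lower estimate within the slack. *)
have [eta [eta_gt0 eta1 eta2]] : exists eta : R,
    [/\ 0 < eta, 6 * (eta * N) <= ka / 2 & 4 * (eta * N) <= eta0 / 8].
  exists (Num.min (ka / 12) (eta0 / 32) / N); rewrite divfK ?lt0r_neq0//.
  split; first by rewrite divr_gt0// lt_min !divr_gt0.
    apply: (@le_trans _ _ (6 * (ka / 12))); last by lra.
    by rewrite ler_pM2l// ge_min lexx.
  apply: (@le_trans _ _ (4 * (eta0 / 32))); last by lra.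
  by rewrite ler_pM2l// ge_min lexx orbT.
pose G : set R := [set y | `|y - v 0| < rho2].
have oG : open G.
  have -> : G = ball (v 0) rho2 by apply/seteqP; split => y; rewrite /G /= /ball /= distrC.
  exact: ball_open.
have Gx : G (x 0) by rewrite /G /= v0 subrr normr0.
have init : \forall n \near \oo, expR (- (r n * (i0 + eta0 / 4))) <=
    Pr (P n) (start_in (b n) (m n) G).
  apply: (LDP_lower_exp (T := T) (P := P) r_gt0 mI0 oG (lbI0 _ oG) Gx i0E).
  by rewrite ltrDl divr_gt0.
have ka20 : 0 < ka / 2 by rewrite divr_gt0.
have eta80 : 0 < eta0 / 8 by rewrite divr_gt0.
have absorb4 := expR_absorb b_gt0 b_small 4 ka20.
have absorb2 := expR_absorb b_gt0 b_small 2 eta80.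
pose K := expR (`|a| * N) * (`|v 0| + 2 * rho2 + (M%:R + 1) * rho).
have ham := hamiltonian_eventually hbeta b_gt0 b_oo K Q eta_gt0.
near=> n.
have n0 : (0 < n)%N by near: n; exact: nbhs_infty_gt.
have rn0 : 0 < r n by near: n.
have mn := hm n0; have bn0 := b_gt0 n0.
have hamn : forall y q, `|y| <= K -> `|q| <= Q ->
    `|cw_hamiltonian beta n (b n) y q - (2 * q ^+ 2 - 2 * (1 - beta) * y * q)| <= eta.
  by near: n.
have initn : expR (- (r n * (i0 + eta0 / 4))) <= Pr (P n) (start_in (b n) (m n) G).
  by near: n.
have abs4 : 4 <= expR (r n * (ka / 2)) by near: n.
have abs2 : 2 <= expR (r n * (eta0 / 8)) by near: n.
have LaE : \sum_(k < M) p k ^+ 2 * V k + 2 * rho2 * \sum_(k < M) `|p k| <=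
    i - i0 + eta0 / 4 by exact: lerD.
have vr s : 0 <= s -> v z @[z --> s^'+] --> v s by exact: weighted_path_rcont.
have [E [mE PE EU]] := tube_lower_bound n0 bn0 mn erefl Q0 eta_gt0 N0 M0 hamn
  (ltW rho0) rho20 th0 vr v_osc pE pQ (lexx _) LaE.
rewrite thka in PE.
apply: (@le_trans _ _ (Pr (P n) E)); last first.
  apply: le_Pr => //; first exact: (measurable_path b hm n0 oU).
  move=> w Ew; apply: near_U; apply: uniform_skorohod_near; first exact: ltW.
  move=> s /andP[s0 sN]; have := EU w Ew s; rewrite s0 sN vE => /(_ isT) H.
  have -> : skorohod_scale (b n) (m n w) s - x s =
      expR (- (a * s)) * (weighted_path a (b n) (m n w) s - expR (a * s) * x s).
    by rewrite /weighted_path -mulrBr mulrA -expRD addNr expR0 mul1r.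
  apply: le_trans rhoe; rewrite normrM ger0_norm ?expR_ge0//; apply: ler_pM => //.
    rewrite ler_expR (le_trans (ler_norm _))// normrN normrM ler_wpM2l//.
    by rewrite ger0_norm.
  by apply: (le_trans H); lra.
apply: le_trans PE.
set X := expR (- (4 * r n * eta * N)).
have X0 : 0 <= X by exact: expR_ge0.
(* Leaving the tube takes at most half of the mass, because [4 <= expR (r n * (ka / 2))]. *)
have half : X / 2 <= X - 2 * expR (- (r n * ka) + 2 * r n * eta * N).
  have : 4 * expR (- (r n * ka) + 2 * r n * eta * N) <= X.
    apply: (le_trans (ler_wpM2r (expR_ge0 _) abs4)); rewrite -expRD ler_expR.
    have := ler_wpM2l (ltW rn0) eta1; set z := r n; nra.
  lra.
have B1 : X / 2 * expR (- (r n * (i0 + eta0 / 4))) <=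
    (X - 2 * expR (- (r n * ka) + 2 * r n * eta * N)) *
      Pr (P n) (start_in (b n) (m n) [set y | `|y - v 0| < rho2]).
  by apply: ler_pM => //; rewrite ?divr_ge0// expR_ge0.
apply: le_trans (ler_wpM2l (expR_ge0 _) B1).
rewrite -(ler_pM2r (ltr0Sn R 1)).
have -> : expR (- (r n * (i - i0 + eta0 / 4))) * (X / 2 * expR (- (r n * (i0 + eta0 / 4)))) * 2 =
   expR (- (r n * (i - i0 + eta0 / 4)) + - (4 * r n * eta * N) + - (r n * (i0 + eta0 / 4))).
  by rewrite !expRD -/X; field.
rewrite mulrC; apply: (le_trans (ler_wpM2r (expR_ge0 _) abs2)); rewrite -expRD ler_expR.
have := ler_wpM2l (ltW rn0) eta2; have := mulr_gt0 rn0 eta00; set z := r n; nra.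
Unshelve. all: by end_near. Qed.

End lower_asymptotics.

Theorem theorem2p3 (R : realType) (beta : R) (hbeta : 0 <= beta)
    (d : nat -> measure_display) (T : forall n, measurableType (d n))
    (P : forall n, probability (T n) R) (m : forall n, T n -> skorohod R)
    (hm : forall n, (0 < n)%N -> cw_process beta n (P n) (m n))
    (b : nat -> R) (b_gt0 : forall n, (0 < n)%N -> 0 < b n)
    (b_oo : b n @[n --> \oo] --> +oo)
    (b_small : (b n) ^+ 2 * n%:R^-1 @[n --> \oo] --> 0)
    (I0 : R -> \bar R)
    (hI0 : LDP P (fun n w => b n * m n w 0) (fun n => n%:R * (b n) ^- 2) I0) :
  LDP P (fun n w => skorohod_scale (b n) (m n w)) (fun n => n%:R * (b n) ^- 2)
    (cw_rate beta I0).
Proof.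
apply: LDP_exp.
- by apply: filterS (speed_cvg b_gt0 b_small 1) => n; exact: lt_le_trans.
- exact: (measurable_path b hm).
- by apply: cw_rate_good; case: hI0.
- by move=> A c cA c0 cI eta0; exact: (cw_upper_bound hbeta hm b_gt0 b_oo b_small hI0).
- by move=> U x i eta0; exact: (cw_lower_bound hbeta hm b_gt0 b_oo b_small hI0).
Qed.
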